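(* Every Gauss–Bonnet-admissible holonomy signature on the sphere is realizable. That is, let $C=\{c_1,\dots,c_n\}\subset S^2$ be distinct points, let $m_1,\dots,m_n>-4$ be integers with $\sum_im_i=-8$, and let $\rho\colon H_1(S^2\setminus C;\mathbb{Z})\to\mathbb{Z}_4$ be a homomorphism with $\rho(\gamma_i)=m_i\bmod4$ for all $i$; then there is a seamless parametrization of $(S^2,C)$ with signature $(m,\rho)$.
   Context: $\mathbb{Z}_4=\mathbb{Z}/4\mathbb{Z}$ is identified with the group of quarter turns ($1$ is rotation by $\pi/2$); $\gamma_i$ is a small positively oriented loop around $c_i$. A seamless parametrization of $(M,C)$, for a closed oriented surface $M$ and finite $C\subset M$, is a locally injective (orientation-preserving) atlas on $M\setminus C$ with values in $\mathbb{R}^2=\mathbb{C}$ whose transition maps have the form $z\mapsto i^kz+t$, and whose cone angles (for the induced flat metric) at the points of $C$ are multiples of $\pi/2$. Its holonomy signature consists of the orders $m_i$, where the cone angle at $c_i$ is $(m_i+4)\pi/2$, together with the rotational holonomy $\rho$: $\rho(\gamma)=k$ if the composite transition along $\gamma$ has rotation part $i^k$. A signature is realizable if some seamless parametrization has it. *)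

(* Defs.v *)
From HB Require Import structures.
From mathcomp Require Import all_boot all_order all_algebra.
From mathcomp Require Import complex.
From mathcomp.multinomials Require Import freeg.
From mathcomp Require Import all_classical all_reals all_analysis.

Set Implicit Arguments.
Unset Strict Implicit.
Unset Printing Implicit Defensive.

Import Order.TTheory GRing.Theory Num.Theory numFieldNormedType.Exports.

Local Open Scope classical_set_scope.
Local Open Scope ring_scope.

Definition stdsimplex (R : realType) (n : nat) : set 'rV[R]_n.+1 :=
  [set x | (forall i, 0 <= x 0 i) /\ \sum_i x 0 i = 1].
Arguments stdsimplex : clear implicits.

Definition face_row (R : realType) (n : nat) (i : 'I_n.+2) (x : 'rV[R]_n.+1) :
    'rV[R]_n.+2 :=
  \row_j (if unlift i j is Some k then x 0 k else 0).

Lemma face_row_stdsimplex (R : realType) (n : nat) (i : 'I_n.+2)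
  (x : stdsimplex R n) : face_row i (set_val x) \in stdsimplex R n.+1.
Proof.
have [x0 x1] := set_valP x; apply/mem_set; split=> [j|].
  by rewrite mxE; case: unliftP.
rewrite (bigD1_ord i) //= mxE unlift_none add0r -[RHS]x1.
by apply: eq_bigr => k _; rewrite mxE liftK.
Qed.

Definition face_fun (R : realType) (n : nat) (i : 'I_n.+2)
    (x : stdsimplex R n) : stdsimplex R n.+1 :=
  exist _ (face_row i (set_val x)) (face_row_stdsimplex i x).

Lemma continuous_row (R : realType) (T : topologicalType) (n : nat)
  (f : T -> 'rV[R]_n) :
  (forall j, continuous (fun x => f x 0 j)) -> continuous f.
Proof.
move=> fc x A /= [P Pf PA]; apply: filterS PA _.
have : forall i j, \forall y \near x, P i j (f y i j).
  by move=> i j; rewrite (ord1 i); apply: fc; rewrite -(ord1 i); exact: Pf.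
move=> H; apply: filter_forall => i; apply: filter_forall => j; exact: H.
Qed.

Lemma continuous_face_fun (R : realType) (n : nat) (i : 'I_n.+2) :
  continuous (@face_fun R n i).
Proof.
apply: continuous_comp_initial; apply: continuous_row => j.
rewrite [X in continuous X](_ : _ = fun y : stdsimplex R n =>
  if unlift i j is Some k then set_val y 0 k else 0); last first.
  by apply/funext => y; rewrite mxE.
case: (unlift i j) => [k|] x; last by apply: cst_continuous.
apply: (@continuous_comp _ _ _ set_val (fun u : 'rV[R]_n.+1 => u 0 k)).
  exact: initial_continuous.
exact: coord_continuous.
Qed.

Definition face (R : realType) (n : nat) (i : 'I_n.+2) :
    continuousType (stdsimplex R n) (stdsimplex R n.+1) :=
  mkcts (@continuous_face_fun R n i).
Arguments face : clear implicits.

Definition simplex (R : realType) (X : topologicalType) (n : nat) :=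
  continuousType (stdsimplex R n) X.

Definition chain (R : realType) (X : topologicalType) (n : nat) :=
  {freeg (simplex R X n)}.

Definition boundary (R : realType) (X : topologicalType) (n : nat) :
    chain R X n.+1 -> chain R X n :=
  fglift (fun s : simplex R X n.+1 =>
    \sum_(i < n.+2) (-1) ^+ i *: << (s \o face R n i : simplex R X n) >>).

Lemma boundary_is_additive (R : realType) (X : topologicalType) (n : nat) :
  zmod_morphism (@boundary R X n).
Proof. exact: lift_is_additive. Qed.

HB.instance Definition _ (R : realType) (X : topologicalType) (n : nat) :=
  GRing.isZmodMorphism.Build (chain R X n.+1) (chain R X n)
    (@boundary R X n) (@boundary_is_additive R X n).

Definition is_cycle (R : realType) (X : topologicalType) (z : chain R X 1) :
    bool :=
  boundary z == 0.

Lemma is_cycle_zmod_closed (R : realType) (X : topologicalType) :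
  zmod_closed (@is_cycle R X).
Proof.
split=> [|y z]; rewrite !unfold_in /is_cycle ?raddf0 // => /eqP y0 /eqP z0.
by rewrite raddfB /= y0 z0 subrr.
Qed.

HB.instance Definition _ (R : realType) (X : topologicalType) :=
  GRing.isZmodClosed.Build (chain R X 1) (@is_cycle R X)
    (@is_cycle_zmod_closed R X).

Record cycle1 (R : realType) (X : topologicalType) := Cycle1 {
  cycle_chain : chain R X 1;
  cycle_chainP : cycle_chain \in @is_cycle R X }.
Arguments cycle1 : clear implicits.

HB.instance Definition _ (R : realType) (X : topologicalType) :=
  [isSub for @cycle_chain R X].
HB.instance Definition _ (R : realType) (X : topologicalType) :=
  [Choice of cycle1 R X by <:].
HB.instance Definition _ (R : realType) (X : topologicalType) :=
  [SubChoice_isSubZmodule of cycle1 R X by <:].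

Definition is_boundary (R : realType) (X : topologicalType)
    (z : cycle1 R X) : bool :=
  `[< exists d : chain R X 2, cycle_chain z = boundary d >].

Lemma is_boundary_zmod_closed (R : realType) (X : topologicalType) :
  zmod_closed (@is_boundary R X).
Proof.
split=> [|y z].
  by apply/asboolP; exists 0; rewrite !raddf0.
move=> /asboolP[d yd] /asboolP[e ze]; apply/asboolP.
by exists (d - e); rewrite !raddfB /= yd ze.
Qed.

HB.instance Definition _ (R : realType) (X : topologicalType) :=
  GRing.isZmodClosed.Build (cycle1 R X) (@is_boundary R X)
    (@is_boundary_zmod_closed R X).

Definition H1 (R : realType) (X : topologicalType) : zmodType :=
  @Quotient.quot (cycle1 R X)
    (GRing.ZmodClosed.clone (cycle1 R X) (@is_boundary R X) _).
Arguments H1 : clear implicits.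

Lemma continuous_stdsimplex1_coord (R : realType) :
  continuous (fun x : stdsimplex R 1 => set_val x 0 ord_max).
Proof.
move=> x.
apply: (@continuous_comp _ _ _ set_val (fun u : 'rV[R]_2 => u 0 ord_max)).
  exact: initial_continuous.
exact: coord_continuous.
Qed.

Definition stdsimplex1_coord (R : realType) : continuousType (stdsimplex R 1) R :=
  mkcts (@continuous_stdsimplex1_coord R).

(* Only the values on [0, 1] matter: a loop [0, 1] -> X extends to the real
   line by constants. *)
Record loop (R : realType) (X : topologicalType) := Loop {
  loop_fun :> continuousType R X;
  loop_closed : loop_fun 0 = loop_fun 1 }.
Arguments loop : clear implicits.

Definition loop_simplex (R : realType) (X : topologicalType) (g : loop R X) :
    simplex R X 1 :=
  loop_fun g \o stdsimplex1_coord R.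

Lemma loop_simplex_is_cycle (R : realType) (X : topologicalType)
  (g : loop R X) : << loop_simplex g >> \in @is_cycle R X.
Proof.
rewrite unfold_in /is_cycle /boundary liftU scale1r big_ord_recl big_ord1.
rewrite expr0 expr1 scale1r scaleN1r subr_eq0; apply/eqP.
congr (<< _ >>); apply/continuousEP => x /=.
have x1 : set_val x 0 0 = 1 :> R.
  by have [_] := set_valP x; rewrite big_ord1.
rewrite /mkcts /face_fun /= !mxE.
case: unliftP => [k kE|//]; case: unliftP => [l lE|_].
  by have := congr1 val lE; rewrite /= (ord1 l).
by rewrite (ord1 k) x1 loop_closed.
Qed.

Definition loop_cycle (R : realType) (X : topologicalType) (g : loop R X) :
    cycle1 R X :=
  Cycle1 (loop_simplex_is_cycle g).

Definition loop_class (R : realType) (X : topologicalType) (g : loop R X) :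
    H1 R X :=
  \pi_(H1 R X)%qT (loop_cycle g).

Local Open Scope complex_scope.

Definition dot (R : realType) (n : nat) (x y : 'rV[R]_n) : R :=
  \sum_i x 0 i * y 0 i.

Definition unit_sphere (R : realType) : set 'rV[R]_3 := [set x | dot x x = 1].
Arguments unit_sphere : clear implicits.

Definition S2 (R : realType) : topologicalType := set_type (unit_sphere R).

Definition punctured (R : realType) (n : nat) (c : 'I_n -> S2 R) :
    topologicalType :=
  set_type (~` range c).

(* e^(i t) *)
Definition cis (R : realType) (t : R) : R[i] := cos t +i* sin t.

(* The rows of the rotation F are a positively oriented orthonormal basis
   (u, v, p), and g (t) = sin r (cos (2 pi t) u + sin (2 pi t) v) + cos r p.
   This fixes the orientation of the sphere: counterclockwise as seen from
   outside. *)
Definition positive_circle (R : realType) (p : S2 R) (r : R) (g : R -> S2 R) :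
    Prop :=
  exists F : 'M[R]_3, [/\ F *m F^T = 1%:M, \det F = 1,
    row ord_max F = set_val p &
    forall t, set_val (g t) =
      (\row_j [:: sin r * cos (2 * pi * t); sin r * sin (2 * pi * t);
                  cos r]`_j) *m F].

(* The closed spherical cap of angular radius r around c i contains no other
   puncture. *)
Definition small_positive_loop (R : realType) (n : nat) (c : 'I_n -> S2 R)
    (i : 'I_n) (g : loop R (punctured c)) : Prop :=
  exists r : R, [/\ 0 < r < pi / 2,
    forall j, j != i -> dot (set_val (c j)) (set_val (c i)) < cos r &
    positive_circle (c i) r (fun t => set_val (g t))].

(* theta is a continuous argument of f - w along [0, 1]. *)
Definition winds_once (R : realType) (f : R -> R[i]) (w : R[i]) : Prop :=
  exists theta : R -> R, [/\ continuous theta, theta 1 = theta 0 + 2 * pi &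
    forall t, 0 <= t <= 1 ->
      exists2 s : R, 0 < s & f t = w + s%:C * cis (theta t)].

Record chart (R : realType) := Chart {
  chart_dom : set (S2 R);
  chart_map :> S2 R -> R[i] }.

(* R[i] itself carries no topology in the library, R[i]^o does. A chart need
   not be differentiable: it preserves the orientation if its local degree is
   1, i.e., it maps small positive circles around p to loops of winding number
   1 around f p. *)
Definition is_chart (R : realType) (C : set (S2 R)) (f : chart R) : Prop :=
  [/\ open (chart_dom f), chart_dom f `<=` ~` C &
    forall p, chart_dom f p ->
      [/\ {for p, continuous (f : S2 R -> R[i]^o)},
          exists2 V, nbhs p V & {in V &, injective f} &
          \forall r \near 0^'+, forall g, positive_circle p r g ->
            winds_once (fun t => f (g t)) (f p)]].

(* Near p, the transition from g-coordinates to f-coordinates is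
   z |-> i^k z + t. *)
Definition transition (R : realType) (f g : chart R) (p : S2 R) (k : 'Z_4) :
    Prop :=
  [/\ chart_dom f p, chart_dom g p &
    exists t : R[i], \forall x \near p, f x = 'i ^+ k * g x + t].

Definition atlas (R : realType) := set (chart R).

(* A neighbourhood of q is isometric, for the flat metric induced by A, to a
   neighbourhood of the apex of the Euclidean cone of total angle theta; P is
   the inverse isometry in polar coordinates (radius, angle). *)
Definition has_cone_angle (R : realType) (A : atlas R) (q : S2 R) (theta : R) :
    Prop :=
  0 < theta /\ exists (e : R) (P : R * R -> S2 R),
    let D := [set x : R * R | 0 < x.1 < e] in
    [/\ 0 < e,
        forall x, D x -> {for x, continuous P},
        forall x y, D x -> D y ->
          (P x = P y <->
           x.1 = y.1 /\ exists k : int, x.2 = y.2 + k%:~R * theta),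
        nbhs q (q |` P @` D) /\
        (forall V, nbhs q V -> \forall r \near 0^'+, forall a, V (P (r, a))) &
        forall x, D x -> exists f : chart R, [/\ A f, chart_dom f (P x) &
          exists a b : R[i], `|a| = 1 /\
            \forall y \near x, f (P y) = a * (y.1%:C * cis y.2) + b]].

Definition seamless (R : realType) (C : set (S2 R)) (A : atlas R) : Prop :=
  [/\ forall f, A f -> is_chart C f,
      forall p, ~ C p -> exists2 f, A f & chart_dom f p,
      forall f g p, A f -> A g -> chart_dom f p -> chart_dom g p ->
        exists k, transition f g p k &
      forall q, C q -> exists k : nat, has_cone_angle A q (k%:R * (pi / 2))].

(* The chart f 0 is continued along g through f 1, ..., f N = f 0: on the l-th
   step f l = i^(k l) f l.+1 + t, so that the composite transition
   expresses the continuation of f 0 along g as i^(\sum_l k l) f 0 + t. With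
   this direction of the transitions, a small positive loop around a cone point
   of angle (m + 4) pi / 2 has holonomy m (and not - m). *)
Definition rotational_holonomy (R : realType) (A : atlas R) (g : R -> S2 R)
    (rot : 'Z_4) : Prop :=
  exists (N : nat) (s : nat -> R) (f : nat -> chart R) (k : nat -> 'Z_4),
    [/\ s 0%N = 0 /\ s N = 1,
        (forall l, (l <= N)%N -> A (f l)) /\ f N = f 0%N,
        forall l, (l < N)%N ->
          s l <= s l.+1 /\
          (forall t, s l <= t <= s l.+1 -> chart_dom (f l) (g t)),
        forall l, (l < N)%N -> transition (f l) (f l.+1) (g (s l.+1)) (k l) &
        rot = \sum_(l < N) k l].

Definition has_signature (R : realType) (n : nat) (c : 'I_n -> S2 R)
    (A : atlas R) (m : 'I_n -> int) (rho : H1 R (punctured c) -> 'Z_4) : Prop :=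
  (forall i, has_cone_angle A (c i) ((m i + 4)%:~R * (pi / 2))) /\
  (forall g : loop R (punctured c),
    rotational_holonomy A (fun t => set_val (g t)) (rho (loop_class g))).

(* Main.v *)
(* In stereographic coordinates of a generic rotated frame the punctures are
   points z_i <> 0, oo of the plane with different arguments. One chart is the
   Schwarz-Christoffel primitive of \prod_i (1 - z / z_i) ^ (m_i / 4), for the
   principal fourth roots, on the plane cut along the rays from z_i to oo. The
   other one is the same construction in the coordinate 1 / z, on the plane cut
   along the segments from 0 to z_i. As the m_i add up to -8, the derivatives of
   the two charts have the same fourth power, so that the transitions are
   z |-> i^k z + t. Here k is constant on the sectors between consecutive rays
   and jumps by m_i at the ray of z_i.
   A loop is cut into pieces that lie in one chart domain. Coning these pieces
   off from the centres 0 and oo shows that the loop is homologous to a sum of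
   meridians from 0 to oo through the points where it changes charts. The value
   of rho on the difference of two meridians also jumps by m_i at the ray of z_i,
   since a small loop around z_i switches charts exactly on the two sides of the
   ray. Hence this value differs from k by a constant, which cancels because a
   closed loop switches charts equally often in both directions.
   Near z_i, in the coordinate u with u^4 = 1 - z / z_i, every branch of the
   primitive is a constant times the (m_i + 4)-th power of a local coordinate
   that commutes with u |-> i u; this gives the cone angle. *)

Require Import Defs.
From HB Require Import structures.
From mathcomp Require Import all_boot all_order all_algebra.
From mathcomp Require Import complex.
From mathcomp.multinomials Require Import freeg.
From mathcomp Require Import all_classical all_reals all_analysis.
From mathcomp Require Import ring lra.

Set Implicit Arguments.
Unset Strict Implicit.
Unset Printing Implicit Defensive.

Import Order.TTheory GRing.Theory Num.Theory numFieldNormedType.Exports.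

Local Open Scope classical_set_scope.
Local Open Scope ring_scope.
Local Open Scope complex_scope.

(** * Complex numbers and strict differentiability *)

(** Two ['Z_4]-valued functions on the overlap of the two charts have to be compared: [lens_rho],
    which comes from [rho], and [turn], which comes from the primitives. A single meridian is not a
    cycle, so [rho] only sees differences of meridians, and the comparison can hold only up to a
    constant. The hypothesis on small loops enters through one explicit circle around each puncture;
    its conclusion spreads along the whole ray because the difference [defect] is invariant under
    scaling by positive reals. Both chart domains are star-shaped about their centres. This serves
    twice: for integrating along radii and for coning paths off. Branches are never tracked.
    Derivatives are compared through their fourth powers, which are rational functions, and a power
    of i that varies continuously is constant. The condition m_i > -4 makes the exponent (m_i + 4) /
    4 of the primitive at z_i positive. The sum -8 occurs because z^-8 is the fourth power of -z^-2,
    the derivative of 1 / z. *)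

Section ComplexAbs.
Variable R : realType.
Implicit Types (x y z w : R[i]) (F : set_system R[i]).

Definition cabs z : R := Num.sqrt (complex.Re z ^+ 2 + complex.Im z ^+ 2).

Lemma normc_cabs z : `|z| = (cabs z)%:C.
Proof. by rewrite normc_def. Qed.

Lemma cabs_ge0 z : 0 <= cabs z.
Proof. exact: sqrtr_ge0. Qed.

Lemma cabs0 : cabs 0 = 0.
Proof. by apply: complexI; rewrite -normc_cabs normr0. Qed.

Lemma cabs1 : cabs 1 = 1.
Proof. by apply: complexI; rewrite -normc_cabs normr1. Qed.

Lemma cabsM x y : cabs (x * y) = cabs x * cabs y.
Proof. by apply: complexI; rewrite rmorphM /= -!normc_cabs normrM. Qed.

Lemma cabsV x : cabs x^-1 = (cabs x)^-1.
Proof. by apply: complexI; rewrite fmorphV /= -!normc_cabs normfV. Qed.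

Lemma cabsX x n : cabs (x ^+ n) = cabs x ^+ n.
Proof. by apply: complexI; rewrite rmorphXn /= -!normc_cabs normrX. Qed.

Lemma cabsN x : cabs (- x) = cabs x.
Proof. by apply: complexI; rewrite -!normc_cabs normrN. Qed.

Lemma cabsC x y : cabs (x - y) = cabs (y - x).
Proof. by rewrite -cabsN opprB. Qed.

Lemma cabsD x y : cabs (x + y) <= cabs x + cabs y.
Proof. by rewrite -lecR rmorphD /= -!normc_cabs ler_normD. Qed.

Lemma cabsB x y : cabs (x - y) <= cabs x + cabs y.
Proof. by rewrite -(cabsN y) cabsD. Qed.

Lemma cabs_tri z x y : cabs (x - y) <= cabs (x - z) + cabs (z - y).
Proof. by rewrite (_ : x - y = x - z + (z - y)) ?cabsD//; ring. Qed.

Lemma cabs_sub x y : cabs x - cabs y <= cabs (x - y).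
Proof. by rewrite lerBlDr -{1}(subrK y x) cabsD. Qed.

Lemma cabs_eq0 x : (cabs x == 0) = (x == 0).
Proof. by rewrite -(inj_eq (@complexI R)) -normc_cabs normr_eq0. Qed.

Lemma cabs_gt0 x : (0 < cabs x) = (x != 0).
Proof. by rewrite lt0r cabs_eq0 cabs_ge0 andbT. Qed.

Lemma cabs_real (a : R) : cabs a%:C = `|a|.
Proof. by rewrite /cabs /= expr0n /= addr0 sqrtr_sqr. Qed.

Lemma cabs_Re z : `|complex.Re z| <= cabs z.
Proof. by rewrite -lecR -normc_cabs normc_ge_Re. Qed.

Lemma cabs_Im z : `|complex.Im z| <= cabs z.
Proof. by rewrite -sqrtr_sqr ler_sqrt ?lerDr ?addr_ge0// sqr_ge0. Qed.

Lemma cabs_le z : cabs z <= `|complex.Re z| + `|complex.Im z|.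
Proof.
have {1}-> : z = (complex.Re z)%:C + 'i * (complex.Im z)%:C by exact: complexE.
apply: le_trans (cabsD _ _) _; rewrite cabsM !cabs_real.
by rewrite [cabs 'i]/cabs /= expr0n expr1n add0r sqrtr1 mul1r.
Qed.

Lemma cabs_sqr z : cabs z ^+ 2 = complex.Re z ^+ 2 + complex.Im z ^+ 2.
Proof. by rewrite sqr_sqrtr// addr_ge0// sqr_ge0. Qed.

Lemma cReD x y : complex.Re (x + y) = complex.Re x + complex.Re y.
Proof. by case: x; case: y. Qed.
Lemma cImD x y : complex.Im (x + y) = complex.Im x + complex.Im y.
Proof. by case: x; case: y. Qed.
Lemma cReN x : complex.Re (- x) = - complex.Re x.
Proof. by case: x. Qed.
Lemma cImN x : complex.Im (- x) = - complex.Im x.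
Proof. by case: x. Qed.
Lemma cReM x y : complex.Re (x * y) =
  complex.Re x * complex.Re y - complex.Im x * complex.Im y.
Proof. by case: x; case: y. Qed.
Lemma cImM x y : complex.Im (x * y) =
  complex.Re x * complex.Im y + complex.Im x * complex.Re y.
Proof. by case: x; case: y. Qed.
Lemma Re_real (a : R) : complex.Re a%:C = a. Proof. by []. Qed.
Lemma Im_real (a : R) : complex.Im a%:C = 0. Proof. by []. Qed.
Definition ReImE := (cReD, cImD, cReN, cImN, cReM, cImM, Re_real, Im_real).

Lemma eqc_ReIm x y : complex.Re x = complex.Re y ->
  complex.Im x = complex.Im y -> x = y.
Proof. by case: x; case: y => ? ? ? ? /= -> ->. Qed.

Lemma realM_ReIm (a : R) z :
  a%:C * z = (a * complex.Re z) +i* (a * complex.Im z).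
Proof. by case: z => u v /=; apply: eqc_ReIm => /=; ring. Qed.

Lemma nbhs_cabsP z (A : set R[i]) :
  nbhs (z : R[i]^o) A <-> exists2 r : R, 0 < r & forall x, cabs (x - z) < r -> A x.
Proof.
split.
  move=> /(@nbhs_ballP _ R[i]^o)[[e e'] /= e0 H].
  (* The radius of a ball of [R[i]^o] is itself a complex number; being positive, it is real. *)
  move: e0; rewrite ltcE /= => /andP[/eqP ei e0]; subst e'.
  exists e => // x xr; apply: H; rewrite /ball /= normc_cabs.
  by rewrite ltcR cabsC.
move=> [r r0 H]; apply/(@nbhs_ballP _ R[i]^o); exists r%:C => /=.
  by rewrite ltcR.
by move=> x; rewrite /ball /= normc_cabs ltcR cabsC => ?; exact: H.
Qed.

Lemma cvgc_cabsP (T : Type) (F : set_system T) {FF : Filter F} (f : T -> R[i]) z :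
  (f : T -> R[i]^o) @ F --> (z : R[i]^o) <->
  forall e : R, 0 < e -> \forall t \near F, cabs (f t - z) < e.
Proof.
split=> [H e e0|H A /nbhs_cabsP[r r0 HA]].
  by apply: (H [set w | cabs (w - z) < e]); apply/nbhs_cabsP; exists e.
by apply: filterS (H _ r0) => x /= /HA.
Qed.

Lemma cvgc_nearP (T : topologicalType) (t : T) (f : T -> R[i]) z :
  (f : T -> R[i]^o) @ t --> (z : R[i]^o) <->
  forall e : R, 0 < e -> \forall x \near t, cabs (f x - z) < e.
Proof. exact: cvgc_cabsP. Qed.

Lemma cvgcD (T : Type) (F : set_system T) {FF : Filter F} (f g : T -> R[i]) a b :
  (f : T -> R[i]^o) @ F --> (a : R[i]^o) -> (g : T -> R[i]^o) @ F --> (b : R[i]^o) ->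
  ((fun t => f t + g t) : T -> R[i]^o) @ F --> (a + b : R[i]^o).
Proof. exact: cvgD. Qed.

Lemma cvgcM (T : Type) (F : set_system T) {FF : Filter F} (f g : T -> R[i]) a b :
  (f : T -> R[i]^o) @ F --> (a : R[i]^o) -> (g : T -> R[i]^o) @ F --> (b : R[i]^o) ->
  ((fun t => f t * g t) : T -> R[i]^o) @ F --> (a * b : R[i]^o).
Proof. exact: cvgM. Qed.

Lemma cvgcV (T : Type) (F : set_system T) {FF : Filter F} (f : T -> R[i]) a :
  a != 0 -> (f : T -> R[i]^o) @ F --> (a : R[i]^o) ->
  ((fun t => (f t)^-1) : T -> R[i]^o) @ F --> (a^-1 : R[i]^o).
Proof. by move=> a0; exact: (@cvgV R[i] T F FF f a a0). Qed.

Lemma cvgcN (T : Type) (F : set_system T) {FF : Filter F} (f : T -> R[i]) a :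
  (f : T -> R[i]^o) @ F --> (a : R[i]^o) ->
  ((fun t => - f t) : T -> R[i]^o) @ F --> (- a : R[i]^o).
Proof. exact: cvgN. Qed.

Lemma cvgc_ReIm (T : Type) (F : set_system T) {FF : Filter F} (f : T -> R[i]) z :
  (fun t => complex.Re (f t)) @ F --> complex.Re z ->
  (fun t => complex.Im (f t)) @ F --> complex.Im z ->
  (f : T -> R[i]^o) @ F --> (z : R[i]^o).
Proof.
move=> /cvgrPdist_lt fr /cvgrPdist_lt fi; apply/cvgc_cabsP => e e0.
near=> x; apply: le_lt_trans (cabs_le _) _; rewrite !ReImE [ltRHS]splitr.
apply: ltrD; rewrite distrC.
- by near: x; apply: fr; rewrite divr_gt0.
- by near: x; apply: fi; rewrite divr_gt0.
Unshelve. all: by end_near. Qed.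

Lemma cvgc_Re (T : Type) (F : set_system T) {FF : Filter F} (f : T -> R[i]) z :
  (f : T -> R[i]^o) @ F --> (z : R[i]^o) ->
  (fun t => complex.Re (f t)) @ F --> complex.Re z.
Proof.
move=> /cvgc_cabsP H; apply/cvgrPdist_lt => e e0; near=> x.
have -> : complex.Re z - complex.Re (f x) = complex.Re (z - f x) by rewrite !ReImE.
by apply: le_lt_trans (cabs_Re _) _; rewrite cabsC; near: x; exact: H.
Unshelve. all: by end_near. Qed.

Lemma cvgc_Im (T : Type) (F : set_system T) {FF : Filter F} (f : T -> R[i]) z :
  (f : T -> R[i]^o) @ F --> (z : R[i]^o) ->
  (fun t => complex.Im (f t)) @ F --> complex.Im z.
Proof.
move=> /cvgc_cabsP H; apply/cvgrPdist_lt => e e0; near=> x.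
have -> : complex.Im z - complex.Im (f x) = complex.Im (z - f x) by rewrite !ReImE.
by apply: le_lt_trans (cabs_Im _) _; rewrite cabsC; near: x; exact: H.
Unshelve. all: by end_near. Qed.

Lemma cvgc_real (T : Type) (F : set_system T) {FF : Filter F} (f : T -> R) (a : R) :
  f @ F --> a -> ((fun t => (f t)%:C) : T -> R[i]^o) @ F --> (a%:C : R[i]^o).
Proof. by move=> fa; apply: cvgc_ReIm => //=; exact: cvg_cst. Qed.

Lemma cvgc_fst (f : R[i] -> R[i]) p z :
  (f : R[i]^o -> R[i]^o) @ (p : R[i]^o) --> (z : R[i]^o) ->
  (fun q : R[i]^o * R[i]^o => f q.1 : R[i]^o) @
    ((p : R[i]^o), (p : R[i]^o)) --> (z : R[i]^o).
Proof. by apply: cvg_comp; exact: cvg_fst. Qed.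

Lemma cvgc_snd (f : R[i] -> R[i]) p z :
  (f : R[i]^o -> R[i]^o) @ (p : R[i]^o) --> (z : R[i]^o) ->
  (fun q : R[i]^o * R[i]^o => f q.2 : R[i]^o) @
    ((p : R[i]^o), (p : R[i]^o)) --> (z : R[i]^o).
Proof. by apply: cvg_comp; exact: cvg_snd. Qed.

End ComplexAbs.
Arguments cabs {R} _.

Section StrictDerivative.
Variable R : realType.
Implicit Types (p d x y z w : R[i]) (f g : R[i] -> R[i]).

(* Strict differentiability: local injectivity, winding numbers and the
   continuity of the derivative are immediate from it. *)
Definition sdiff f p d := forall e : R, 0 < e ->
  exists2 r : R, 0 < r & forall x y, cabs (x - p) < r -> cabs (y - p) < r ->
    cabs (f x - f y - d * (x - y)) <= e * cabs (x - y).

Lemma sdiff_eq f g p d : f =1 g -> sdiff f p d -> sdiff g p d.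
Proof. by move=> /funext ->. Qed.

Lemma sdiff_cst c p : sdiff (fun=> c) p 0.
Proof.
move=> e e0; exists 1 => // x y _ _.
by rewrite subrr mul0r subrr cabs0 mulr_ge0 ?cabs_ge0// ltW.
Qed.

Lemma sdiff_id p : sdiff id p 1.
Proof.
move=> e e0; exists 1 => // x y _ _.
by rewrite mul1r subrr cabs0 mulr_ge0 ?cabs_ge0// ltW.
Qed.

Lemma sdiffD f g p a b : sdiff f p a -> sdiff g p b ->
  sdiff (fun x => f x + g x) p (a + b).
Proof.
move=> fp gp e e0; have e2 : 0 < e / 2 by rewrite divr_gt0.
have [r r0 Hf] := fp _ e2; have [s s0 Hg] := gp _ e2.
exists (Num.min r s) => [|x y]; first by rewrite lt_min r0.
rewrite !lt_min => /andP[xr xs] /andP[yr ys].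
have -> : f x + g x - (f y + g y) - (a + b) * (x - y) =
  (f x - f y - a * (x - y)) + (g x - g y - b * (x - y)) by ring.
apply: le_trans (cabsD _ _) _; rewrite (splitr e) mulrDl.
by apply: lerD; [exact: Hf | exact: Hg].
Qed.

Lemma sdiff_lip f p d : sdiff f p d -> exists2 r : R, 0 < r &
  forall x y, cabs (x - p) < r -> cabs (y - p) < r ->
    cabs (f x - f y) <= (cabs d + 1) * cabs (x - y).
Proof.
move=> /(_ 1 ltr01)[r r0 H]; exists r => // x y xr yr.
rewrite -(subrK (d * (x - y)) (f x - f y)) addrC.
apply: le_trans (cabsD _ _) _; rewrite cabsM mulrDl lerD2l.
exact: H.
Qed.

Lemma sdiff_cvg f p d : sdiff f p d -> (f : R[i] -> R[i]^o) @ (p : R[i]^o) --> (f p : R[i]^o).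
Proof.
move=> /sdiff_lip[r r0 H]; apply/cvgc_nearP => e e0; apply/nbhs_cabsP.
have d0 : 0 < cabs d + 1 by rewrite ltr_wpDl ?cabs_ge0.
exists (Num.min r (e / (cabs d + 1))) => [|x].
  by rewrite lt_min r0 divr_gt0.
rewrite lt_min => /andP[xr xe].
apply: le_lt_trans (H _ _ xr _) _; first by rewrite subrr cabs0.
by rewrite -ltr_pdivlMl// mulrC.
Qed.

Lemma sdiff_factor f p d (Q : R[i] -> R[i] -> R[i]) :
  (\forall q \near ((p : R[i]^o), (p : R[i]^o)),
    f q.1 - f q.2 = Q q.1 q.2 * (q.1 - q.2)) ->
  (fun q : R[i]^o * R[i]^o => Q q.1 q.2 : R[i]^o) @
    ((p : R[i]^o), (p : R[i]^o)) --> (d : R[i]^o) ->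
  sdiff f p d.
Proof.
move=> H /cvgc_nearP Qd e e0.
have [[A B] /= [/nbhs_cabsP[r r0 HA] /nbhs_cabsP[s s0 HB]] AB] :=
  filterI H (Qd _ e0).
exists (Num.min r s) => [|x y]; first by rewrite lt_min r0.
rewrite !lt_min => /andP[xr xs] /andP[yr ys].
have [/= -> Q1] := AB (x, y) (conj (HA _ xr) (HB _ ys)).
by rewrite -mulrBl cabsM ler_wpM2r ?cabs_ge0// ltW.
Qed.

(** Carathéodory's form: the difference quotient, with the value [d] put on the diagonal, is a
    function of two points that is continuous at (p, p). Products, compositions and inverses then
    amount to algebra with quotients. *)
Lemma sdiffP f p d : sdiff f p d <-> exists2 Q : R[i] -> R[i] -> R[i],
  forall x y, f x - f y = Q x y * (x - y) &
  (fun q : R[i]^o * R[i]^o => Q q.1 q.2 : R[i]^o) @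
    ((p : R[i]^o), (p : R[i]^o)) --> (d : R[i]^o).
Proof.
split=> [fp|[Q H Qd]]; last by apply: sdiff_factor Qd; near do exact: H.
exists (fun x y => if x == y then d else (f x - f y) / (x - y)).
  move=> x y; case: eqVneq => [->|xy]; first by rewrite !subrr mulr0.
  by rewrite divfK// subr_eq0.
apply/cvgc_nearP => e e0; have [r r0 H] := fp _ (divr_gt0 e0 (ltr0Sn _ 1)).
exists ([set x | cabs (x - p) < r], [set x | cabs (x - p) < r]).
  by split; apply/nbhs_cabsP; exists r.
move=> [x y] [/= xr yr]; case: eqVneq => [_|xy]; first by rewrite subrr cabs0.
have xy0 : x - y != 0 by rewrite subr_eq0.
have -> : (f x - f y) / (x - y) - d = (f x - f y - d * (x - y)) / (x - y) by field.
rewrite cabsM cabsV ltr_pdivrMr ?cabs_gt0//; apply: le_lt_trans (H _ _ xr yr) _.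
by rewrite ltr_pM2r ?cabs_gt0// ltr_pdivrMr// ltr_pMr// ltr1n.
Unshelve. all: by end_near. Qed.

Lemma sdiffM f g p a b : sdiff f p a -> sdiff g p b ->
  sdiff (fun x => f x * g x) p (a * g p + f p * b).
Proof.
move=> fp gp; have [P HP Pa] := (sdiffP _ _ _).1 fp.
have [Q HQ Qb] := (sdiffP _ _ _).1 gp.
apply/sdiffP; exists (fun x y => P x y * g x + f y * Q x y) => [x y|].
  by rewrite mulrDl mulrAC -HP -mulrA -HQ; ring.
exact: (cvgcD (cvgcM Pa (cvgc_fst (sdiff_cvg gp))) (cvgcM (cvgc_snd (sdiff_cvg fp)) Qb)).
Qed.

Lemma sdiffZ c f p a : sdiff f p a -> sdiff (fun x => c * f x) p (c * a).
Proof.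
by move=> /(sdiffM (sdiff_cst c p)); rewrite mul0r add0r.
Qed.

Lemma sdiff_comp f g p a b : sdiff f p a -> sdiff g (f p) b ->
  sdiff (g \o f) p (b * a).
Proof.
move=> fp gp; have [P HP Pa] := (sdiffP _ _ _).1 fp.
have [Q HQ Qb] := (sdiffP _ _ _).1 gp.
apply/sdiffP; exists (fun x y => Q (f x) (f y) * P x y) => [x y|].
  by rewrite /= HQ HP mulrA.
apply: (cvgcM _ Pa).
exact: (cvg_comp (fun q : R[i]^o * R[i]^o => (f q.1 : R[i]^o, f q.2 : R[i]^o)) _
  (cvg_pair (cvgc_fst (sdiff_cvg fp)) (cvgc_snd (sdiff_cvg fp))) Qb).
Qed.

Lemma sdiffX f p a n : sdiff f p a ->
  sdiff (fun x => f x ^+ n) p (n%:R * f p ^+ n.-1 * a).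
Proof.
move=> fp; elim: n => [|n IH].
  by rewrite !mul0r; apply: sdiff_eq (sdiff_cst 1 p) => x; rewrite expr0.
have := sdiffM fp IH; rewrite (_ : _ + _ = n.+1%:R * f p ^+ n.+1.-1 * a).
  by apply: sdiff_eq => x; rewrite exprS.
case: n {IH} => [|n] /=; first by rewrite expr0; ring.
by rewrite exprS -[n.+2%:R]natr1; ring.
Qed.

(** The difference quotient of [f] is the inverse of that of [g], taken at the points [f x] and
    [f y]; it converges as soon as [f] is known to be continuous at [p]. *)
Lemma sdiff_inv f g p d : d != 0 ->
  (f : R[i] -> R[i]^o) @ (p : R[i]^o) --> (f p : R[i]^o) ->
  (\forall x \near (p : R[i]^o), g (f x) = x) ->
  sdiff g (f p) d -> sdiff f p d^-1.
Proof.
move=> d0 fp gf gp; have [Q HQ Qd] := (sdiffP _ _ _).1 gp.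
have Qfd : (fun q : R[i]^o * R[i]^o => Q (f q.1) (f q.2) : R[i]^o) @
    ((p : R[i]^o), (p : R[i]^o)) --> (d : R[i]^o).
  apply: (cvg_comp
    (fun q : R[i]^o * R[i]^o => (f q.1 : R[i]^o, f q.2 : R[i]^o)) _ _ Qd).
  exact: (cvg_pair (cvgc_fst fp) (cvgc_snd fp)).
apply: (@sdiff_factor _ _ _ (fun x y => (Q (f x) (f y))^-1)); last first.
  exact: (cvgcV d0 Qfd).
have /cvgc_nearP/(_ (cabs d)) := Qfd; rewrite cabs_gt0 => /(_ d0) Q0.
near=> q; have Qn0 : Q (f q.1) (f q.2) != 0.
  apply/eqP => q0; suff : cabs (Q (f q.1) (f q.2) - d) < cabs d.
    by rewrite q0 sub0r cabsN ltxx.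
  by near: q; exact: Q0.
have q1 : g (f q.1) = q.1 by near: q; exact: (cvg_fst gf).
have q2 : g (f q.2) = q.2 by near: q; exact: (cvg_snd gf).
have -> : q.1 - q.2 = Q (f q.1) (f q.2) * (f q.1 - f q.2) by rewrite -HQ q1 q2.
by rewrite mulKf.
Unshelve. all: by end_near. Qed.

Lemma sdiffV p : p != 0 -> sdiff (fun x => x^-1) p (- (p ^- 2)).
Proof.
move=> p0; have c : (fun x => x^-1 : R[i]^o) @ (p : R[i]^o) --> (p^-1 : R[i]^o).
  exact: (cvgcV p0 (sdiff_cvg (sdiff_id p))).
have := @sdiff_factor (fun x => x^-1) p (- (p ^- 2)) (fun x y => - (x^-1 * y^-1)).
apply.
  have pn : \forall x \near (p : R[i]^o), x != 0.
    apply/nbhs_cabsP; exists (cabs p); first by rewrite cabs_gt0.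
    by move=> x; apply: contraTneq => ->; rewrite sub0r cabsN ltxx.
  near=> q; have q1 : q.1 != 0 by near: q; exact: (cvg_fst pn).
  have q2 : q.2 != 0 by near: q; exact: (cvg_snd pn).
  by field; rewrite q1 q2.
rewrite -exprVn expr2.
exact: (cvgcN (cvgcM (cvgc_fst c) (cvgc_snd c))).
Unshelve. all: by end_near. Qed.

(** Strictness at [p] controls difference quotients between two points near [p], in particular from
    [x] to [x + t]; so does differentiability at [x] for small [t]. One common step [t] therefore
    compares both derivatives. *)
Lemma sdiff_deriv_cvg f f' p : (\forall x \near (p : R[i]^o), sdiff f x (f' x)) ->
  (f' : R[i] -> R[i]^o) @ (p : R[i]^o) --> (f' p : R[i]^o).
Proof.
move=> fp; apply/cvgc_nearP => e e0.
have e3 : 0 < e / 3 by rewrite divr_gt0.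
have [r r0 H] := nbhs_singleton fp _ e3.
near=> x; have fx : sdiff f x (f' x) by near: x; exact: fp.
have [s s0 Hs] := fx _ e3.
have xr : cabs (x - p) < r by near: x; apply/nbhs_cabsP; exists r.
pose t := Num.min s (r - cabs (x - p)) / 2.
have t0 : 0 < t by rewrite divr_gt0// lt_min s0 subr_gt0.
have ts : t < s.
  by rewrite ltr_pdivrMr// (@le_lt_trans _ _ s)// ?ge_min ?lexx// ltr_pMr ?ltr1n.
have tr : t < r - cabs (x - p).
  rewrite ltr_pdivrMr// (@le_lt_trans _ _ (r - cabs (x - p)))// ?ge_min ?lexx ?orbT//.
  by rewrite ltr_pMr ?ltr1n// subr_gt0.
have yx : x + t%:C - x = t%:C by ring.
have := Hs (x + t%:C) x; rewrite yx subrr cabs0 cabs_real gtr0_norm// => /(_ ts s0) K1.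
have := H (x + t%:C) x; rewrite yx cabs_real gtr0_norm// => /(_ _ xr) K2.
have {}K2 : cabs (f (x + t%:C) - f x - f' p * t%:C) <= e / 3 * t.
  apply: K2; rewrite addrAC; apply: le_lt_trans (cabsD _ _) _.
  by rewrite cabs_real gtr0_norm// -ltrBrDl.
have tn0 : t%:C != 0 :> R[i] by rewrite (inj_eq (@complexI R)) gt_eqF.
have K : cabs (f' x - f' p) * t <= 2 * (e / 3) * t.
  rewrite -{1}(gtr0_norm t0) -cabs_real -cabsM.
  have -> : (f' x - f' p) * t%:C = (f (x + t%:C) - f x - f' p * t%:C) -
    (f (x + t%:C) - f x - f' x * t%:C) by ring.
  by apply: le_trans (cabsB _ _) _; rewrite mulr2n mulrDl mul1r mulrDl lerD.
rewrite ler_pM2r// in K; apply: le_lt_trans K _.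
by rewrite mulrA ltr_pdivrMr// mulrC ltr_pM2l// ltr_nat.
Unshelve. all: by end_near. Qed.

Lemma sdiff_inj f p d : d != 0 -> sdiff f p d -> exists2 r : R, 0 < r &
  forall x y, cabs (x - p) < r -> cabs (y - p) < r -> f x = f y -> x = y.
Proof.
move=> d0 fp; have e0 : 0 < cabs d / 2 by rewrite divr_gt0// cabs_gt0.
have [r r0 H] := fp _ e0; exists r => // x y xr yr fxy; apply/eqP.
rewrite -subr_eq0 -cabs_eq0; apply: contraT; rewrite cabs_eq0 -cabs_gt0 => xy.
have := H _ _ xr yr; rewrite fxy subrr sub0r cabsN cabsM ler_pM2r//.
by rewrite ler_pdivlMr// leNgt ltr_pMr ?cabs_gt0// ltr1n.
Qed.

End StrictDerivative.

(** * Principal fourth roots *)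

Section Root4.
Variable R : realType.
Implicit Types (p r s x y z w : R[i]).

Lemma Re_exp4 z : complex.Re (z ^+ 4) =
  (complex.Re z ^+ 2 - complex.Im z ^+ 2) ^+ 2 -
    4 * complex.Re z ^+ 2 * complex.Im z ^+ 2.
Proof. by rewrite (exprM _ 2 2) !expr2 !(cReM, cImM); ring. Qed.

Lemma Im_exp4 z : complex.Im (z ^+ 4) =
  4 * complex.Re z * (complex.Re z ^+ 2 - complex.Im z ^+ 2) * complex.Im z.
Proof. by rewrite (exprM _ 2 2) !expr2 !(cReM, cImM); ring. Qed.

(** The plane without the closed negative real axis, the domain of the principal branch. *)
Definition slit z := (complex.Im z != 0) || (0 < complex.Re z).

(** The sector |arg z| < pi/4, which the fourth power maps bijectively to the slit plane. *)
Definition sector z := `|complex.Im z| < complex.Re z.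

Lemma sectorP z : sector z <->
  0 < complex.Re z /\ complex.Im z ^+ 2 < complex.Re z ^+ 2.
Proof.
rewrite /sector; split=> [H|[Re0 H]].
  have Re0 : 0 < complex.Re z by exact: le_lt_trans H.
  by split=> //; rewrite -(real_normK (num_real (complex.Im z))) ltr_pXn2r// nnegrE ltW.
by rewrite -(ltr_pXn2r (n := 2))// ?nnegrE ?real_normK ?num_real// ltW.
Qed.

Lemma sector_slit4 r : sector r -> slit (r ^+ 4).
Proof.
move=> /sectorP[u0 uv]; rewrite /slit Im_exp4 Re_exp4.
rewrite !mulf_eq0 pnatr_eq0/= (gt_eqF u0)/= subr_eq0 (gt_eqF uv)/=.
case: eqVneq => //= ->; rewrite expr0n /= mulr0 !subr0.
by rewrite exprn_gt0// exprn_gt0.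
Qed.

(** Any fourth root can be rotated into the sector by a power of i, unless its real and imaginary
    parts have equal absolute value; but then its fourth power is a nonpositive real. *)
Lemma ex_sector_root4 z : slit z -> exists2 r, sector r & r ^+ 4 = z.
Proof.
move=> sz; have [r r4] : exists r, r ^+ 4 = z.
  by exists (sqrtc (sqrtc z)); rewrite (exprM _ 2 2) !sqr_sqrtc.
case: r r4 => u v r4.
have uv : `|u| != `|v|.
  apply/eqP => uv.
  have uv2 : u ^+ 2 = v ^+ 2 by rewrite -[LHS]real_normK ?num_real// uv real_normK ?num_real.
  move: sz; rewrite /slit -r4 Im_exp4 Re_exp4 [complex.Re _]/= [complex.Im _]/=.
  rewrite uv2 subrr mulr0 mul0r eqxx/= expr0n/= sub0r oppr_gt0.
  by rewrite -mulrA -expr2 ltNge mulr_ge0// sqr_ge0.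
have [vu|uv'] := ltP `|v| `|u|.
  have [u0|u0] := ltP 0 u.
    by exists (u +i* v) => //; rewrite /sector /= -(gtr0_norm u0).
  exists (- (u +i* v)); last by rewrite exprNn -signr_odd mul1r.
  by rewrite /sector /= normrN -(ler0_norm u0).
have {}uv : `|u| < `|v| by rewrite lt_neqAle uv.
have i4 : ('i : R[i]) ^+ 4 = 1 by rewrite (exprM _ 2 2) sqr_i sqrrN expr1n.
have [v0|v0] := ltP 0 v.
  exists (- 'i * (u +i* v)); last by rewrite exprMn exprNn -signr_odd mul1r i4 mul1r.
  by rewrite /sector !ReImE /= !(mul0r, oppr0, add0r, mulN1r, opprK) normrN -(gtr0_norm v0).
exists ('i * (u +i* v)); last by rewrite exprMn i4 mul1r.
by rewrite /sector !ReImE /= !(mul0r, add0r, sub0r, mul1r) -(ler0_norm v0).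
Qed.

Definition root4 z : R[i] := xget 0 [set r | sector r /\ r ^+ 4 = z].

Lemma root4P z : slit z -> sector (root4 z) /\ root4 z ^+ 4 = z.
Proof.
move=> /ex_sector_root4[r rs r4].
by apply: (@xgetPex _ 0 [set r | sector r /\ r ^+ 4 = z]); exists r.
Qed.

Lemma root4_sector z : slit z -> sector (root4 z).
Proof. by move=> /root4P[]. Qed.

Lemma root4K z : slit z -> root4 z ^+ 4 = z.
Proof. by move=> /root4P[]. Qed.

Lemma sector_neq0 z : sector z -> z != 0.
Proof. by move=> /sectorP[z0 _]; apply: contraTneq z0 => ->; rewrite ltxx. Qed.

Lemma root4_neq0 z : slit z -> root4 z != 0.
Proof. by move=> /root4_sector/sector_neq0. Qed.

Lemma le_ReD z w : 0 < complex.Re w -> complex.Re z <= cabs (z + w).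
Proof.
move=> w0; apply: le_trans (cabs_Re (z + w)).
by apply: le_trans (ler_norm _); rewrite cReD lerDl ltW.
Qed.

(** In r^4 - s^4 = (r - s)(r + s)(r^2 + s^2) every summand of the last two factors has positive real
    part, since the sector and its image under squaring lie in the right half plane. The estimate
    yields both injectivity of the fourth power and continuity of [root4]. *)
Lemma sector_sub_le r s : sector r -> sector s ->
  cabs (r - s) * (complex.Re r * complex.Re (r ^+ 2)) <= cabs (r ^+ 4 - s ^+ 4).
Proof.
move=> /sectorP[r0 r1] /sectorP[s0 s1].
have sqE z : complex.Re (z ^+ 2) = complex.Re z ^+ 2 - complex.Im z ^+ 2.
  by rewrite expr2 cReM.
have r20 : 0 < complex.Re (r ^+ 2) by rewrite sqE subr_gt0.
have s20 : 0 < complex.Re (s ^+ 2) by rewrite sqE subr_gt0.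
have -> : r ^+ 4 - s ^+ 4 = (r - s) * ((r + s) * (r ^+ 2 + s ^+ 2)) by ring.
rewrite !cabsM ler_wpM2l ?cabs_ge0//.
by apply: ler_pM; [exact: ltW|exact: ltW|exact: le_ReD|exact: le_ReD].
Qed.

Lemma sector4_inj r s : sector r -> sector s -> r ^+ 4 = s ^+ 4 -> r = s.
Proof.
move=> rS sS rs; have := sector_sub_le rS sS; rewrite rs subrr cabs0.
have [r0 r1] := (sectorP _).1 rS.
rewrite pmulr_lle0; last by rewrite mulr_gt0// expr2 cReM subr_gt0.
by move=> h; apply/eqP; rewrite -subr_eq0 -cabs_eq0 eq_le h cabs_ge0.
Qed.

Lemma root4_eq r : sector r -> root4 (r ^+ 4) = r.
Proof.
by move=> rs; have [] := root4P (sector_slit4 rs) => ?; exact: sector4_inj.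
Qed.

Lemma slit_open p : slit p -> \forall x \near (p : R[i]^o), slit x.
Proof.
move=> /orP[p0|p0]; apply/nbhs_cabsP.
  exists `|complex.Im p|; rewrite ?normr_gt0// => x xp; apply/orP; left.
  apply: contraTneq xp => x0; rewrite -leNgt; apply: le_trans (cabs_Im _).
  by rewrite cImD x0 add0r cImN normrN.
exists (complex.Re p) => // x xp; apply/orP; right.
have := le_lt_trans (cabs_Re _) xp; rewrite cReD cReN ltr_norml => /andP[+ _].
by rewrite ltrBrDl subrr.
Qed.

Lemma root4_cvg p : slit p -> (root4 : R[i] -> R[i]^o) @ (p : R[i]^o) --> (root4 p : R[i]^o).
Proof.
move=> sp; apply/cvgc_nearP => e e0.
have [rs r4] := root4P sp; have [r0 r1] := (sectorP _).1 rs.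
pose M := complex.Re (root4 p) * complex.Re (root4 p ^+ 2).
have M0 : 0 < M by rewrite mulr_gt0// expr2 cReM subr_gt0.
have eM : \forall x \near (p : R[i]^o), cabs (x - p) < e * M.
  by apply/nbhs_cabsP; exists (e * M) => //; rewrite mulr_gt0.
have S := slit_open sp; near=> x.
have [xs x4] : sector (root4 x) /\ root4 x ^+ 4 = x by apply: root4P; near: x; exact: S.
rewrite cabsC -(ltr_pM2r M0); apply: le_lt_trans (sector_sub_le rs xs) _.
by rewrite r4 x4 cabsC; near: x; exact: eM.
Unshelve. all: by end_near. Qed.

Lemma root4_sdiff p : slit p -> sdiff root4 p (4 * root4 p ^+ 3)^-1.
Proof.
move=> sp; apply: (@sdiff_inv _ _ (fun x => x ^+ 4)).
- by rewrite mulf_neq0 ?expf_neq0 ?root4_neq0 ?pnatr_eq0.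
- exact: root4_cvg.
- by apply: filterS (slit_open sp) => x; exact: root4K.
- by have := sdiffX 4 (sdiff_id (root4 p)); rewrite mulr1.
Qed.

(* The imaginary parts of -y and 1 - 1/y have opposite signs, so the arguments
   of their roots do not add up beyond pi/4. *)
Lemma root4_split y : slit (- y) -> slit (1 - y) -> slit (1 - y^-1) ->
  root4 (1 - y) = root4 (- y) * root4 (1 - y^-1).
Proof.
move=> s1 s2 s3; have y0 : y != 0.
  by apply: contraTneq s1 => ->; rewrite oppr0 /slit /= eqxx ltxx.
have E : (root4 (- y) * root4 (1 - y^-1)) ^+ 4 = 1 - y.
  by rewrite exprMn !root4K//; field.
rewrite -{1}E; apply: root4_eq.
have [/sectorP[]] := root4P s1; have [/sectorP[]] := root4P s3.
case: (root4 (- y)) => u v; case: (root4 (1 - y^-1)) => s t /= s0 st r4 u0 uv q4.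
have imy : complex.Im ((u +i* v) ^+ 4) * complex.Im ((s +i* t) ^+ 4) <= 0.
  rewrite q4 r4; case: (y) => c d /=; rewrite sub0r opprK.
  rewrite mulrA mulNr -expr2 mulNr oppr_le0 divr_ge0 ?sqr_ge0//.
  by rewrite addr_ge0 ?sqr_ge0.
have vt : v * t <= 0.
  move: imy; rewrite !Im_exp4 ![complex.Re _]/= ![complex.Im _]/=.
  have P1 : 0 < 4 * u * (u ^+ 2 - v ^+ 2) by rewrite !mulr_gt0 ?subr_gt0.
  have P2 : 0 < 4 * s * (s ^+ 2 - t ^+ 2) by rewrite !mulr_gt0 ?subr_gt0.
  by rewrite mulrACA (pmulr_rle0 _ (mulr_gt0 P1 P2)).
have v1 : `|v| < u by rewrite -(ltr_pXn2r (n := 2))// ?nnegrE ?real_normK ?num_real// ltW.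
have t1 : `|t| < s by rewrite -(ltr_pXn2r (n := 2))// ?nnegrE ?real_normK ?num_real// ltW.
rewrite /sector !ReImE /=; move: v1 t1; rewrite !ltr_norml => /andP[v1 v2] /andP[t1 t2].
apply/andP; split; [have [v0|v0] := lerP 0 v | have [v0|v0] := lerP 0 v].
- have t0 : t <= 0 \/ v = 0 by have [|?] := lerP t 0; [left|right; nra].
  by case: t0 => [t0|->]; nra.
- have t0 : 0 <= t by nra.
  by nra.
- have t0 : t <= 0 \/ v = 0 by have [|?] := lerP t 0; [left|right; nra].
  by case: t0 => [t0|->]; nra.
- have t0 : 0 <= t by nra.
  by nra.
Qed.

(** Star-shapedness of the slit plane about 1, which becomes star-shapedness of the chart domains
    about 0. *)
Lemma slit_conv (t : R) w : 0 <= t <= 1 -> slit w -> slit ((1 - t)%:C + t%:C * w).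
Proof.
move=> /andP[t0 t1]; rewrite /slit.
have -> : complex.Re ((1 - t)%:C + t%:C * w) = 1 - t + t * complex.Re w.
  by rewrite !ReImE mul0r subr0.
have -> : complex.Im ((1 - t)%:C + t%:C * w) = t * complex.Im w.
  by rewrite !ReImE mul0r addr0 add0r.
have [->|tn0] := eqVneq t 0; first by rewrite subr0 !mul0r addr0 ltr01 orbT.
have {}t0 : 0 < t by rewrite lt0r tn0.
move=> /orP[v0|u0]; first by rewrite mulf_neq0.
by rewrite ltr_wpDl ?orbT// ?mulr_gt0// subr_ge0.
Qed.

End Root4.
Arguments root4 {R} _.

Section Holomorphic.
Variable R : realType.
Implicit Types (p d x y z w : R[i]) (f g : R[i] -> R[i]).

Definition hol f p := exists d, sdiff f p d.

Definition cderiv f p := xget 0 [set d | sdiff f p d].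

Lemma holP f p : hol f p -> sdiff f p (cderiv f p).
Proof. exact: (@xgetPex _ 0 [set d | sdiff f p d]). Qed.

Lemma hol_cvg f p : hol f p -> (f : R[i] -> R[i]^o) @ (p : R[i]^o) --> (f p : R[i]^o).
Proof. by move=> [d]; exact: sdiff_cvg. Qed.

Lemma hol_cst c p : hol (fun=> c) p.
Proof. by exists 0; exact: sdiff_cst. Qed.

Lemma hol_id p : hol id p.
Proof. by exists 1; exact: sdiff_id. Qed.

Lemma holD f g p : hol f p -> hol g p -> hol (fun x => f x + g x) p.
Proof. by move=> [a fa] [b gb]; exists (a + b); exact: sdiffD. Qed.

Lemma holM f g p : hol f p -> hol g p -> hol (fun x => f x * g x) p.
Proof. by move=> [a fa] [b gb]; eexists; exact: sdiffM fa gb. Qed.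

Lemma holX f n p : hol f p -> hol (fun x => f x ^+ n) p.
Proof. by move=> [a fa]; eexists; exact: sdiffX fa. Qed.

Lemma hol_comp f g p : hol f p -> hol g (f p) -> hol (g \o f) p.
Proof. by move=> [a fa] [b gb]; eexists; exact: sdiff_comp fa gb. Qed.

Lemma holV f p : f p != 0 -> hol f p -> hol (fun x => (f x)^-1) p.
Proof.
move=> fp0 fp; apply: (hol_comp (g := fun y => y^-1) fp).
by eexists; exact: sdiffV.
Qed.

Lemma hol_exprz f (m : int) p : f p != 0 -> hol f p -> hol (fun x => f x ^ m) p.
Proof.
move=> fp0 fp; case: m => n; first exact: holX.
by apply: holV; [rewrite expf_neq0 | exact: holX].
Qed.

Lemma hol_prod (I : Type) (r : seq I) (P : pred I) (F : I -> R[i] -> R[i]) p :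
  (forall i, P i -> hol (F i) p) -> hol (fun x => \prod_(i <- r | P i) F i x) p.
Proof.
move=> FP; elim: r => [|i r IH].
  by have := hol_cst 1 p; congr hol; apply/funext => x; rewrite big_nil.
have [Pi|Pi] := boolP (P i); last first.
  by move: IH; congr hol; apply/funext => x; rewrite big_cons (negbTE Pi).
by have := holM (FP _ Pi) IH; congr hol; apply/funext => x; rewrite big_cons Pi.
Qed.

Lemma hol_root4 f p : slit (f p) -> hol f p -> hol (root4 \o f) p.
Proof. by move=> sp fp; apply: hol_comp fp _; eexists; exact: root4_sdiff. Qed.

End Holomorphic.

(** * Restriction to real segments, and uniqueness of primitives up to quarter turns *)

Section RealRestriction.
Variable R : realType.
Implicit Types (p d x y z w : R[i]) (f g : R[i] -> R[i]).

Lemma is_derive_estimate (u : R -> R) (t d : R) :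
  (forall e, 0 < e -> \forall h \near 0, `|u (t + h) - u t - d * h| <= e * `|h|) ->
  is_derive t 1 u d.
Proof.
move=> H; have cv : (fun h : R => h^-1 *: (u (h *: (1 : R) + t) - u t)) @ 0^' --> d.
  apply/cvgrPdist_le => e e0; have := H _ e0; rewrite near_withinE.
  apply: filterS => h hE h0.
  have -> : d - h^-1 *: (u (h *: (1 : R) + t) - u t) =
      - h^-1 * (u (t + h) - u t - d * h).
    have -> : h *: (1 : R) + t = t + h by rewrite addrC /GRing.scale /= mulr1.
    by rewrite /GRing.scale /=; field.
  rewrite normrM normrN normfV mulrC ler_pdivrMr ?normr_gt0//.
split; last exact: cvg_lim cv.
by apply/cvg_ex; exists d.
Qed.

Lemma sdiff_is_derive f (t : R) d : sdiff f t%:C d ->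
  is_derive t 1 (fun s : R => complex.Re (f s%:C)) (complex.Re d) /\
  is_derive t 1 (fun s : R => complex.Im (f s%:C)) (complex.Im d).
Proof.
move=> fd; split; apply: is_derive_estimate => e /fd[r r0 H].
all: have near_r : \forall h \near (0 : R), `|h| < r by exact: nbhs0_lt.
all: near=> h; have hr : `|h| < r by near: h; exact: near_r.
all: have := H (t + h)%:C t%:C.
all: rewrite -!rmorphB /= subrr cabs0 addrAC subrr add0r cabs_real => /(_ hr r0).
- apply: le_trans; apply: le_trans (cabs_Re _).
  by rewrite !ReImE mulr0 subr0.
- apply: le_trans; apply: le_trans (cabs_Im _).
  by rewrite !ReImE mulr0 add0r.
Unshelve. all: by end_near. Qed.

Lemma hol_real_cvg f (t : R) : hol f t%:C ->
  ((fun s : R => f s%:C) : R -> R[i]^o) @ t --> (f t%:C : R[i]^o).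
Proof.
move=> /hol_cvg ft; apply: (cvg_comp (fun s : R => s%:C : R[i]^o)) ft.
by apply: cvgc_real; exact: cvg_id.
Qed.

Lemma within_segment_cont (u : R -> R) (a b : R) :
  (forall t, a <= t <= b -> {for t, continuous u}) -> {within `[a, b], continuous u}.
Proof.
move=> H; apply: continuous_in_subspaceT => t /set_mem /=.
by rewrite in_itv; exact: H.
Qed.

(** The mean value theorem is applied to the real and the imaginary part separately, along the
    segment from [p] to [x]. *)
Lemma sdiff0_cst f p (r : R) : (forall x, cabs (x - p) < r -> sdiff f x 0) ->
  forall x, cabs (x - p) < r -> f x = f p.
Proof.
move=> H x xr; pose g (w : R[i]) := f (p + w * (x - p)).
have gt (t : R) : 0 <= t <= 1 -> sdiff g t%:C 0.
  move=> /andP[t0 t1]; rewrite -(mul0r (1 * (x - p))).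
  have -> : g = f \o (fun w => p + w * (x - p)) by [].
  apply: sdiff_comp; last first.
    apply: H; rewrite addrAC subrr add0r cabsM cabs_real ger0_norm//.
    by apply: le_lt_trans xr; rewrite ler_piMl ?cabs_ge0.
  have := sdiffD (sdiff_cst p t%:C) (sdiffM (sdiff_id t%:C) (sdiff_cst (x - p) t%:C)).
  by rewrite add0r mulr0 addr0.
have g01 : g 1 = g 0.
  have ct (t : R) : 0 <= t <= 1 -> ((fun s : R => g s%:C) : R -> R[i]^o) @ t --> (g t%:C : R[i]^o).
    by move=> /gt g0; apply: hol_real_cvg; exists 0.
  apply: eqc_ReIm.
    have [| |c _] := @MVT_segment R (fun s => complex.Re (g s%:C)) (fun=> 0) 0 1 ler01.
    - by move=> t; rewrite in_itv /= => /andP[t0 t1]; apply: (sdiff_is_derive (gt _ _)).1; rewrite !ltW.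
    - by apply: within_segment_cont => t /ct; exact: cvgc_Re.
    by rewrite mul0r => /eqP; rewrite subr_eq0 => /eqP.
  have [| |c _] := @MVT_segment R (fun s => complex.Im (g s%:C)) (fun=> 0) 0 1 ler01.
  - by move=> t; rewrite in_itv /= => /andP[t0 t1]; apply: (sdiff_is_derive (gt _ _)).2; rewrite !ltW.
  - by apply: within_segment_cont => t /ct; exact: cvgc_Im.
  by rewrite mul0r => /eqP; rewrite subr_eq0 => /eqP.
by move: g01; rewrite /g mul1r mul0r addr0 addrC subrK.
Qed.

Lemma expr4_eq1 z : z ^+ 4 = 1 -> exists k : 'Z_4, z = 'i ^+ k.
Proof.
move=> /eqP; rewrite -subr_eq0.
have -> : z ^+ 4 - 1 = (z - 1) * (z - 'i) * (z + 1) * (z + 'i).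
  have i2 : ('i : R[i]) * 'i = -1 by rewrite -expr2 sqr_i.
  transitivity ((z ^+ 2 - 1) * (z ^+ 2 - 'i * 'i)); last by ring.
  by rewrite i2; ring.
rewrite !mulf_eq0 => /orP[/orP[/orP[]|]|] h.
- by exists 0; apply/eqP; rewrite -subr_eq0.
- by exists 1; apply/eqP; rewrite -subr_eq0.
- by exists 2; rewrite /= sqr_i; apply/eqP; rewrite -addr_eq0.
- exists 3; rewrite /= exprSr sqr_i mulN1r.
  by apply/eqP; rewrite -addr_eq0.
Qed.

Lemma expr4_eq x y : x ^+ 4 = y ^+ 4 -> exists k : 'Z_4, x = 'i ^+ k * y.
Proof.
have [->|y0] := eqVneq y 0.
  by move=> /eqP; rewrite expr0n expf_eq0 => /eqP ->; exists 0; rewrite mulr0.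
move=> xy; have [|k xk] := @expr4_eq1 (x / y).
  by rewrite expr_div_n xy divff// expf_neq0.
by exists k; rewrite -xk divfK.
Qed.

Lemma i_neq0 : ('i : R[i]) != 0.
Proof. by rewrite eq_complex /= eqxx oner_eq0. Qed.

Lemma cabs_i : cabs ('i : R[i]) = 1.
Proof. by rewrite /cabs /= expr0n expr1n add0r sqrtr1. Qed.

Lemma exprM4i (n : nat) : ('i : R[i]) ^+ (n %% 4) = 'i ^+ n.
Proof.
rewrite {2}(divn_eq n 4) exprD mulnC exprM.
by rewrite (exprM _ 2 2) sqr_i sqrrN !expr1n mul1r.
Qed.

Lemma exprZ4D (k l : 'Z_4) : ('i : R[i]) ^+ (k + l)%R = 'i ^+ k * 'i ^+ l.
Proof. by rewrite -exprD -[RHS]exprM4i. Qed.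

(** Distinct fourth roots of unity are at distance at least the square root of 2. Through this
    lemma, estimates become equalities in ['Z_4]. *)
Lemma exprZ4_inj (k l : 'Z_4) : cabs (('i : R[i]) ^+ k - 'i ^+ l) <= 1 -> k = l.
Proof.
have H (m : 'Z_4) : cabs (('i : R[i]) ^+ m - 1) <= 1 -> m = 0.
  case: m => -[|[|[|[|//]]]] mlt h; apply/val_inj => //=; exfalso; move: h => /=.
  - rewrite expr1 -(ler_pXn2r (n := 2))// ?nnegrE ?cabs_ge0// cabs_sqr /=; lra.
  - rewrite sqr_i -(ler_pXn2r (n := 2))// ?nnegrE ?cabs_ge0// cabs_sqr /=; lra.
  - rewrite exprS sqr_i -(ler_pXn2r (n := 2))// ?nnegrE ?cabs_ge0// cabs_sqr /=; lra.
have {1}-> : k = (k - l) + l by rewrite subrK.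
rewrite exprZ4D -[X in _ - X]mul1r -mulrBl cabsM cabsX cabs_i expr1n mulr1 => /H.
by move/eqP; rewrite subr_eq0 => /eqP.
Qed.

(** At each point the derivatives differ by a fourth root of unity. They are continuous and [G' p]
    is not 0, so this root does not change near [p], and then F - i^k G has derivative 0. *)
Lemma primitive_uniq (F F' G G' : R[i] -> R[i]) p :
  (\forall x \near (p : R[i]^o), sdiff F x (F' x)) ->
  (\forall x \near (p : R[i]^o), sdiff G x (G' x)) ->
  (\forall x \near (p : R[i]^o), F' x ^+ 4 = G' x ^+ 4) -> G' p != 0 ->
  exists (k : 'Z_4), F' p = 'i ^+ k * G' p /\
    exists t : R[i], \forall x \near (p : R[i]^o), F x = 'i ^+ k * G x + t.
Proof.
move=> FF GG FG Gp0; have [k Fk] := expr4_eq (nbhs_singleton FG).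
exists k; split=> //.
have := sdiff_deriv_cvg FF; have := sdiff_deriv_cvg GG.
move=> /cvgc_nearP cG /cvgc_nearP cF.
(* If both derivatives move by less than a quarter of |G' p|, the two moves add up to at most |G' p|
   / 2, while |G' x| is still at least 3/4 |G' p|; hence the two roots of unity differ by at most
   1. *)
pose e := cabs (G' p) / 4; have Gp : 0 < cabs (G' p) by rewrite cabs_gt0.
have e0 : 0 < e by rewrite divr_gt0.
have : \forall x \near (p : R[i]^o), sdiff (fun x => F x + (- 'i ^+ k) * G x) x 0.
  near=> x.
  have Fx : sdiff F x (F' x) by near: x; exact: FF.
  have Gx : sdiff G x (G' x) by near: x; exact: GG.
  have FGx : F' x ^+ 4 = G' x ^+ 4 by near: x; exact: FG.
  have cGx : cabs (G' x - G' p) < e by near: x; exact: cG.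
  have cFx : cabs (F' x - F' p) < e by near: x; exact: cF.
  have [l Fl] := expr4_eq FGx.
  suff lk : l = k.
    have := sdiffD Fx (sdiffZ (- 'i ^+ k) Gx).
    by rewrite Fl lk mulNr subrr.
  have Gx0 : cabs (G' p) * (3 / 4) <= cabs (G' x).
    have := cabs_sub (G' p) (G' x); rewrite cabsC => h; move: cGx; rewrite /e; lra.
  have Gx1 : 0 < cabs (G' x) by apply: lt_le_trans Gx0; rewrite mulr_gt0//; lra.
  apply: exprZ4_inj; rewrite -(ler_pM2r Gx1) mul1r -cabsM mulrBl -Fl.
  have -> : F' x - 'i ^+ k * G' x = (F' x - F' p) - 'i ^+ k * (G' x - G' p).
    by rewrite Fk; ring.
  apply: le_trans (cabsB _ _) _; rewrite cabsM cabsX cabs_i expr1n mul1r.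
  by move: Gx0 cGx cFx; rewrite /e; lra.
move=> /nbhs_cabsP[r r0 /sdiff0_cst H].
exists (F p - 'i ^+ k * G p); apply/nbhs_cabsP; exists r => // x /H.
by rewrite !mulNr => <-; ring.
Unshelve. all: by end_near. Qed.

End RealRestriction.

(** * Primitives by radial integration *)

Section UnitInterval.
Variable R : realType.

(** The one compactness argument of the proof. It gives uniform estimates along a ray and, later, a
    Lebesgue number for the cover of a loop by the two chart domains. *)
Lemma unit_interval_uniform (P : R -> R -> Prop) :
  (forall t r s, s <= r -> P t r -> P t s) ->
  (forall t, 0 <= t <= 1 -> exists2 r, 0 < r &
    forall s, `|s - t| < r -> 0 <= s <= 1 -> P s r) ->
  exists2 r, 0 < r & forall t, 0 <= t <= 1 -> P t r.
Proof.
move=> Pmono Ploc.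
have /compact_near_coveringP : compact (`[0, 1]%classic : set R) by exact: segment_compact.
move=> /(_ R (0^'+) (fun r t => 0 <= t <= 1 -> P t r)) H.
suff : \forall r \near 0^'+, `[0, 1] `<=` (fun t => 0 <= t <= 1 -> P t r).
  move=> K; near (0 : R)^'+ => r; exists r => // t t01.
  have /= := near K r; apply=> //.
apply: H => t; rewrite /= in_itv => /= /Ploc[r r0 Hr].
exists (ball t r, [set s | 0 < s < r]) => /=.
  split; first exact: nbhsx_ballx.
  near=> s; apply/andP; split => //.
move=> [s d] [/= ts /andP[d0 dr]] s01; apply: Pmono (ltW dr) _.
by apply: Hr => //; rewrite distrC.
Unshelve. all: by end_near. Qed.

End UnitInterval.

Section ComplexIntegral.
Variable R : realType.
Implicit Types (p d x y z w : R[i]) (f g : R -> R[i]).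
Let mu := @lebesgue_measure R.

Definition cont01 f := forall t : R, 0 <= t <= 1 ->
  (f : R -> R[i]^o) @ t --> (f t : R[i]^o).

Definition cint f : R[i] := (\int[mu]_(t in `[0, 1]) complex.Re (f t))%R +i*
  (\int[mu]_(t in `[0, 1]) complex.Im (f t))%R.

Let itv01P (t : R) : `[0, 1]%classic t <-> 0 <= t <= 1.
Proof. by rewrite /= in_itv. Qed.

Lemma cont01_integrable f : cont01 f ->
  mu.-integrable `[0, 1] (EFin \o (fun t => complex.Re (f t))) /\
  mu.-integrable `[0, 1] (EFin \o (fun t => complex.Im (f t))).
Proof.
move=> cf; split; (apply: continuous_compact_integrable; first exact: segment_compact);
  apply: within_segment_cont => t /cf; [exact: cvgc_Re | exact: cvgc_Im].
Qed.

Lemma eq_cint f g : (forall t, 0 <= t <= 1 -> f t = g t) -> cint f = cint g.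
Proof.
by move=> fg; apply: eqc_ReIm => /=; apply: eq_Rintegral => t /set_mem/itv01P/fg ->.
Qed.

Lemma cintD f g : cont01 f -> cont01 g ->
  cint (fun t => f t + g t) = cint f + cint g.
Proof.
move=> /cont01_integrable[fr fi] /cont01_integrable[gr gi].
apply: eqc_ReIm => /=; rewrite -RintegralD//;
  by apply: eq_Rintegral => t _; rewrite !ReImE.
Qed.

Lemma cintM c f : cont01 f -> cint (fun t => c * f t) = c * cint f.
Proof.
move=> cf; have [fr fi] := cont01_integrable cf.
have mI : measurable (`[0, 1]%classic : set R) by [].
have Z (a : R) (u : R -> R) : mu.-integrable `[0, 1] (EFin \o u) ->
    mu.-integrable `[0, 1] (EFin \o (fun t => a * u t)).
  move=> iu; rewrite (_ : _ \o _ = fun t => (a%:E * (EFin \o u) t)%E).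
    exact: integrableZl.
  by apply/funext => t; rewrite /= EFinM.
apply: eqc_ReIm; rewrite !ReImE /= -!RintegralZl//.
  by rewrite -RintegralB ?Z//; apply: eq_Rintegral => t _; rewrite !ReImE.
by rewrite -RintegralD ?Z//; apply: eq_Rintegral => t _; rewrite !ReImE.
Qed.

Lemma cont01D f g : cont01 f -> cont01 g -> cont01 (fun t => f t + g t).
Proof. by move=> cf cg t t01; apply: cvgcD; [exact: cf|exact: cg]. Qed.

Lemma cont01M f g : cont01 f -> cont01 g -> cont01 (fun t => f t * g t).
Proof. by move=> cf cg t t01; apply: cvgcM; [exact: cf|exact: cg]. Qed.

Lemma cont01_eq f g : f =1 g -> cont01 f -> cont01 g.
Proof. by move=> /funext ->. Qed.

Lemma cont01_cst c : cont01 (fun=> c).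
Proof. by move=> t _; exact: cvg_cst. Qed.

Lemma cont01_hol (f : R[i] -> R[i]) : (forall t : R, 0 <= t <= 1 -> hol f t%:C) ->
  cont01 (fun t => f t%:C).
Proof. by move=> fh t t01; exact: hol_real_cvg (fh _ t01). Qed.

(** The factor 2 comes from bounding real and imaginary parts separately; [radint_sdiff] absorbs it
    by working with e / 2. *)
Lemma cint_le f (M : R) : cont01 f -> (forall t, 0 <= t <= 1 -> cabs (f t) <= M) ->
  cabs (cint f) <= 2 * M.
Proof.
move=> /cont01_integrable[fr fi] fM; apply: le_trans (cabs_le _) _.
have mI : measurable (`[0, 1]%classic : set R) by [].
have mu01 : (fine (mu `[0, 1]%classic) = 1)%R.
  by rewrite /mu lebesgue_measure_itv /= lte_fin ltr01 -EFinD /= subr0.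
have H (u : R -> R) : mu.-integrable `[0, 1] (EFin \o u) ->
    (forall t, 0 <= t <= 1 -> `|u t| <= M) ->
    (`|\int[mu]_(t in `[0, 1]) u t| <= M)%R.
  move=> iu uM; apply: le_trans (le_normr_Rintegral _ iu) _ => //.
  have -> : M = (\int[mu]_(t in `[0, 1]) (cst M t))%R.
    by rewrite Rintegral_cst// mu01 mulr1.
  apply: le_Rintegral => //.
  - exact: (integrable_norm iu).
  - apply: continuous_compact_integrable; first exact: segment_compact.
    by apply: within_segment_cont => t _; exact: cvg_cst.
rewrite mulr_natl mulr2n; apply: lerD => /=.
  by apply: H => // t t01; exact: le_trans (cabs_Re _) (fM _ t01).
by apply: H => // t t01; exact: le_trans (cabs_Im _) (fM _ t01).
Qed.

Lemma cint_FTC (g g' : R[i] -> R[i]) :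
  (forall t : R, 0 <= t <= 1 -> sdiff g t%:C (g' t%:C)) ->
  cont01 (fun t => g' t%:C) -> cint (fun t => g' t%:C) = g 1 - g 0.
Proof.
move=> gg' cg'.
have gc : cont01 (fun t => g t%:C).
  by apply: cont01_hol => t /gg' gt; eexists; exact: gt.
have FTC (u v : R -> R) : (forall t : R, 0 <= t <= 1 -> is_derive t 1 u (v t)) ->
    (forall t : R, 0 <= t <= 1 -> {for t, continuous v}) ->
    (forall t : R, 0 <= t <= 1 -> {for t, continuous u}) ->
    (\int[mu]_(t in `[0, 1]) v t)%R = u 1 - u 0.
  move=> uv cv cu; rewrite /Rintegral (@continuous_FTC2 R v u 0 1)//.
  - exact: within_segment_cont.
  - split=> [t|  |].
    + by rewrite in_itv => /andP[t0 t1]; have [] := uv t; rewrite ?ltW.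
    + by apply: cvg_at_right_filter; apply: cu; rewrite lexx ler01.
    + by apply: cvg_at_left_filter; apply: cu; rewrite lexx ler01.
  - move=> t; rewrite in_itv => /andP[t0 t1].
    by rewrite derive1E; have [] := uv t; rewrite ?ltW.
apply: eqc_ReIm; rewrite !ReImE /=.
  apply: (FTC (fun t => complex.Re (g t%:C)) (fun t => complex.Re (g' t%:C))) => t t01.
  - exact: (sdiff_is_derive (gg' _ t01)).1.
  - exact: cvgc_Re (cg' _ t01).
  - exact: cvgc_Re (gc _ t01).
apply: (FTC (fun t => complex.Im (g t%:C)) (fun t => complex.Im (g' t%:C))) => t t01.
- exact: (sdiff_is_derive (gg' _ t01)).2.
- exact: cvgc_Im (cg' _ t01).
- exact: cvgc_Im (gc _ t01).
Qed.

End ComplexIntegral.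
Arguments cont01_cst {R} c t _.

Section RadialIntegral.
Variable R : realType.
Implicit Types (p d x y z w : R[i]).

(* The substitution t^4 keeps the integrand of the primitive of s^(a-1) h (s)
   regular at 0 when a is a positive multiple of 1/4. *)
Definition radint (j : nat) (h : R[i] -> R[i]) x :=
  cint (fun t : R => t%:C ^+ j * h (t%:C ^+ 4 * x)).

Lemma realX (t : R) n : t%:C ^+ n = (t ^+ n)%:C.
Proof. by rewrite rmorphXn. Qed.

Lemma half_scale_lt (r c : R) : 0 < r -> 0 < c -> r / c / 2 * c < r.
Proof.
move=> r0 c0; have -> : r / c / 2 * c = r / 2 by field; rewrite gt_eqF.
by rewrite ltr_pdivrMr// ltr_pMr// ltr1n.
Qed.

Lemma expr4_01 (t : R) : 0 <= t <= 1 -> 0 <= t ^+ 4 <= 1.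
Proof. by move=> /andP[t0 t1]; rewrite exprn_ge0// exprn_ile1. Qed.

Variables (h : R[i] -> R[i]) (p : R[i]).
Hypothesis hp : forall t : R, 0 <= t <= 1 ->
  \forall x \near ((t%:C * p) : R[i]^o), hol h x.

Lemma near_ray_dist (s t r : R) x : 0 <= s <= 1 -> 0 < r ->
  `|s - t| < r -> cabs (x - p) < r ->
  cabs (s%:C * x - t%:C * p) <= r * (1 + cabs p).
Proof.
move=> /andP[s0 s1] r0 st xp.
have -> : s%:C * x - t%:C * p = s%:C * (x - p) + (s - t)%:C * p.
  by rewrite rmorphB; ring.
apply: le_trans (cabsD _ _) _; rewrite !cabsM !cabs_real mulrDr mulr1 (ger0_norm s0).
apply: lerD; last by rewrite ler_wpM2r ?cabs_ge0// ltW.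
by apply: le_trans (ltW xp); rewrite ler_piMl ?cabs_ge0.
Qed.

Lemma hol_near_ray : exists2 r : R, 0 < r & forall t : R, 0 <= t <= 1 ->
  forall x, cabs (x - p) < r -> hol h (t%:C * x).
Proof.
apply: unit_interval_uniform => [t r s sr H x xs|t t01].
  by apply: H; exact: lt_le_trans sr.
have /nbhs_cabsP[r r0 H] := hp t01.
have c0 : 0 < 1 + cabs p by rewrite ltr_pwDl ?cabs_ge0.
exists (r / (1 + cabs p) / 2); rewrite ?divr_gt0// => s st s01 x xp.
apply: H; apply: le_lt_trans (near_ray_dist s01 _ st xp) _; rewrite ?divr_gt0//.
exact: half_scale_lt.
Qed.

Lemma hol_ray (t : R) : 0 <= t <= 1 -> hol h (t%:C * p).
Proof. by move=> t01; exact: nbhs_singleton (hp t01). Qed.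

(** Near a fixed t, strict differentiability at [t%:C * p] gives the estimate with the derivative at
    that point; continuity of the derivative replaces it by the derivative at [s%:C * p] for s close
    to t, and compactness makes the radius uniform. *)
Lemma uniform_sdiff_ray (e : R) : 0 < e ->
  exists2 r : R, 0 < r & forall t : R, 0 <= t <= 1 ->
  forall x y, cabs (x - p) < r -> cabs (y - p) < r ->
    cabs (h (t%:C * x) - h (t%:C * y) - cderiv h (t%:C * p) * (t%:C * (x - y)))
      <= e * cabs (x - y).
Proof.
move=> e0; apply: unit_interval_uniform => [t r s sr H x y xs ys|t t01].
  by apply: H; exact: lt_le_trans sr.
have e2 : 0 < e / 2 by rewrite divr_gt0.
have [r r0 Hr] := holP (hol_ray t01) e2.
have hh : \forall x \near ((t%:C * p) : R[i]^o), sdiff h x (cderiv h x).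
  by apply: filterS (hp t01) => x; exact: holP.
have /cvgc_nearP/(_ _ e2)/nbhs_cabsP[q q0 Hq] := sdiff_deriv_cvg hh.
have c0 : 0 < 1 + cabs p by rewrite ltr_pwDl ?cabs_ge0.
pose u := Num.min r q; have u0 : 0 < u by rewrite lt_min r0.
exists (u / (1 + cabs p) / 2); rewrite ?divr_gt0// => s st s01 x y xp yp.
have D z : cabs (z - p) < u / (1 + cabs p) / 2 -> cabs (s%:C * z - t%:C * p) < u.
  move=> zp; apply: le_lt_trans (near_ray_dist s01 _ st zp) _; rewrite ?divr_gt0//.
  exact: half_scale_lt.
have := D _ xp; rewrite lt_min => /andP[xr _].
have := D _ yp; rewrite lt_min => /andP[yr _].
have : cabs (s%:C * p - t%:C * p) < u by apply: D; rewrite subrr cabs0 !divr_gt0.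
rewrite lt_min => /andP[_ pq].
have -> : h (s%:C * x) - h (s%:C * y) - cderiv h (s%:C * p) * (s%:C * (x - y)) =
  (h (s%:C * x) - h (s%:C * y) - cderiv h (t%:C * p) * (s%:C * x - s%:C * y)) -
  (cderiv h (s%:C * p) - cderiv h (t%:C * p)) * (s%:C * (x - y)) by ring.
have sxy : cabs (s%:C * (x - y)) <= cabs (x - y).
  by case/andP: s01 => s0 s1; rewrite cabsM cabs_real ger0_norm// ler_piMl ?cabs_ge0.
apply: le_trans (cabsB _ _) _; rewrite (splitr e) [leRHS]mulrDl; apply: lerD.
  apply: le_trans (Hr _ _ xr yr) _; rewrite -mulrBr.
  by rewrite ler_pM2l.
rewrite cabsM; apply: ler_pM; rewrite ?cabs_ge0//.
exact: ltW (Hq _ pq).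
Qed.

Lemma cont01_expr (j : nat) : cont01 (fun t : R => t%:C ^+ j).
Proof. by apply: (cont01_hol (f := fun w => w ^+ j)) => t _; exact/holX/hol_id. Qed.

Lemma hol_scale (c : R[i]) x : hol (fun w => w ^+ 4 * c) x.
Proof. by apply: holM (hol_cst _ _); exact/holX/hol_id. Qed.

Lemma cont01_ray (j : nat) x : (forall t : R, 0 <= t <= 1 -> hol h (t%:C * x)) ->
  cont01 (fun t : R => t%:C ^+ j * h (t%:C ^+ 4 * x)).
Proof.
move=> hx; apply: cont01M; first exact: cont01_expr.
apply: (cont01_hol (f := h \o (fun w => w ^+ 4 * x))) => t t01.
apply: hol_comp; first exact: hol_scale.
by rewrite realX; apply: hx; exact: expr4_01.
Qed.

Lemma cont01_deriv_ray (j : nat) :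
  cont01 (fun t : R => t%:C ^+ j * cderiv h (t%:C ^+ 4 * p)).
Proof.
apply: cont01M; first exact: cont01_expr.
move=> t t01; have ht : \forall x \near (((t ^+ 4)%:C * p) : R[i]^o), sdiff h x (cderiv h x).
  by apply: filterS (hp (expr4_01 t01)) => x; exact: holP.
have := sdiff_deriv_cvg ht; rewrite -realX => H.
apply: (cvg_comp (fun s : R => s%:C ^+ 4 * p : R[i]^o) (cderiv h : R[i]^o -> R[i]^o) _ H).
exact: (hol_real_cvg (f := fun w => w ^+ 4 * p) (hol_scale _ _)).
Qed.

Definition radint' (j : nat) :=
  cint (fun t : R => t%:C ^+ (j + 4) * cderiv h (t%:C ^+ 4 * p)).

(** Differentiation under the integral sign. *)
Lemma radint_sdiff (j : nat) : sdiff (radint j h) p (radint' j).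
Proof.
move=> e e0; have e2 : 0 < e / 2 by rewrite divr_gt0.
have [r r0 Hr] := uniform_sdiff_ray e2; have [q q0 Hq] := hol_near_ray.
exists (Num.min r q) => [|x y]; first by rewrite lt_min r0.
rewrite !lt_min => /andP[xr xq] /andP[yr yq].
have cx := cont01_ray (j := j) (fun t t01 => Hq t t01 _ xq).
have cy := cont01_ray (j := j) (fun t t01 => Hq t t01 _ yq).
have cd := cont01_deriv_ray (j := (j + 4)%N).
have c1 := cont01M (cont01_cst (-1)) cy.
have c2 := cont01M (cont01_cst (- (x - y))) cd.
have -> : radint j h x - radint j h y - radint' j * (x - y) =
    cint (fun t : R => t%:C ^+ j * (h (t%:C ^+ 4 * x) - h (t%:C ^+ 4 * y) -
      cderiv h (t%:C ^+ 4 * p) * (t%:C ^+ 4 * (x - y)))).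
  transitivity (radint j h x + (-1) * radint j h y + (- (x - y)) * radint' j).
    by ring.
  rewrite /radint /radint' -(cintM _ cy) -(cintM _ cd) -(cintD cx c1).
  rewrite -(cintD (cont01D cx c1) c2).
  by apply: eq_cint => t _; rewrite exprD; ring.
have -> : e * cabs (x - y) = 2 * (e / 2 * cabs (x - y)) by field.
apply: cint_le.
  apply: (cont01_eq (f := fun t : R => t%:C ^+ j * h (t%:C ^+ 4 * x)
   + -1 * (t%:C ^+ j * h (t%:C ^+ 4 * y)) +
   - (x - y) * (t%:C ^+ (j + 4) * cderiv h (t%:C ^+ 4 * p)))).
    by move=> t; rewrite exprD; ring.
  exact: (cont01D (cont01D cx c1) c2).
move=> t t01; rewrite cabsM !realX cabs_real.
have /andP[t0 t1] := t01.
apply: le_trans (Hr _ (expr4_01 t01) _ _ xr yr).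
by rewrite ler_piMl ?cabs_ge0// normrX exprn_ile1// ger0_norm.
Qed.

(** The fundamental theorem for w^(j+1) h(w^4 p) on [0, 1]. This identity collapses the product rule
    for [Fprim] (with j = 3) and for [cone_prim] (with j = q) to the bare integrand. *)
Lemma radint_eq (j : nat) :
  j.+1%:R * radint j h p + 4 * p * radint' j = h p.
Proof.
pose g' (w : R[i]) := j.+1%:R * (w ^+ j * h (w ^+ 4 * p)) +
  4 * p * (w ^+ (j + 4) * cderiv h (w ^+ 4 * p)).
have := @cint_FTC R (fun w => w ^+ j.+1 * h (w ^+ 4 * p)) g'.
rewrite !expr1n !mul1r expr0n /= mul0r subr0 => <-.
- have c1 := cont01_ray (j := j) hol_ray; have c2 := cont01_deriv_ray (j := (j + 4)%N).
  rewrite (cintD (cont01M (cont01_cst j.+1%:R) c1) (cont01M (cont01_cst (4 * p)) c2)).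
  by rewrite (cintM _ c1) (cintM _ c2).
- move=> t t01; have ht := holP (hol_ray (expr4_01 t01)).
  rewrite -realX in ht.
  have s4 := sdiffM (sdiffX 4 (sdiff_id (t%:C : R[i]))) (sdiff_cst p t%:C).
  have := sdiffM (sdiffX j.+1 (sdiff_id (t%:C : R[i]))) (sdiff_comp s4 ht).
  rewrite /g' (_ : _ + _ = j.+1%:R * (t%:C ^+ j * h (t%:C ^+ 4 * p)) +
    4 * p * (t%:C ^+ (j + 4) * cderiv h (t%:C ^+ 4 * p)))//.
  by rewrite /= exprD !exprS; ring.
- apply: cont01D; apply: cont01M; first exact: cont01_cst.
  + exact: cont01_ray hol_ray.
  + exact: cont01_cst.
  + exact: cont01_deriv_ray.
Qed.

End RadialIntegral.

(** * Schwarz-Christoffel primitives on a plane cut along rays *)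

Section SchwarzChristoffel.
Variables (R : realType) (n : nat) (a : 'I_n -> R[i]) (m : 'I_n -> int).
Implicit Types z : R[i].

(** The factor [1 - a i * z] leaves the slit plane exactly when [a i * z] is real and at least 1,
    that is, on the ray from [(a i)^-1] to infinity. *)
Definition Omega z := forall i, slit (1 - a i * z).

Definition hfun z := \prod_i root4 (1 - a i * z) ^ m i.

(** The integral of [hfun] along the segment from 0 to z, parametrized by t^4 z; the differential 4
    t^3 z dt explains the factor and the weight. *)
Definition Fprim z := 4 * z * radint 3 hfun z.

Lemma Omega_star (t : R) z : 0 <= t <= 1 -> Omega z -> Omega (t%:C * z).
Proof.
move=> t01 Oz i; have := slit_conv t01 (Oz i).
by congr slit; rewrite rmorphB /=; ring.
Qed.

Lemma hol_slit_factor (c : R[i]) z : hol (fun x => 1 - c * x) z.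
Proof.
exists (0 + (- c) * 1).
apply: sdiff_eq (sdiffD (sdiff_cst 1 z) (sdiffZ (- c) (sdiff_id z))) => x.
by rewrite mulNr.
Qed.

Lemma Omega_near z : Omega z -> \forall x \near (z : R[i]^o), Omega x.
Proof.
move=> Oz; apply: (@filter_forall _ _ (fun i x => slit (1 - a i * x)) (nbhs (z : R[i]^o)) _).
move=> i; exact: (hol_cvg (hol_slit_factor (a i) z) (slit_open (Oz i))).
Qed.

Lemma root4_factor_neq0 z i : Omega z -> root4 (1 - a i * z) != 0.
Proof. by move=> Oz; exact: root4_neq0. Qed.

Lemma hol_hfun z : Omega z -> hol hfun z.
Proof.
move=> Oz; apply: hol_prod => i _; apply: (hol_exprz (f := root4 \o (fun x => 1 - a i * x))).
  exact: root4_factor_neq0.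
exact: hol_root4 (hol_slit_factor _ _).
Qed.

Lemma hfun_neq0 z : Omega z -> hfun z != 0.
Proof.
by move=> Oz; apply/prodf_neq0 => i _; rewrite expfz_neq0// root4_factor_neq0.
Qed.

Lemma exprz_exp4 (x : R[i]) (k : int) : (x ^ k) ^+ 4 = (x ^+ 4) ^ k.
Proof. by rewrite !exprnP exprzAC. Qed.

Lemma hfun4 z : Omega z -> hfun z ^+ 4 = \prod_i (1 - a i * z) ^ m i.
Proof.
move=> Oz; rewrite -prodrXl; apply: eq_bigr => i _.
by rewrite exprz_exp4 root4K.
Qed.

Lemma Fprim_sdiff z : Omega z -> sdiff Fprim z (hfun z).
Proof.
move=> Oz.
have hz (t : R) : 0 <= t <= 1 -> \forall x \near ((t%:C * z) : R[i]^o), hol hfun x.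
  move=> t01; have := Omega_near (Omega_star t01 Oz).
  by apply: filterS => x; exact: hol_hfun.
have := sdiffM (sdiffZ 4 (sdiff_id z)) (radint_sdiff hz 3).
by rewrite /= -(radint_eq hz 3) mulr1.
Qed.

Lemma Fprim_near z : Omega z -> \forall x \near (z : R[i]^o), sdiff Fprim x (hfun x).
Proof. by move=> /Omega_near; apply: filterS => x; exact: Fprim_sdiff. Qed.

End SchwarzChristoffel.

(** * Rotated stereographic coordinates *)

Section Sphere.
Variable R : realType.
Implicit Types (B F G : 'M[R]_3) (x y p : S2 R) (z : R[i]).

Lemma sum3 (V : nmodType) (f : 'I_3 -> V) : \sum_k f k = f 0 + f 1 + f 2.
Proof.
rewrite !big_ord_recl big_ord0 addr0 addrA; congr (f _ + f _ + f _);
  exact/val_inj.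
Qed.

Definition so3 B := B *m B^T = 1%:M /\ \det B = 1.

Definition crd B (k : 'I_3) x : R := (set_val x *m B^T) 0 k.

Lemma sphere_sqr x : dot (set_val x) (set_val x) = 1.
Proof. by have := set_valP x. Qed.

Lemma dotE (u v : 'rV[R]_3) : dot u v = (u *m v^T) 0 0.
Proof. by rewrite mxE; apply: eq_bigr => i _; rewrite mxE. Qed.

Lemma so3_orthoT B : so3 B -> B^T *m B = 1%:M.
Proof. by move=> [/mulmx1C]. Qed.

Lemma dot_crd B x y : so3 B ->
  dot (set_val x) (set_val y) = \sum_k crd B k x * crd B k y.
Proof.
move=> /so3_orthoT BB; rewrite dotE.
have -> : set_val x *m (set_val y)^T = (set_val x *m B^T) *m (set_val y *m B^T)^T.
  by rewrite trmx_mul trmxK -mulmxA (mulmxA B^T) BB mul1mx.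
by rewrite mxE; apply: eq_bigr => k _; rewrite [_^T k 0]mxE.
Qed.

Lemma crd_sqr B x : so3 B -> crd B 0 x ^+ 2 + crd B 1 x ^+ 2 + crd B 2 x ^+ 2 = 1.
Proof. by move=> hB; rewrite -(sphere_sqr x) (dot_crd _ _ hB) sum3 !expr2. Qed.

Lemma ord3P (k : 'I_3) : [\/ k = 0, k = 1 | k = 2].
Proof.
case: k => -[|[|[|//]]] kl; [apply: Or31|apply: Or32|apply: Or33]; exact/val_inj.
Qed.

Lemma crd_inj B x y : so3 B -> (forall k, crd B k x = crd B k y) -> x = y.
Proof.
move=> /so3_orthoT BB xy; apply: val_inj; rewrite -[LHS]mulmx1 -[RHS]mulmx1 -BB !mulmxA.
by congr (_ *m _); apply/rowP => k; exact: xy.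
Qed.

Lemma crd_row B (w : 'rV[R]_3) x k : so3 B -> set_val x = w *m B -> crd B k x = w 0 k.
Proof. by move=> [BB _] xw; rewrite /crd xw -mulmxA BB mulmx1. Qed.

Lemma sphere_pt_subproof B (w : 'rV[R]_3) : so3 B -> dot w w = 1 ->
  w *m B \in unit_sphere R.
Proof.
move=> [BB _] w1; apply/mem_set; rewrite /unit_sphere /= -w1 !dotE.
by rewrite trmx_mul -mulmxA (mulmxA B) BB mul1mx.
Qed.

Definition sphere_pt B (hB : so3 B) (w : 'rV[R]_3) (w1 : dot w w = 1) : S2 R :=
  exist _ (w *m B) (sphere_pt_subproof hB w1).

Lemma crd_sphere_pt B (hB : so3 B) w (w1 : dot w w = 1) k :
  crd B k (sphere_pt hB w1) = w 0 k.
Proof. exact: crd_row. Qed.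

Lemma cvgrD (T : Type) (F : set_system T) {FF : Filter F} (f g : T -> R) (a b : R) :
  f @ F --> a -> g @ F --> b -> (fun t => f t + g t) @ F --> a + b.
Proof. exact: cvgD. Qed.

Lemma cvgrM (T : Type) (F : set_system T) {FF : Filter F} (f g : T -> R) (a b : R) :
  f @ F --> a -> g @ F --> b -> (fun t => f t * g t) @ F --> a * b.
Proof. exact: cvgM. Qed.

Lemma lin3_cvg (T : Type) (F : set_system T) {FF : Filter F} (f g h : T -> R)
    (a b c u v w : R) :
  f @ F --> u -> g @ F --> v -> h @ F --> w ->
  (fun t => f t * a + g t * b + h t * c) @ F --> u * a + v * b + w * c.
Proof.
by move=> fu gv hw; apply: cvgD; [apply: cvgD|]; apply: cvgM => //; exact: cvg_cst.
Qed.

Lemma crd_continuous B k : continuous (crd B k).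
Proof.
move=> x; have -> : crd B k = fun y => set_val y 0 0 * B k 0 +
    set_val y 0 1 * B k 1 + set_val y 0 2 * B k 2.
  by apply/funext => y; rewrite /crd mxE sum3 !mxE.
have H j : (fun y : S2 R => set_val y 0 j) @ x --> set_val x 0 j.
  apply: (@continuous_comp _ _ _ set_val (fun u : 'rV[R]_3 => u 0 j)).
    exact: initial_continuous.
  exact: coord_continuous.
exact: (@lin3_cvg (S2 R) (nbhs x) _ _ _ _ (B k 0) (B k 1) (B k 2) _ _ _ (H 0) (H 1) (H 2)).
Qed.

Lemma cvg_S2 (T : Type) (F : set_system T) {FF : Filter F} (f : T -> S2 R) p :
  (forall j, (fun t => set_val (f t) 0 j) @ F --> set_val p 0 j) -> f @ F --> p.
Proof.
move=> fp U [? /= [[W oW <-]]] /= Wp /filterS; apply.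
have /= [P Pp PW] : nbhs (set_val p) W by exact: open_nbhs_nbhs.
have H : forall i j, \forall t \near F, P i j (set_val (f t) i j).
  by move=> i j; rewrite (ord1 i); apply: fp; rewrite -(ord1 i); exact: Pp.
apply: (@filterS _ F _ (fun t => forall i j, P i j (set_val (f t) i j))).
  by move=> t Pt; apply: PW.
by apply: filter_forall => i; apply: filter_forall => j; exact: H.
Qed.

Lemma cvg_S2_crd B (T : Type) (F : set_system T) {FF : Filter F} (f : T -> S2 R) p :
  so3 B -> (forall k, (fun t => crd B k (f t)) @ F --> crd B k p) -> f @ F --> p.
Proof.
move=> /so3_orthoT BB fp; apply: cvg_S2 => j.
have E x : set_val x 0 j = \sum_k crd B k x * B k j.
  by rewrite -[set_val x]mulmx1 -BB mulmxA mxE.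
have {}E x : set_val x 0 j = crd B 0 x * B 0 j + crd B 1 x * B 1 j + crd B 2 x * B 2 j.
  by rewrite E sum3.
rewrite E (_ : (fun t => _) = fun t => crd B 0 (f t) * B 0 j +
  crd B 1 (f t) * B 1 j + crd B 2 (f t) * B 2 j); first exact: lin3_cvg.
by apply/funext => t; rewrite E.
Qed.

Definition numS B x : R[i] := crd B 0 x +i* crd B 1 x.
Definition denS B x : R := 1 + crd B 2 x.
(* Stereographic projection from the antipode of the third row of [B]; this one
   preserves the orientation. *)
Definition stereo B x : R[i] := numS B x / (denS B x)%:C.

Lemma cabs_numS B x : so3 B -> cabs (numS B x) ^+ 2 = denS B x * (1 - crd B 2 x).
Proof. by move=> /(@crd_sqr _ x) H; rewrite cabs_sqr /= /denS; nra. Qed.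

Definition unstereo_row z : 'rV[R]_3 :=
  \row_k ([:: 2 * complex.Re z; 2 * complex.Im z; 1 - cabs z ^+ 2]`_k / (1 + cabs z ^+ 2)).

Lemma onecabs_gt0 z : 0 < 1 + cabs z ^+ 2.
Proof. by rewrite ltr_pwDl// sqr_ge0. Qed.

Lemma unstereo_subproof z : dot (unstereo_row z) (unstereo_row z) = 1.
Proof.
have d0 := onecabs_gt0 z; rewrite /dot sum3 !mxE /= !cabs_sqr in d0 *.
by field; rewrite gt_eqF.
Qed.

Definition unstereo B (hB : so3 B) z : S2 R := sphere_pt hB (unstereo_subproof z).

Lemma crd_unstereo B (hB : so3 B) z : [/\
  crd B 0 (unstereo hB z) = 2 * complex.Re z / (1 + cabs z ^+ 2),
  crd B 1 (unstereo hB z) = 2 * complex.Im z / (1 + cabs z ^+ 2) &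
  crd B 2 (unstereo hB z) = (1 - cabs z ^+ 2) / (1 + cabs z ^+ 2)].
Proof. by rewrite !crd_sphere_pt !mxE. Qed.

Lemma denS_unstereo B (hB : so3 B) z : denS B (unstereo hB z) = 2 / (1 + cabs z ^+ 2).
Proof.
have := onecabs_gt0 z; have [_ _ E] := crd_unstereo hB z; rewrite /denS E => d0.
by field; rewrite gt_eqF.
Qed.

Lemma denS_unstereo_neq0 B (hB : so3 B) z : denS B (unstereo hB z) != 0.
Proof. by rewrite denS_unstereo gt_eqF// divr_gt0// onecabs_gt0. Qed.

Lemma real_neq0 (r : R) : r != 0 -> r%:C != 0.
Proof. by move=> r0; rewrite (inj_eq (@complexI R)). Qed.

Lemma divc_real z (d : R) : z / d%:C = (complex.Re z / d) +i* (complex.Im z / d).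
Proof. by rewrite -fmorphV mulrC realM_ReIm ![_^-1 * _]mulrC. Qed.

Lemma unstereoK B (hB : so3 B) z : stereo B (unstereo hB z) = z.
Proof.
have d0 := onecabs_gt0 z; have [E0 E1 _] := crd_unstereo hB z.
rewrite /stereo divc_real denS_unstereo /= E0 E1.
by apply: eqc_ReIm => /=; field; rewrite gt_eqF.
Qed.

Lemma cabs_stereo B x : so3 B -> denS B x != 0 ->
  1 + cabs (stereo B x) ^+ 2 = 2 / denS B x.
Proof.
move=> hB D0; rewrite /stereo cabsM cabsV exprMn exprVn cabs_numS// cabs_real.
rewrite real_normK ?num_real//.
have -> : 1 - crd B 2 x = 2 - denS B x by rewrite /denS; ring.
by field.
Qed.

Lemma stereoK B (hB : so3 B) x : denS B x != 0 -> unstereo hB (stereo B x) = x.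
Proof.
move=> D0; apply: (crd_inj hB) => k; have [E0 E1 E2] := crd_unstereo hB (stereo B x).
have H := cabs_stereo hB D0; have SE := divc_real (numS B x) (denS B x).
have DE : crd B 2 x = denS B x - 1 by rewrite /denS; ring.
case: (ord3P k) => ->.
- by rewrite E0 H /stereo SE /=; field.
- by rewrite E1 H /stereo SE /=; field.
- rewrite E2 H; have -> : cabs (stereo B x) ^+ 2 = 2 / denS B x - 1 by rewrite -H; ring.
  by rewrite DE; field.
Qed.

Lemma numS_cvg B x : (numS B : S2 R -> R[i]^o) @ x --> (numS B x : R[i]^o).
Proof.
exact: (@cvgc_ReIm R _ (nbhs x) _ (numS B) (numS B x) (@crd_continuous B 0 x) (@crd_continuous B 1 x)).
Qed.

Lemma denS_cvg B x : denS B @ x --> denS B x.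
Proof.
by apply: (@cvgD _ _ _ (nbhs x)); [exact: cvg_cst|exact: crd_continuous].
Qed.

Lemma stereo_cvg B x : denS B x != 0 ->
  (stereo B : S2 R -> R[i]^o) @ x --> (stereo B x : R[i]^o).
Proof.
move=> D0.
exact: (cvgcM (@numS_cvg B x) (cvgcV (real_neq0 D0) (cvgc_real (@denS_cvg B x)))).
Qed.

Lemma unstereo_cvg B (hB : so3 B) (T : Type) (F : set_system T) {FF : Filter F}
    (f : T -> R[i]) z :
  (f : T -> R[i]^o) @ F --> (z : R[i]^o) -> (fun t => unstereo hB (f t)) @ F --> unstereo hB z.
Proof.
move=> fz; apply: (cvg_S2_crd hB) => k.
have fr := cvgc_Re (FF := FF) fz; have fi := cvgc_Im (FF := FF) fz.
have fc : (fun t => 1 + cabs (f t) ^+ 2) @ F --> 1 + cabs z ^+ 2.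
  have E w : cabs w ^+ 2 = complex.Re w * complex.Re w + complex.Im w * complex.Im w.
    by rewrite cabs_sqr !expr2.
  rewrite E (_ : (fun t => _) = fun t => 1 + (complex.Re (f t) * complex.Re (f t) +
    complex.Im (f t) * complex.Im (f t))); last by apply/funext => t; rewrite E.
  have H1 : (fun=> 1 : R) @ F --> (1 : R) by exact: cvg_cst.
  exact: (cvgrD H1 (cvgrD (cvgrM fr fr) (cvgrM fi fi))).
have fV : (fun t => (1 + cabs (f t) ^+ 2)^-1) @ F --> (1 + cabs z ^+ 2)^-1.
  by apply: cvgV => //; rewrite gt_eqF// onecabs_gt0.
have fp : (fun t => [:: 2 * complex.Re (f t); 2 * complex.Im (f t);
    1 - cabs (f t) ^+ 2]`_k) @ F --> [:: 2 * complex.Re z; 2 * complex.Im z;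
    1 - cabs z ^+ 2]`_k.
  have c2 : (fun=> 2 : R) @ F --> (2 : R) by exact: cvg_cst.
  case: (ord3P k) => -> /=.
  - exact: (cvgrM c2 fr).
  - exact: (cvgrM c2 fi).
  - have cN : (fun=> -1 : R) @ F --> (-1 : R) by exact: cvg_cst.
    have -> : 1 - cabs z ^+ 2 = 2 + (-1) * (1 + cabs z ^+ 2) by ring.
    have -> : (fun t => 1 - cabs (f t) ^+ 2) = fun t => 2 + (-1) * (1 + cabs (f t) ^+ 2).
      by apply/funext => t; ring.
    exact: (cvgrD c2 (cvgrM cN fc)).
have E w : crd B k (unstereo hB w) = [:: 2 * complex.Re w; 2 * complex.Im w;
    1 - cabs w ^+ 2]`_k * (1 + cabs w ^+ 2)^-1.
  by rewrite crd_sphere_pt mxE.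
rewrite E (_ : (fun t => _) = fun t => [:: 2 * complex.Re (f t);
  2 * complex.Im (f t); 1 - cabs (f t) ^+ 2]`_k * (1 + cabs (f t) ^+ 2)^-1).
  exact: (cvgrM fp fV).
by apply/funext => t; rewrite E.
Qed.

(** The half turn about the first axis. It exchanges the two poles and preserves the orientation,
    and it replaces the stereographic coordinate z by 1 / z. *)
Definition flip_mx : 'M[R]_3 := diag_mx (\row_k [:: 1; -1; -1]`_k).

Lemma so3_flip B : so3 B -> so3 (flip_mx *m B).
Proof.
move=> [BB dB]; split.
  rewrite trmx_mul -mulmxA (mulmxA B) BB mul1mx tr_diag_mx mulmx_diag.
  rewrite -diag_const_mx; congr diag_mx; apply/rowP => k; rewrite !mxE.
  by case: (ord3P k) => -> /=; ring.
rewrite det_mulmx dB det_diag !big_ord_recl big_ord0 !mxE /=; ring.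
Qed.

Lemma crd_flip B x : [/\ crd (flip_mx *m B) 0 x = crd B 0 x,
  crd (flip_mx *m B) 1 x = - crd B 1 x & crd (flip_mx *m B) 2 x = - crd B 2 x].
Proof.
have E k : crd (flip_mx *m B) k x = crd B k x * [:: 1; -1; -1]`_k.
  by rewrite /crd trmx_mul tr_diag_mx mulmxA mul_mx_diag !mxE.
by rewrite !E /=; split; ring.
Qed.

Lemma stereo_flip B x : so3 B -> denS B x != 0 -> denS (flip_mx *m B) x != 0 ->
  stereo B x * stereo (flip_mx *m B) x = 1.
Proof.
move=> hB; have [E0 E1 E2] := crd_flip B x; have := crd_sqr x hB.
have cR (u v : R) : complex.Re (u +i* v) = u by [].
have cI (u v : R) : complex.Im (u +i* v) = v by [].
rewrite /stereo !divc_real /numS /denS E0 E1 E2 !cR !cI => H D0 D1.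
have H1 : crd B 0 x ^+ 2 = (1 + crd B 2 x) * (1 - crd B 2 x) - crd B 1 x ^+ 2.
  by lra.
have Re1 : complex.Re (1 : R[i]) = 1 by [].
have Im1 : complex.Im (1 : R[i]) = 0 by [].
apply: eqc_ReIm; rewrite ?Re1 ?Im1 !(cReM, cImM) !cR !cI; last by field; rewrite D0 D1.
transitivity ((crd B 0 x ^+ 2 + crd B 1 x ^+ 2) / ((1 + crd B 2 x) * (1 - crd B 2 x))).
  by field; rewrite D0 D1.
by rewrite H1 subrK divff// mulf_neq0.
Qed.

End Sphere.

Section Determinant3.
Variable R : realType.

Lemma det_mx2 (M : 'M[R]_2) : \det M = M 0 0 * M 1 1 - M 0 1 * M 1 0.
Proof.
rewrite (expand_det_row _ 0) !big_ord_recl big_ord0 addr0 /cofactor !det_mx11 !mxE /=.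
have -> : fintype.lift 0 0 = 1 :> 'I_2 by exact/val_inj.
have -> : fintype.lift 1 0 = 0 :> 'I_2 by exact/val_inj.
by rewrite /= ?add0n ?addn0 expr0 expr1 mul1r mulN1r mulrN.
Qed.

Lemma det_mx3 (M : 'M[R]_3) : \det M =
  M 0 0 * (M 1 1 * M 2 2 - M 1 2 * M 2 1) -
  M 0 1 * (M 1 0 * M 2 2 - M 1 2 * M 2 0) +
  M 0 2 * (M 1 0 * M 2 1 - M 1 1 * M 2 0).
Proof.
rewrite (expand_det_row _ 0) sum3 /cofactor !det_mx2 !mxE /=.
have -> : fintype.lift 0 0 = 1 :> 'I_3 by exact/val_inj.
have -> : fintype.lift 0 1 = 2 :> 'I_3 by exact/val_inj.
have -> : fintype.lift 1 0 = 0 :> 'I_3 by exact/val_inj.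
have -> : fintype.lift 1 1 = 2 :> 'I_3 by exact/val_inj.
have -> : fintype.lift 2 0 = 0 :> 'I_3 by exact/val_inj.
have -> : fintype.lift 2 1 = 1 :> 'I_3 by exact/val_inj.
by rewrite expr0 expr1 add0n sqrrN expr1n; ring.
Qed.

Lemma so3_rows (G : 'M[R]_3) : so3 G -> forall i j,
  G i 0 * G j 0 + G i 1 * G j 1 + G i 2 * G j 2 = (i == j)%:R.
Proof.
move=> [GG _] i j; have /matrixP/(_ i j) := GG.
by rewrite !mxE sum3 !mxE.
Qed.

(* The middle row of a rotation matrix is the cross product of the other two. *)
Lemma so3_cross (G : 'M[R]_3) : so3 G -> [/\
  G 1 0 = G 2 1 * G 0 2 - G 2 2 * G 0 1,
  G 1 1 = G 2 2 * G 0 0 - G 2 0 * G 0 2 &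
  G 1 2 = G 2 0 * G 0 1 - G 2 1 * G 0 0].
Proof.
move=> sG; have H := so3_rows sG; have := sG.2; rewrite det_mx3.
have := H 0 0; have := H 1 1; have := H 2 2; have := H 0 2.
rewrite !eqxx /= => h02 h22 h11 h00 dG.
set w0 := G 2 1 * G 0 2 - G 2 2 * G 0 1.
set w1 := G 2 2 * G 0 0 - G 2 0 * G 0 2.
set w2 := G 2 0 * G 0 1 - G 2 1 * G 0 0.
have Z : (G 1 0 - w0) ^+ 2 + (G 1 1 - w1) ^+ 2 + (G 1 2 - w2) ^+ 2 = 0.
  transitivity ((G 1 0 * G 1 0 + G 1 1 * G 1 1 + G 1 2 * G 1 2) - 2 * (
    G 0 0 * (G 1 1 * G 2 2 - G 1 2 * G 2 1) -
    G 0 1 * (G 1 0 * G 2 2 - G 1 2 * G 2 0) +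
    G 0 2 * (G 1 0 * G 2 1 - G 1 1 * G 2 0)) +
    ((G 0 0 * G 0 0 + G 0 1 * G 0 1 + G 0 2 * G 0 2) *
     (G 2 0 * G 2 0 + G 2 1 * G 2 1 + G 2 2 * G 2 2) -
     (G 0 0 * G 2 0 + G 0 1 * G 2 1 + G 0 2 * G 2 2) ^+ 2)).
    by rewrite /w0 /w1 /w2; ring.
  by rewrite h11 dG h00 h22 h02; ring.
have sq0 (u v w : R) : u ^+ 2 + v ^+ 2 + w ^+ 2 = 0 -> u = 0.
  move=> uvw; apply/eqP; rewrite -sqrf_eq0 eq_le sqr_ge0 andbT.
  by have := sqr_ge0 v; have := sqr_ge0 w; lra.
split; apply/eqP; rewrite -subr_eq0; apply/eqP.
- exact: (sq0 _ _ _ Z).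
- by apply: (sq0 _ (G 1 0 - w0) (G 1 2 - w2)); lra.
- by apply: (sq0 _ (G 1 0 - w0) (G 1 1 - w1)); lra.
Qed.

Lemma so3_relative (F B : 'M[R]_3) : so3 F -> so3 B -> so3 (F *m B^T).
Proof.
move=> [FF dF] sB; have [BB dB] := sB; split.
  by rewrite trmx_mul trmxK mulmxA -(mulmxA F) (so3_orthoT sB) mulmx1.
by rewrite det_mulmx det_tr dF dB mulr1.
Qed.

End Determinant3.

Section Cis.
Variable R : realType.
Implicit Types (s t : R) (z : R[i]).

Lemma cisD s t : cis (s + t) = cis s * cis t :> R[i].
Proof. by apply: eqc_ReIm; rewrite /cis /= ?cosD ?sinD//; ring. Qed.

Lemma cabs_cis t : cabs (cis t) = 1.
Proof. by rewrite /cabs /= cos2Dsin2 sqrtr1. Qed.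

Lemma cis0 : cis 0 = 1 :> R[i].
Proof. by rewrite /cis cos0 sin0. Qed.

Lemma cis2pi : cis (2 * pi) = 1 :> R[i].
Proof. by rewrite /cis mulr_natl cos2pi sin2pi. Qed.

Lemma cis_neq0 t : cis t != 0 :> R[i].
Proof. by rewrite -cabs_eq0 cabs_cis oner_eq0. Qed.

Lemma cvg_cis (T : Type) (F : set_system T) {FF : Filter F} (f : T -> R) (a : R) :
  f @ F --> a -> ((fun u => cis (f u)) : T -> R[i]^o) @ F --> (cis a : R[i]^o).
Proof.
move=> fa; apply: cvgc_ReIm => /=.
  by apply: (cvg_comp f cos fa); exact: continuous_cos.
by apply: (cvg_comp f sin fa); exact: continuous_sin.
Qed.

(** The argument on the right half plane, where factors 1 + e with |e| < 1 lie. *)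
Definition rarg z : R := atan (complex.Im z / complex.Re z).

Lemma cos_atan_gt0 t : 0 < cos (atan t).
Proof. by rewrite cos_atan invr_gt0 sqrtr_gt0 ltr_wpDr// sqr_ge0. Qed.

Lemma sin_atan t : sin (atan t) = t * cos (atan t).
Proof.
rewrite -{2}(atanK t) /tan divfK//.
by rewrite gt_eqF// cos_atan_gt0.
Qed.

Lemma polar_rarg z : 0 < complex.Re z -> z = (cabs z)%:C * cis (rarg z).
Proof.
move=> z0; have c0 := cos_atan_gt0 (complex.Im z / complex.Re z).
have E : cabs z * cos (rarg z) = complex.Re z.
  rewrite /rarg cos_atan; set q := 1 + _.
  have -> : cabs z = complex.Re z * Num.sqrt q.
    rewrite /q -{1}(ger0_norm (ltW z0)) -sqrtr_sqr -sqrtrM ?sqr_ge0//.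
    by congr Num.sqrt; field; rewrite gt_eqF.
  by rewrite mulfK// gt_eqF// sqrtr_gt0 /q ltr_wpDr// sqr_ge0.
apply: eqc_ReIm; rewrite realM_ReIm /= ?E// /rarg sin_atan mulrCA -/(rarg z) E.
by rewrite divfK// gt_eqF.
Qed.

Lemma polar_ex z : exists t, z = (cabs z)%:C * cis t.
Proof.
have [z0|z0] := ltP 0 (complex.Re z); first by exists (rarg z); exact: polar_rarg.
have [z1|z1] := ltP (complex.Re z) 0.
  exists (rarg (- z) + pi); rewrite cisD.
  have /polar_rarg E : 0 < complex.Re (- z) by rewrite cReN oppr_gt0.
  rewrite mulrA -(cabsN z) -E; apply: eqc_ReIm; rewrite /cis cospi sinpi;
  by case: (z) => u v /=; ring.
have Re0 : complex.Re z = 0 by apply/eqP; rewrite eq_le z0.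
have [z2|z2] := ltP 0 (complex.Im z).
  exists (pi / 2); rewrite realM_ReIm /cis /= cos_pihalf sin_pihalf.
  by apply: eqc_ReIm; rewrite /= ?mulr0 ?mulr1// /cabs Re0 expr0n/= add0r sqrtr_sqr gtr0_norm.
exists (- (pi / 2)); rewrite realM_ReIm /cis /= cosN sinN cos_pihalf sin_pihalf.
apply: eqc_ReIm; rewrite /= ?mulr0 ?mulrN1// /cabs Re0 expr0n/= add0r sqrtr_sqr.
by rewrite ler0_norm ?opprK.
Qed.

End Cis.

(** * Winding numbers of the images of small circles *)

Section Winding.
Variable R : realType.

(** The factor [cis (2 * pi * t)] contributes one full turn. The perturbation 1 + e stays in the
    right half plane, so its argument is continuous and returns to its initial value. *)
Lemma winds_once_intro (f e : R -> R[i]) (w A : R[i]) : A != 0 ->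
  (forall t, (e : R -> R[i]^o) @ t --> (e t : R[i]^o)) -> e 1 = e 0 ->
  (forall t, cabs (e t) < 1) ->
  (forall t, f t = w + cis (2 * pi * t) * A * (1 + e t)) ->
  winds_once f w.
Proof.
move=> A0 ce e01 e1 fE; have [al AE] := polar_ex A.
have Re0 t : 0 < complex.Re (1 + e t).
  have := le_lt_trans (cabs_Re _) (e1 t); rewrite ltr_norml => /andP[h _].
  by rewrite cReD -(subrr 1) ltrD2l.
exists (fun t => 2 * pi * t + al + rarg (1 + e t)); split.
- move=> t.
  have c1 : (fun t => 1 + e t : R[i]^o) @ t --> (1 + e t : R[i]^o).
    by apply: cvgcD; [exact: cvg_cst|exact: ce].
  have cV : (fun t => (complex.Re (1 + e t))^-1) @ t --> (complex.Re (1 + e t))^-1.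
    by apply: cvgV; [rewrite gt_eqF|exact: cvgc_Re c1].
  have cq := cvgrM (FF := nbhs_filter t) (cvgc_Im (FF := nbhs_filter t) c1) cV.
  have ca : (fun t => rarg (1 + e t)) @ t --> rarg (1 + e t).
    by apply: (cvg_comp _ atan cq); exact: continuous_atan.
  have cpi : (fun=> 2 * pi : R) @ t --> (2 * pi : R) by exact: cvg_cst.
  have cal : (fun=> al : R) @ t --> (al : R) by exact: cvg_cst.
  have cid : (fun t : R => t) @ t --> t by exact: cvg_id.
  exact: (cvgrD (cvgrD (cvgrM cpi cid) cal) ca).
- by rewrite e01 mulr0 mulr1 add0r; ring.
- move=> t _; exists (cabs A * cabs (1 + e t)).
    rewrite mulr_gt0// cabs_gt0//; apply: contraTneq (Re0 t) => ->.
    by rewrite ltxx.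
  rewrite fE {1}AE {1}(polar_rarg (Re0 t)) !cisD rmorphM /=.
  by congr (_ + _); ring.
Qed.

End Winding.

Section Circle.
Variables (R : realType) (B : 'M[R]_3).
Hypothesis sB : so3 B.
Implicit Types (p x : S2 R).

Definition circle_row (r t : R) : 'rV[R]_3 :=
  \row_j [:: sin r * cos (2 * pi * t); sin r * sin (2 * pi * t); cos r]`_j.

Lemma circle_crd (F : 'M[R]_3) x r t k : set_val x = circle_row r t *m F ->
  crd B k x = sin r * cos (2 * pi * t) * (F *m B^T) 0 k +
    sin r * sin (2 * pi * t) * (F *m B^T) 1 k + cos r * (F *m B^T) 2 k.
Proof. by move=> gE; rewrite /crd gE -mulmxA mxE sum3 ![circle_row _ _ _ _]mxE. Qed.

Lemma center_crd (F : 'M[R]_3) p k : row ord_max F = set_val p ->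
  crd B k p = (F *m B^T) 2 k.
Proof.
move=> Fp; rewrite /crd -Fp -row_mul mxE; congr (fun_of_matrix _ _ k).
exact/val_inj.
Qed.

(** The numerator of the quotient rule for [numS / denS] at the third row of the frame [G], in the
    direction of its first row. *)
Definition tangent (G : 'M[R]_3) : R[i] :=
  (G 0 0 +i* G 0 1) * (1 + G 2 2)%:C - (G 2 0 +i* G 2 1) * (G 0 2)%:C.

Lemma crd_le1 x k : `|crd B k x| <= 1.
Proof.
have := crd_sqr x sB; have := sqr_ge0 (crd B 0 x); have := sqr_ge0 (crd B 1 x).
have := sqr_ge0 (crd B 2 x) => h2 h1 h0 H.
rewrite -(ler_pXn2r (n := 2))// ?nnegrE// real_normK ?num_real// expr1n.
by case: (ord3P k) => ->; lra.
Qed.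

Lemma denS_ge0 x : 0 <= denS B x.
Proof. by have := crd_le1 x 2; rewrite ler_norml /denS => /andP[? _]; lra. Qed.

Lemma denS_gt0 x : denS B x != 0 -> 0 < denS B x.
Proof. by move=> D0; rewrite lt0r D0 denS_ge0. Qed.

Lemma cabs_numS_le1 x : cabs (numS B x) <= 1.
Proof.
rewrite -(ler_pXn2r (n := 2))// ?nnegrE ?cabs_ge0// cabs_numS// expr1n /denS.
by have := sqr_ge0 (crd B 2 x); nra.
Qed.

(** Conformality: after division by the denominator (1 + G 2 2)^2 of the quotient rule, the
    stereographic projection scales tangent vectors by 1 / (1 + G 2 2). *)
Lemma cabs_tangent (G : 'M[R]_3) : so3 G -> cabs (tangent G) = `|1 + G 2 2|.
Proof.
move=> sG; have H := so3_rows sG; have := H 0 0; have := H 0 2; have := H 2 2.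
rewrite !eqxx /= => h22 h02 h00; rewrite -sqrtr_sqr /cabs; congr Num.sqrt.
have -> : complex.Re (tangent G) = G 0 0 * (1 + G 2 2) - G 2 0 * G 0 2.
  by rewrite /tangent /=; ring.
have -> : complex.Im (tangent G) = G 0 1 * (1 + G 2 2) - G 2 1 * G 0 2.
  by rewrite /tangent /=; ring.
transitivity ((1 + G 2 2) ^+ 2 * ((G 0 0 * G 0 0 + G 0 1 * G 0 1 + G 0 2 * G 0 2) - G 0 2 ^+ 2)
  - 2 * (1 + G 2 2) * G 0 2 * ((G 0 0 * G 2 0 + G 0 1 * G 2 1 + G 0 2 * G 2 2) - G 0 2 * G 2 2)
  + G 0 2 ^+ 2 * ((G 2 0 * G 2 0 + G 2 1 * G 2 1 + G 2 2 * G 2 2) - G 2 2 ^+ 2)); first by ring.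
by rewrite h00 h02 h22; ring.
Qed.

(* The differential of the stereographic projection is complex linear: it sends
   the second row of the frame to [i] times the image of the first one. *)
Lemma circle_exact (F : 'M[R]_3) p x r t : so3 F -> row ord_max F = set_val p ->
  set_val x = circle_row r t *m F ->
  numS B x * (denS B p)%:C - numS B p * (denS B x)%:C =
  (sin r)%:C * cis (2 * pi * t) * tangent (F *m B^T) + (cos r - 1)%:C * numS B p.
Proof.
move=> sF Fp gE; have sG := so3_relative sF sB.
have G0k k := circle_crd k gE; have G2k k := center_crd k Fp.
set G := F *m B^T in sG G0k G2k *.
have [c0 c1 c2] := so3_cross sG.
have H := so3_rows sG; have := H 0 2; have := H 2 2; rewrite !eqxx /= => h22 h02.
have vRe : G 1 0 * (1 + G 2 2) - G 2 0 * G 1 2 = - (G 0 1 * (1 + G 2 2) - G 2 1 * G 0 2).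
  transitivity (- (G 0 1 * (1 + G 2 2) - G 2 1 * G 0 2) +
    G 0 1 * (1 - (G 2 0 * G 2 0 + G 2 1 * G 2 1 + G 2 2 * G 2 2)) +
    G 2 1 * (G 0 0 * G 2 0 + G 0 1 * G 2 1 + G 0 2 * G 2 2)); last by rewrite h22 h02; ring.
  by rewrite c0 c2; ring.
have vIm : G 1 1 * (1 + G 2 2) - G 2 1 * G 1 2 = G 0 0 * (1 + G 2 2) - G 2 0 * G 0 2.
  transitivity (G 0 0 * (1 + G 2 2) - G 2 0 * G 0 2 -
    G 0 0 * (1 - (G 2 0 * G 2 0 + G 2 1 * G 2 1 + G 2 2 * G 2 2)) -
    G 2 0 * (G 0 0 * G 2 0 + G 0 1 * G 2 1 + G 0 2 * G 2 2)); last by rewrite h22 h02; ring.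
  by rewrite c1 c2; ring.
rewrite /numS /denS !G0k !G2k /tangent /cis.
set c := cos (2 * pi * t); set s := sin (2 * pi * t); set u := sin r; set k := cos r.
have cR (a b : R) : complex.Re (a +i* b) = a by [].
have cI (a b : R) : complex.Im (a +i* b) = b by [].
apply: eqc_ReIm; rewrite !(cReD, cImD, cReN, cImN, cReM, cImM) !cR !cI.
  transitivity (u * c * (G 0 0 * (1 + G 2 2) - G 2 0 * G 0 2) +
    u * s * (G 1 0 * (1 + G 2 2) - G 2 0 * G 1 2) + (k - 1) * G 2 0); first by ring.
  by rewrite vRe; ring.
transitivity (u * c * (G 0 1 * (1 + G 2 2) - G 2 1 * G 0 2) +
  u * s * (G 1 1 * (1 + G 2 2) - G 2 1 * G 1 2) + (k - 1) * G 2 1); first by ring.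
by rewrite vIm; ring.
Qed.

Lemma circle_cvg p r g (t : R) : positive_circle p r g -> g @ t --> g t.
Proof.
move=> [F [_ _ _ gE]]; apply: (cvg_S2_crd sB) => k.
rewrite (circle_crd k (gE t)) (_ : (fun s => _) = fun s =>
  cos (2 * pi * s) * (sin r * (F *m B^T) 0 k) +
  sin (2 * pi * s) * (sin r * (F *m B^T) 1 k) + 1 * (cos r * (F *m B^T) 2 k)); last first.
  by apply/funext => s; rewrite (circle_crd k (gE s)); ring.
rewrite (_ : _ + _ = cos (2 * pi * t) * (sin r * (F *m B^T) 0 k) +
  sin (2 * pi * t) * (sin r * (F *m B^T) 1 k) + 1 * (cos r * (F *m B^T) 2 k)); last by ring.
have cpi : (fun s : R => 2 * pi * s) @ t --> 2 * pi * t.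
  by apply: cvgM; [exact: cvg_cst|exact: cvg_id].
apply: lin3_cvg; last exact: cvg_cst.
  by apply: (cvg_comp _ cos cpi); exact: continuous_cos.
by apply: (cvg_comp _ sin cpi); exact: continuous_sin.
Qed.

Lemma denS_circle (F : 'M[R]_3) p x r t : so3 F -> row ord_max F = set_val p ->
  set_val x = circle_row r t *m F -> 0 <= sin r -> 0 <= cos r ->
  `|denS B x - denS B p| <= 3 * sin r.
Proof.
move=> sF Fp gE s0 c0; have sG := so3_relative sF sB.
rewrite /denS (circle_crd 2 gE) (center_crd 2 Fp); set G := F *m B^T in sG *.
have Gle i j : `|G i j| <= 1.
  have := so3_rows sG i i; rewrite eqxx /= => h.
  have := sqr_ge0 (G i 0); have := sqr_ge0 (G i 1); have := sqr_ge0 (G i 2).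
  rewrite !expr2 => h2 h1 h0.
  rewrite -(ler_pXn2r (n := 2))// ?nnegrE// real_normK ?num_real// expr1n expr2.
  by case: (ord3P j) => ->; lra.
have s1 : sin r <= 1 by exact: sin_le1.
have c1 : 1 - cos r <= sin r.
  have := cos2Dsin2 r; have := cos_le1 r; nra.
have -> : 1 + (sin r * cos (2 * pi * t) * G 0 2 + sin r * sin (2 * pi * t) * G 1 2 +
    cos r * G 2 2) - (1 + G 2 2) = sin r * (cos (2 * pi * t) * G 0 2) +
    sin r * (sin (2 * pi * t) * G 1 2) - (1 - cos r) * G 2 2 by ring.
have le1 (a b : R) : `|a| <= 1 -> `|b| <= 1 -> `|sin r * (a * b)| <= sin r.
  move=> a1 b1; rewrite !normrM (ger0_norm s0) ler_piMr// -[1]mulr1.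
  by apply: ler_pM.
have sn (u : R) : `|sin u| <= 1 by rewrite ler_norml sin_geN1 sin_le1.
have cn (u : R) : `|cos u| <= 1 by rewrite ler_norml cos_geN1 cos_le1.
apply: le_trans (ler_normB _ _) _.
have -> : 3 * sin r = sin r + sin r + sin r by ring.
apply: lerD; first by apply: le_trans (ler_normD _ _) _; apply: lerD; exact: le1.
rewrite normrM ger0_norm ?subr_ge0 ?cos_le1//; apply: le_trans c1.
by rewrite ler_piMr ?subr_ge0 ?cos_le1.
Qed.

Lemma stereo_sub p x : denS B p != 0 -> denS B x != 0 -> stereo B x - stereo B p =
  (numS B x * (denS B p)%:C - numS B p * (denS B x)%:C) / ((denS B x)%:C * (denS B p)%:C).
Proof. by move=> /real_neq0 Dp /real_neq0 Dx; rewrite /stereo; field; rewrite Dp Dx. Qed.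

(** In the stereographic coordinate a small circle is round with radius [cabs l], up to a relative
    error of 1/4. Two errors of order sin^2 r arise, one from the variation of the denominator and
    one from 1 - cos r. Bounding them takes 16 sin r <= [denS B (g t)]; the latter is at least half
    of [denS B p], whence the constant 32. *)
Lemma circle_estimate p r g : denS B p != 0 -> 0 < sin r -> 0 <= cos r ->
  32 * sin r <= denS B p -> positive_circle p r g ->
  exists l : R[i], cabs l = sin r / denS B p /\ forall t,
    denS B (g t) != 0 /\
    cabs (stereo B (g t) - stereo B p - cis (2 * pi * t) * l) <= cabs l / 4.
Proof.
move=> Dp0 s0 c0 sD [F [FF dF Fp gE]]; have sF : so3 F by [].
have sG := so3_relative sF sB; have Dp := denS_gt0 Dp0.
have Tl : cabs (tangent (F *m B^T)) = denS B p.
  by rewrite cabs_tangent// -(center_crd 2 Fp) ger0_norm// denS_ge0.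
set T := tangent _ in Tl.
have lE : cabs ((sin r)%:C * T / (denS B p)%:C ^+ 2) = sin r / denS B p.
  by rewrite !cabsM cabsV cabsX !cabs_real Tl !gtr0_norm//; field; rewrite gt_eqF.
exists ((sin r)%:C * T / (denS B p)%:C ^+ 2); split=> // t.
have Dt := denS_circle sF Fp (gE t) (ltW s0) c0.
have Dt2 : denS B p / 2 <= denS B (g t).
  by move: Dt; rewrite ler_norml => /andP[h1 h2]; lra.
have Dt0 : 0 < denS B (g t) by apply: lt_le_trans Dt2; rewrite divr_gt0.
split; first by rewrite gt_eqF.
rewrite stereo_sub ?gt_eqF// (circle_exact sF Fp (gE t)) -/T.
have cDp := real_neq0 Dp0; have cDt := real_neq0 (lt0r_neq0 Dt0).
have -> : ((sin r)%:C * cis (2 * pi * t) * T + (cos r - 1)%:C * numS B p) /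
   ((denS B (g t))%:C * (denS B p)%:C) -
   cis (2 * pi * t) * ((sin r)%:C * T / (denS B p)%:C ^+ 2) =
  ((sin r)%:C * cis (2 * pi * t) * T * ((denS B p)%:C - (denS B (g t))%:C) +
   (cos r - 1)%:C * numS B p * (denS B p)%:C) / ((denS B (g t))%:C * (denS B p)%:C ^+ 2).
  by field; rewrite cDp cDt.
rewrite lE cabsM cabsV ler_pdivrMr; last first.
  by rewrite cabs_gt0 mulf_neq0 ?expf_neq0.
apply: le_trans (cabsD _ _) _.
rewrite !cabsM cabs_cis !cabs_real -rmorphB cabs_real Tl mulr1 distrC.
have cn : cos r - 1 <= 0 by rewrite subr_le0 cos_le1.
rewrite (gtr0_norm s0) (gtr0_norm Dp) (gtr0_norm Dt0) (ler0_norm cn).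
have N1 := cabs_numS_le1 p; have N0 := cabs_ge0 (numS B p).
set N := cabs (numS B p) in N1 N0 *; set s := sin r in s0 sD Dt *; set D := denS B p in Dp sD Dt Dt2 *.
have c1 : 1 - cos r <= s ^+ 2.
  by have := cos2Dsin2 r; rewrite -/s; have := cos_le1 r; nra.
have c2 : 0 <= 1 - cos r by rewrite subr_ge0 cos_le1.
have h1 : s * D * `|denS B (g t) - D| <= s * D * (3 * s).
  by rewrite ler_wpM2l// mulr_ge0// ltW.
have h2 : - (cos r - 1) * N * D <= s ^+ 2 * D.
  rewrite opprB ler_wpM2r ?(ltW Dp)//; apply: le_trans c1.
  by rewrite ler_piMr.
apply: le_trans (lerD h1 h2) _.
have -> : s / D / 4 * (denS B (g t) * (D * D)) = s * D * denS B (g t) / 4.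
  by field; rewrite gt_eqF.
have -> : s * D * (3 * s) + s ^+ 2 * D = s * D * (4 * s) by ring.
rewrite -[leRHS]mulrA; apply: ler_wpM2l; last by lra.
by rewrite mulr_ge0// ltW.
Qed.

Lemma near_sin (d : R) : 0 < d -> \forall r \near 0^'+, [/\ 0 < sin r, 0 <= cos r & sin r < d].
Proof.
move=> d0; have sd : \forall r \near 0^'+, sin r < d.
  have : sin r @[r --> (0 : R)] --> sin (0 : R) by exact: continuous_sin.
  rewrite sin0 => /cvgrPdist_lt/(_ _ d0) H; rewrite near_withinE.
  apply: filterS H => r; rewrite sub0r normrN => h _.
  exact: le_lt_trans (ler_norm _) h.
have p2 : 0 < pi / 2 :> R by rewrite divr_gt0// pi_gt0.
near=> r; split.
- apply: sin_gt0_pihalf; apply/andP; split => //.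
- by apply/ltW/cos_gt0_pihalf; apply/andP; split => //; apply: (@lt_trans _ _ 0) => //; rewrite oppr_lt0.
- by near: r; exact: sd.
Unshelve. all: by end_near. Qed.

End Circle.

Section HolomorphicChart.
Variables (R : realType) (B : 'M[R]_3).
Hypothesis sB : so3 B.
Implicit Types (p x : S2 R).

Lemma denS_near p : denS B p != 0 -> \forall x \near p, denS B x != 0.
Proof.
move=> /(denS_gt0 sB) D0; have /cvgrPdist_lt/(_ _ D0) H := @denS_cvg R B p.
apply: filterS H => x; rewrite ltr_norml => /andP[_ h].
by apply: contraTneq h => ->; rewrite subr0 ltxx.
Qed.

Lemma stereo_inj x y : denS B x != 0 -> denS B y != 0 -> stereo B x = stereo B y -> x = y.
Proof. by move=> x0 y0 xy; rewrite -(stereoK sB x0) -(stereoK sB y0) xy. Qed.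

(** Relative to d l cis(2 pi t), the image curve has an error of at most 1/4 from the shape of the
    circle and 1/4 times 5/4 from strict differentiability, together 9/16 < 1. *)
Lemma sdiff_winds_once (F F' : R[i] -> R[i]) p : denS B p != 0 ->
  (\forall z \near (stereo B p : R[i]^o), sdiff F z (F' z)) -> F' (stereo B p) != 0 ->
  \forall r \near 0^'+, forall g, positive_circle p r g ->
    winds_once (fun t => F (stereo B (g t))) (F (stereo B p)).
Proof.
move=> Dp0 Fp d0; set z0 := stereo B p in Fp d0 *; set d := F' z0 in d0 *.
have Dp := denS_gt0 sB Dp0.
have dn0 : 0 < cabs d by rewrite cabs_gt0.
have e0 : 0 < cabs d / 4 by rewrite divr_gt0.
have /(_ _ e0)[q q0 Hq] : sdiff F z0 d by exact: nbhs_singleton Fp.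
have /nbhs_cabsP[q' q'0 Hq'] := Fp.
(* This bound on sin r keeps twice the image radius below [q] (the estimate for F at the centre) and
   [q'] (continuity of F along the circle); the entry 1/16 is the requirement 32 sin r <=
   [denS B p]. *)
pose u := Num.min (Num.min q q') (1 / 16) * denS B p / 2.
have m0 : 0 < Num.min (Num.min q q') (1 / 16) by rewrite !lt_min q0 q'0 divr_gt0.
have u0 : 0 < u by rewrite divr_gt0// mulr_gt0.
have := near_sin u0; apply: filterS => r [s0 c0 su] g gc.
have sD : 2 * sin r / denS B p < Num.min (Num.min q q') (1 / 16).
  by rewrite ltr_pdivrMr// -ltr_pdivlMl// mulrC.
have s32 : 32 * sin r <= denS B p.
  move: sD; rewrite lt_min => /andP[_]; rewrite ltr_pdivrMr// => h; lra.
have [l [lE H]] := circle_estimate sB Dp0 s0 c0 s32 gc.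
have l0 : 0 < cabs l by rewrite lE divr_gt0.
have lq : 2 * cabs l < Num.min (Num.min q q') (1 / 16) by rewrite lE mulrA.
have zt t : cabs (stereo B (g t) - z0) <= 5 / 4 * cabs l.
  have [_ h] := H t; rewrite -(subrK (cis (2 * pi * t) * l) (_ - _)).
  apply: le_trans (cabsD _ _) _; rewrite cabsM cabs_cis mul1r; lra.
have ztq t : cabs (stereo B (g t) - z0) < q.
  by apply: le_lt_trans (zt t) _; move: lq; rewrite !lt_min => /andP[/andP[h _] _]; lra.
have ztq' t : cabs (stereo B (g t) - z0) < q'.
  by apply: le_lt_trans (zt t) _; move: lq; rewrite !lt_min => /andP[/andP[_ h] _]; lra.
have A0 : d * l != 0 by rewrite mulf_neq0// -cabs_gt0.
pose e t := (F (stereo B (g t)) - F z0) / (cis (2 * pi * t) * (d * l)) - 1.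
have ct (t : R) : (fun s => cis (2 * pi * s) * (d * l) : R[i]^o) @ t -->
    (cis (2 * pi * t) * (d * l) : R[i]^o).
  have k : (fun=> d * l : R[i]^o) @ t --> (d * l : R[i]^o) by exact: cvg_cst.
  apply: (cvgcM _ k).
  by apply: cvg_cis; apply: cvgM; [exact: cvg_cst|exact: cvg_id].
have ce (t : R) : (e : R -> R[i]^o) @ t --> (e t : R[i]^o).
  have [Dt _] := H t.
  have gs : (fun s => stereo B (g s) : R[i]^o) @ t --> (stereo B (g t) : R[i]^o).
    exact: (cvg_comp g (stereo B : S2 R -> R[i]^o) (circle_cvg sB gc) (stereo_cvg Dt)).
  have Fgs := cvg_comp _ (F : R[i]^o -> R[i]^o) gs (sdiff_cvg (Hq' _ (ztq' t))).
  have cn : cis (2 * pi * t) * (d * l) != 0 by rewrite mulf_neq0// cis_neq0.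
  have k1 : (fun=> - F z0 : R[i]^o) @ t --> (- F z0 : R[i]^o) by exact: cvg_cst.
  have k2 : (fun=> -1 : R[i]^o) @ t --> (-1 : R[i]^o) by exact: cvg_cst.
  exact: (cvgcD (cvgcM (cvgcD Fgs k1) (cvgcV cn (ct t))) k2).
apply: (winds_once_intro A0 ce).
- have [F0 [_ _ _ gE]] := gc.
  have g01 : g 1 = g 0.
    apply: val_inj; rewrite [LHS](gE 1) [RHS](gE 0).
    by rewrite !mulr1 !(mulr0 (2 * pi)) mulr_natl cos2pi sin2pi cos0 sin0.
  by rewrite /e g01 mulr1 mulr0 cis2pi cis0.
- move=> t; have [_ h] := H t.
  have cl : cabs (cis (2 * pi * t) * (d * l)) = cabs d * cabs l.
    by rewrite !cabsM cabs_cis mul1r.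
  have cl0 : cis (2 * pi * t) * (d * l) != 0 by rewrite mulf_neq0// cis_neq0.
  have -> : e t = ((F (stereo B (g t)) - F z0 - d * (stereo B (g t) - z0)) +
      d * (stereo B (g t) - z0 - cis (2 * pi * t) * l)) / (cis (2 * pi * t) * (d * l)).
    have dd : d != 0 by []. have ll : l != 0 by rewrite -cabs_gt0.
    rewrite /e; field.
    by rewrite dd ll cis_neq0.
  rewrite cabsM cabsV cl ltr_pdivrMr ?mulr_gt0// mul1r.
  apply: le_lt_trans (cabsD _ _) _; rewrite cabsM.
  have h1 : cabs (F (stereo B (g t)) - F z0 - d * (stereo B (g t) - z0)) <=
      cabs d / 4 * (5 / 4 * cabs l).
    apply: le_trans (Hq _ _ (ztq t) _) _; first by rewrite subrr cabs0.
    by rewrite ler_pM2l// zt.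
  have h2 : cabs d * cabs (stereo B (g t) - z0 - cis (2 * pi * t) * l) <=
      cabs d * (cabs l / 4) by rewrite ler_pM2l.
  have h3 : 0 < cabs d * cabs l by rewrite mulr_gt0.
  by apply: le_lt_trans (lerD h1 h2) _; lra.
- move=> t; have -> : 1 + e t =
    (F (stereo B (g t)) - F z0) / (cis (2 * pi * t) * (d * l)) by rewrite /e; ring.
  have cl0 : cis (2 * pi * t) * (d * l) != 0 by rewrite mulf_neq0// cis_neq0.
  by rewrite [X in _ + X]mulrC (divfK cl0); ring.
Qed.

Lemma holo_is_chart (C U : set (S2 R)) (F F' : R[i] -> R[i]) :
  open U -> U `<=` ~` C ->
  (forall x, U x -> [/\ denS B x != 0,
    \forall z \near (stereo B x : R[i]^o), sdiff F z (F' z) & F' (stereo B x) != 0]) ->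
  is_chart C (Chart U (F \o stereo B)).
Proof.
move=> oU UC H; split=> // p Up; have [Dp Fp F0] := H p Up.
have Fpp := nbhs_singleton Fp; split.
- exact: (cvg_comp (stereo B : S2 R -> R[i]^o) (F : R[i]^o -> R[i]^o)
    (stereo_cvg Dp) (sdiff_cvg Fpp)).
- have [r r0 inj] := sdiff_inj F0 Fpp.
  exists [set x | denS B x != 0 /\ cabs (stereo B x - stereo B p) < r].
    apply: filterI; first exact: denS_near.
    by have /cvgc_nearP/(_ _ r0) := stereo_cvg Dp.
  move=> x y /set_mem[/= x0 xr] /set_mem[/= y0 yr] /= Fxy.
  by apply: stereo_inj => //; exact: inj.
- exact: (sdiff_winds_once Dp Fp F0).
Qed.

Lemma open_stereo_preimage (O : set R[i]) :
  (forall z, O z -> \forall w \near (z : R[i]^o), O w) ->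
  open [set x | denS B x != 0 /\ O (stereo B x)].
Proof.
move=> oO; rewrite openE => x [D0 Ox]; apply: filterI; first exact: denS_near.
exact: (stereo_cvg D0 (oO _ Ox)).
Qed.

End HolomorphicChart.

(** * Singular chains in the punctured sphere *)

Lemma subr_rot (V : zmodType) (u v w : V) : u - v - w = - (w - u + v).
Proof. by rewrite !opprD opprK addrAC [- w + u]addrC. Qed.

Section Simplices.
Variables (R : realType) (X : topologicalType).

Definition co n (x : stdsimplex R n) (i : 'I_n.+1) : R := set_val x 0 i.

Lemma co_ge0 n (x : stdsimplex R n) i : 0 <= co x i.
Proof. by have [x0 _] := set_valP x; exact: x0. Qed.

Lemma co_sum n (x : stdsimplex R n) : \sum_i co x i = 1.
Proof. by have [_ x1] := set_valP x; exact: x1. Qed.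

Lemma co1_sum (x : stdsimplex R 1) : co x 0 + co x 1 = 1.
Proof.
by rewrite -(co_sum x) big_ord_recl big_ord1; congr (_ + co x _); exact/val_inj.
Qed.

Lemma co2_sum (x : stdsimplex R 2) : co x 0 + co x 1 + co x 2 = 1.
Proof. by rewrite -(co_sum x) sum3. Qed.

Lemma co_cvg n (x : stdsimplex R n) i : (fun y => co y i) @ x --> co x i.
Proof.
apply: (@continuous_comp _ _ _ set_val (fun u : 'rV[R]_n.+1 => u 0 i)).
  exact: initial_continuous.
exact: coord_continuous.
Qed.

Lemma co_face_lift n (x : stdsimplex R n) i k : co (face R n i x) (fintype.lift i k) = co x k.
Proof. by rewrite /co /face /= mxE liftK. Qed.

Lemma co_face_same n (x : stdsimplex R n) i : co (face R n i x) i = 0.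
Proof. by rewrite /co /face /= mxE unlift_none. Qed.

Lemma co_face2 (x : stdsimplex R 1) : [/\
  [/\ co (face R 1 0 x) 0 = 0, co (face R 1 0 x) 1 = co x 0 & co (face R 1 0 x) 2 = co x 1],
  [/\ co (face R 1 1 x) 0 = co x 0, co (face R 1 1 x) 1 = 0 & co (face R 1 1 x) 2 = co x 1] &
  [/\ co (face R 1 2 x) 0 = co x 0, co (face R 1 2 x) 1 = co x 1 & co (face R 1 2 x) 2 = 0]].
Proof.
have E (i j : 'I_3) (k : 'I_2) : fintype.lift i k = j -> co (face R 1 i x) j = co x k.
  by move=> <-; exact: co_face_lift.
by split; split; rewrite ?co_face_same//; apply: E; exact/val_inj.
Qed.

Lemma co_face1 (x : stdsimplex R 0) :
  [/\ co (face R 0 0 x) 0 = 0, co (face R 0 0 x) 1 = 1,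
      co (face R 0 1 x) 0 = 1 & co (face R 0 1 x) 1 = 0].
Proof.
have x1 : co x 0 = 1 by rewrite -(co_sum x) big_ord1.
have E (i j : 'I_2) (k : 'I_1) : fintype.lift i k = j -> co (face R 0 i x) j = co x k.
  by move=> <-; exact: co_face_lift.
by split; rewrite ?co_face_same// -x1; apply: E; exact/val_inj.
Qed.

Lemma boundary1E (s : simplex R X 1) : boundary << s >> =
  << (s \o face R 0 0 : simplex R X 0) >> - << (s \o face R 0 1 : simplex R X 0) >>.
Proof.
rewrite /boundary liftU scale1r big_ord_recl big_ord1 expr0 expr1 scale1r scaleN1r.
congr (_ - << _ >>); apply/continuousEP => x /=; congr (s (face R 0 _ x)).
exact/val_inj.
Qed.

Lemma boundary2E (s : simplex R X 2) : boundary << s >> =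
  << (s \o face R 1 0 : simplex R X 1) >> - << (s \o face R 1 1 : simplex R X 1) >> +
  << (s \o face R 1 2 : simplex R X 1) >>.
Proof.
rewrite /boundary liftU scale1r sum3 expr0 expr1 scale1r scaleN1r.
by rewrite expr2 mulN1r opprK scale1r.
Qed.

(** Stated for chains instead of cycles, so that the pieces of a loop can be handled before they
    close up. *)
Definition bdry (z : chain R X 1) := exists d : chain R X 2, z = boundary d.

Lemma bdry0 : bdry 0.
Proof. by exists 0; rewrite raddf0. Qed.

Lemma bdryD z w : bdry z -> bdry w -> bdry (z + w).
Proof. by move=> [d ->] [e ->]; exists (d + e); rewrite raddfD. Qed.

Lemma bdryN z : bdry z -> bdry (- z).
Proof. by move=> [d ->]; exists (- d); rewrite raddfN. Qed.

Lemma bdryB z w : bdry z -> bdry w -> bdry (z - w).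
Proof. by move=> bz bw; apply: bdryD => //; exact: bdryN. Qed.

Lemma bdry_sum (I : Type) (r : seq I) (F : I -> chain R X 1) :
  (forall i, bdry (F i)) -> bdry (\sum_(i <- r) F i).
Proof. by move=> FB; elim/big_ind: _ => //; [exact: bdry0|exact: bdryD]. Qed.

Lemma triangle_bdry (s : simplex R X 2) (s0 s1 s2 : simplex R X 1) :
  (forall x, s (face R 1 0 x) = s0 x) -> (forall x, s (face R 1 1 x) = s1 x) ->
  (forall x, s (face R 1 2 x) = s2 x) -> bdry (<< s0 >> - << s1 >> + << s2 >>).
Proof.
move=> e0 e1 e2; exists << s >>; rewrite boundary2E.
congr (<< _ >> - << _ >> + << _ >>); apply/continuousEP => x.
- by rewrite -e0.
- by rewrite -e1.
- by rewrite -e2.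
Qed.

Lemma seg_continuous (g : continuousType R X) (a b : R) :
  continuous (fun x : stdsimplex R 1 => g (co x 0 * a + co x 1 * b)).
Proof.
move=> x; apply: (cvg_comp (fun y => co y 0 * a + co y 1 * b) g); last exact: cts_fun.
apply: (@cvgrD R _ (nbhs x)); apply: (@cvgrM R _ (nbhs x));
  by [exact: co_cvg|exact: cvg_cst].
Qed.

Definition seg (g : continuousType R X) (a b : R) : simplex R X 1 :=
  mkcts (@seg_continuous g a b).

Lemma tri_continuous (g : continuousType R X) (a b c : R) :
  continuous (fun x : stdsimplex R 2 => g (co x 0 * a + co x 1 * b + co x 2 * c)).
Proof.
move=> x; apply: (cvg_comp (fun y => co y 0 * a + co y 1 * b + co y 2 * c) g);
  last exact: cts_fun.
exact: (@lin3_cvg R _ (nbhs x) _ _ _ _ a b c _ _ _ (@co_cvg _ x 0) (@co_cvg _ x 1) (@co_cvg _ x 2)).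
Qed.

(** The triangle is mapped affinely to the real line with vertices a, b, c and then along the path,
    so it is degenerate but has the three segments as faces. *)
Lemma seg_split (g : continuousType R X) (a b c : R) :
  bdry (<< seg g a c >> - << seg g a b >> - << seg g b c >>).
Proof.
have := @triangle_bdry (mkcts (@tri_continuous g a b c)) (seg g b c) (seg g a c) (seg g a b).
move=> H; have -> : << seg g a c >> - << seg g a b >> - << seg g b c >> =
    - (<< seg g b c >> - << seg g a c >> + << seg g a b >>) :> chain R X 1.
  exact: subr_rot.
have E (i : 'I_3) (x : stdsimplex R 1) : mkcts (@tri_continuous g a b c) (face R 1 i x) =
  g (co (face R 1 i x) 0 * a + co (face R 1 i x) 1 * b + co (face R 1 i x) 2 * c) by [].
apply/bdryN/H => x; have [[e00 e01 e02] [e10 e11 e12] [e20 e21 e22]] := co_face2 x.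
- by apply: etrans (E 0 x) _; rewrite e00 e01 e02 mul0r add0r.
- by apply: etrans (E 1 x) _; rewrite e10 e11 e12 mul0r addr0.
- by apply: etrans (E 2 x) _; rewrite e20 e21 e22 mul0r addr0.
Qed.

(** For a = b = c the three segments of [seg_split] combine to minus a single one. *)
Lemma seg_refl (g : continuousType R X) a : bdry << seg g a a >>.
Proof.
have /bdryN := seg_split g a a a.
by rewrite addrAC subrr sub0r opprK.
Qed.

End Simplices.

(** * Coning paths off from the centre of a chart *)

Section Cone.
Variables (R : realType) (n : nat) (c : 'I_n -> S2 R).
Variables (B : 'M[R]_3) (hB : so3 B) (a : 'I_n -> R[i]).
Implicit Types (z : R[i]) (q : punctured c).

Definition chart_set : set (S2 R) := [set x | denS B x != 0 /\ Omega a (stereo B x)].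

Hypothesis chart_setNc : forall i, ~ chart_set (c i).

Lemma Omega0 : Omega a 0.
Proof. by move=> i; rewrite mulr0 subr0 /slit /= ltr01 orbT. Qed.

Lemma chart_set_unstereo z : Omega a z -> chart_set (unstereo hB z).
Proof. by move=> Oz; split; [exact: denS_unstereo_neq0|rewrite unstereoK]. Qed.

Lemma chart_setN (x : S2 R) : chart_set x -> x \in ~` range c.
Proof. by move=> Ux; apply/mem_set => -[i _ cx]; apply: (@chart_setNc i); rewrite cx. Qed.

Definition apex : punctured c :=
  exist _ (unstereo hB 0) (chart_setN (chart_set_unstereo Omega0)).

(** Totalized by the value [apex], so that simplices can be written as compositions with
    complex-valued functions. *)
Definition cone_pt z : punctured c := insubd apex (unstereo hB z).

Lemma val_cone_pt z : Omega a z -> set_val (cone_pt z) = unstereo hB z.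
Proof. by move=> Oz; apply: insubdK; exact/chart_setN/chart_set_unstereo. Qed.

Lemma cone_pt_continuous (T : topologicalType) (f : T -> R[i]) :
  (forall t, Omega a (f t)) ->
  (forall t, (f : T -> R[i]^o) @ t --> (f t : R[i]^o)) -> continuous (cone_pt \o f).
Proof.
move=> Of cf; apply: continuous_comp_initial => t.
have -> : set_val \o (cone_pt \o f) = fun s => unstereo hB (f s).
  by apply/funext => s /=; rewrite val_cone_pt.
exact: unstereo_cvg (cf t).
Qed.

(** The default 0 lies in [Omega a], so that [ray q] makes sense for every [q] without a proof of
    membership. *)
Definition chart_coord (q : punctured c) : R[i] :=
  if `[< chart_set (set_val q) >] then stereo B (set_val q) else 0.

Lemma chart_coordE (q : punctured c) :
  chart_set (set_val q) -> chart_coord q = stereo B (set_val q).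
Proof. by move=> Uq; rewrite /chart_coord asboolT. Qed.

Lemma Omega_coord q : Omega a (chart_coord q).
Proof. by rewrite /chart_coord; case: asboolP => [[]//|_]; exact: Omega0. Qed.

Lemma cone_pt_coord (q : punctured c) : chart_set (set_val q) -> cone_pt (chart_coord q) = q.
Proof.
move=> Uq; apply: val_inj; apply: etrans (val_cone_pt (Omega_coord q)) _.
by rewrite chart_coordE// stereoK//; case: Uq.
Qed.

Lemma open_chart_set : open chart_set.
Proof. exact: (open_stereo_preimage hB (@Omega_near _ _ a)). Qed.

Lemma chart_coord_cvg (q : punctured c) : chart_set (set_val q) ->
  (chart_coord : punctured c -> R[i]^o) @ q --> (chart_coord q : R[i]^o).
Proof.
move=> Uq; have vq : set_val @ q --> set_val q by exact: initial_continuous.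
have nU : \forall s \near q, chart_set (set_val s).
  by apply: vq; rewrite nbhsE; exists chart_set; [split => //; exact: open_chart_set|].
have sq : (fun s => stereo B (set_val s) : R[i]^o) @ q --> (chart_coord q : R[i]^o).
  rewrite chart_coordE//; apply: (cvg_comp set_val (stereo B : S2 R -> R[i]^o) vq).
  by apply: stereo_cvg; case: Uq.
apply/cvgc_nearP => e e0; have /cvgc_nearP/(_ _ e0) H := sq.
by apply: filterS2 nU H => s Us; rewrite (chart_coordE Us).
Qed.

Lemma ray_continuous (q : punctured c) :
  continuous (cone_pt \o (fun x : stdsimplex R 1 => (co x 0)%:C * chart_coord q)).
Proof.
apply: cone_pt_continuous => x.
  apply: Omega_star; last exact: Omega_coord.
  by rewrite co_ge0 -(co1_sum x) lerDl co_ge0.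
have k : (fun=> chart_coord q : R[i]^o) @ x --> (chart_coord q : R[i]^o).
  exact: cst_continuous.
exact: (cvgcM (cvgc_real (@co_cvg _ _ x 0)) k).
Qed.

(** For [q] in the chart domain, vertex 0 is [q] and vertex 1 is the centre: the ray runs
    inwards. *)
Definition ray (q : punctured c) : simplex R (punctured c) 1 := mkcts (@ray_continuous q).

Definition pt (q : punctured c) : simplex R (punctured c) 0 := mkcts (@cst_continuous _ _ q).

Lemma boundary_ray (q : punctured c) : chart_set (set_val q) ->
  boundary << ray q >> = << pt (cone_pt 0) >> - << pt q >>.
Proof.
move=> Uq; rewrite boundary1E; congr (<< _ >> - << _ >>);
  apply/continuousEP => x; have [e00 e01 e10 e11] := co_face1 x.
- have E : ray q (face R 0 0 x) = cone_pt ((co (face R 0 0 x) 0)%:C * chart_coord q) by [].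
  by apply: etrans E _; rewrite e00 mul0r.
- have E : ray q (face R 0 1 x) = cone_pt ((co (face R 0 1 x) 0)%:C * chart_coord q) by [].
  by apply: etrans E _; rewrite e10 mul1r cone_pt_coord.
Qed.

Section ConeOverPath.
Variables (g : continuousType R (punctured c)) (s0 s1 : R).
Hypothesis s01 : s0 <= s1.
Hypothesis gU : forall t, s0 <= t <= s1 -> chart_set (set_val (g t)).

(** Vertex 2 is the apex of the cone: [height] is 0 there and 1 on the opposite edge, and [base] is
    the path parameter reached by projecting from the apex. *)
Let height (x : stdsimplex R 2) : R := co x 0 + co x 1.
Let base (x : stdsimplex R 2) : R := (co x 0 * s0 + co x 1 * s1) / height x.

Let height_ge0 x : 0 <= height x.
Proof. by rewrite addr_ge0 ?co_ge0. Qed.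

Let height_le1 x : height x <= 1.
Proof. by rewrite -(co2_sum x) lerDl co_ge0. Qed.

Let base_itv x : height x != 0 -> s0 <= base x <= s1.
Proof.
move=> h0; have hp : 0 < height x by rewrite lt0r h0 height_ge0.
rewrite /base ler_pdivlMr// ler_pdivrMr//.
have := co_ge0 x 0; have := co_ge0 x 1; rewrite /height.
by have := s01; nra.
Qed.

Let gcoord_cvg t : s0 <= t <= s1 ->
  (fun s => chart_coord (g s) : R[i]^o) @ t --> (chart_coord (g t) : R[i]^o).
Proof.
move=> /gU Ut.
exact: (cvg_comp g (chart_coord : punctured c -> R[i]^o) (@cts_fun _ _ g t) (chart_coord_cvg Ut)).
Qed.

Let gcoord_bounded : exists2 M : R, 0 < M &
  forall t, s0 <= t <= s1 -> cabs (chart_coord (g t)) <= M.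
Proof.
have cont : {within `[s0, s1], continuous (fun t => cabs (chart_coord (g t)))}.
  apply: within_segment_cont => t /gcoord_cvg H; apply/cvgrPdist_lt => e e0.
  have /cvgc_nearP/(_ _ e0) := H; apply: filterS => s; apply: le_lt_trans.
  rewrite ler_norml; apply/andP; split; last by rewrite cabsC cabs_sub.
  by rewrite lerNl opprB cabs_sub.
have [m _ Hm] := EVT_max s01 cont.
exists (cabs (chart_coord (g m)) + 1); first by rewrite ltr_wpDl ?cabs_ge0.
move=> t ts; apply: le_trans (_ : cabs (chart_coord (g m)) <= _); last by rewrite lerDl.
by apply: Hm; rewrite in_itv.
Qed.

Let cone_coord (x : stdsimplex R 2) : R[i] := (height x)%:C * chart_coord (g (base x)).

Let height_cvg x : height @ x --> height x.
Proof. exact: (@cvgrD R _ (nbhs x) _ _ _ _ _ (@co_cvg _ _ x 0) (@co_cvg _ _ x 1)). Qed.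

(** At the apex [base] has no limit, but the coordinate along the compact path is bounded while
    [height] tends to 0. *)
Let cone_coord_cvg x : (cone_coord : _ -> R[i]^o) @ x --> (cone_coord x : R[i]^o).
Proof.
have [h0|h0] := eqVneq (height x) 0; last first.
  have k0 : (fun=> s0) @ x --> s0 by exact: cst_continuous.
  have k1 : (fun=> s1) @ x --> s1 by exact: cst_continuous.
  have hV : (fun y => (height y)^-1) @ x --> (height x)^-1.
    by apply: (@cvgV _ _ (nbhs x)) => //; exact: height_cvg.
  have bc : base @ x --> base x.
    exact: (cvgrM (cvgrD (cvgrM (@co_cvg _ _ x 0) k0) (cvgrM (@co_cvg _ _ x 1) k1)) hV).
  have gb := cvg_comp base (fun s => chart_coord (g s) : R[i]^o) bc (gcoord_cvg (base_itv h0)).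
  exact: (cvgcM (cvgc_real (@height_cvg x)) gb).
have [M M0 HM] := gcoord_bounded.
apply/cvgc_nearP => e e0; rewrite /cone_coord h0 mul0r.
have := @height_cvg x; rewrite h0 => /cvgrPdist_lt/(_ (e / M)).
rewrite divr_gt0// => /(_ isT); apply: filterS => y.
rewrite sub0r normrN subr0 cabsM cabs_real => hy.
have [hy0|hy0] := eqVneq (height y) 0; first by rewrite hy0 normr0 mul0r.
apply: le_lt_trans (_ : `|height y| * M < e); last by rewrite -ltr_pdivlMr.
by rewrite ler_wpM2l// HM// base_itv.
Qed.

Let cone_continuous : continuous (cone_pt \o cone_coord).
Proof.
apply: cone_pt_continuous => x; last exact: cone_coord_cvg.
by apply: Omega_star; [rewrite height_ge0 height_le1|exact: Omega_coord].
Qed.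

(** The faces of the cone are the two inward rays and the path. A path inside one chart domain may
    thus be replaced by the ray at its start minus the ray at its end. *)
Lemma cone_bdry : bdry (<< ray (g s1) >> - << ray (g s0) >> + << seg g s0 s1 >>).
Proof.
apply: (triangle_bdry (s := mkcts cone_continuous)) => x;
  have [[e00 e01 e02] [e10 e11 e12] [e20 e21 e22]] := co_face2 x.
- have E : mkcts cone_continuous (face R 1 0 x) = cone_pt (cone_coord (face R 1 0 x)) by [].
  apply: etrans E _; rewrite /cone_coord /base /height e00 e01 !mul0r !add0r.
  have F : ray (g s1) x = cone_pt ((co x 0)%:C * chart_coord (g s1)) by [].
  apply: etrans (esym F); have [->|x0] := eqVneq (co x 0) 0; first by rewrite !mul0r.
  by rewrite mulrAC mulfV// mul1r.
- have E : mkcts cone_continuous (face R 1 1 x) = cone_pt (cone_coord (face R 1 1 x)) by [].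
  apply: etrans E _; rewrite /cone_coord /base /height e10 e11 !mul0r !addr0.
  have F : ray (g s0) x = cone_pt ((co x 0)%:C * chart_coord (g s0)) by [].
  apply: etrans (esym F); have [->|x0] := eqVneq (co x 0) 0; first by rewrite !mul0r.
  by rewrite mulrAC mulfV// mul1r.
- have E : mkcts cone_continuous (face R 1 2 x) = cone_pt (cone_coord (face R 1 2 x)) by [].
  apply: etrans E _; rewrite /cone_coord /base /height e20 e21 co1_sum divr1 mul1r.
  apply: cone_pt_coord; apply: gU.
  have := co1_sum x; have := co_ge0 x 0; have := co_ge0 x 1; have := s01 => h h1 h0 e.
  have -> : co x 1 = 1 - co x 0 by lra.
  by apply/andP; split; nra.
Qed.

End ConeOverPath.
End Cone.

(** * The two charts *)

Section TwoCharts.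
Variables (R : realType) (n : nat) (c : 'I_n -> S2 R) (m : 'I_n -> int).
Variable B : 'M[R]_3.
Implicit Types (x : S2 R) (z y w : R[i]).

Definition Bop : 'M[R]_3 := flip_mx R *m B.
Definition cpos (i : 'I_n) : R[i] := stereo B (c i).
Definition cinv (i : 'I_n) : R[i] := (cpos i)^-1.

(* The axis of the frame avoids the punctures, and no two punctures lie on a
   common meridian. *)
Definition generic_frame : Prop := [/\ so3 B,
  forall i, denS B (c i) != 0 /\ denS Bop (c i) != 0 &
  forall i j, i != j -> slit (- (cinv j * cpos i))].

Hypothesis gB : generic_frame.

Lemma sB : so3 B. Proof. by case: gB. Qed.
Lemma sBop : so3 Bop. Proof. exact: so3_flip sB. Qed.

Definition regS := chart_set B cinv.
Definition regN := chart_set Bop cpos.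

Lemma stereo_op x : denS B x != 0 -> denS Bop x != 0 ->
  stereo B x != 0 /\ stereo Bop x = (stereo B x)^-1.
Proof.
move=> D0 D1; have E := stereo_flip sB D0 D1.
have z0 : stereo B x != 0.
  by apply/eqP => z0; move/eqP: E; rewrite z0 mul0r eq_sym oner_eq0.
by split=> //; apply: (mulfI z0); rewrite E mulfV.
Qed.

Lemma cpos_neq0 i : cpos i != 0.
Proof. by case: gB => _ /(_ i)[D0 D1] _; have [] := stereo_op D0 D1. Qed.

Lemma cinv_neq0 i : cinv i != 0.
Proof. by rewrite invr_eq0 cpos_neq0. Qed.

Lemma not_slit0 : slit (0 : R[i]) = false.
Proof. by rewrite /slit /= eqxx ltxx. Qed.

Lemma regSNc i : ~ regS (c i).
Proof. by case=> _ /(_ i); rewrite /cinv mulVf ?cpos_neq0// subrr not_slit0. Qed.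

Lemma regNNc i : ~ regN (c i).
Proof.
case: gB => _ /(_ i)[D0 D1] _ [_ /(_ i)]; have [z0 ->] := stereo_op D0 D1.
by rewrite mulfV// subrr not_slit0.
Qed.

(** The positive real axis is the union of (0, 1] and [1, oo): leaving out the whole ray means
    leaving out the cuts of both charts. *)
Lemma slit_split y : y != 0 ->
  slit (- y) = slit (1 - y) && slit (1 - y^-1).
Proof.
move=> y0; rewrite /slit !(cReD, cImD, cReN, cImN).
have -> : complex.Im (1 : R[i]) = 0 by [].
have -> : complex.Re (1 : R[i]) = 1 by [].
rewrite !add0r !oppr_eq0.
case: y y0 => u v /= y0; rewrite oppr_eq0 mulf_eq0 invr_eq0.
have [v0|v0] := eqVneq v 0; last first.
  by rewrite /= paddr_eq0 ?sqr_ge0// !expf_eq0 /= (negbTE v0) andbF.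
have u0 : u != 0 by apply: contraNneq y0 => u0; rewrite u0 v0 eq_complex /= eqxx.
rewrite v0 expr0n/= addr0; have -> : u / u ^+ 2 = u^-1 by field.
rewrite oppr_gt0; apply/idP/andP => [h|[h1 h2]].
  by split; rewrite subr_gt0; [lra|apply: lt_trans ltr01; rewrite invr_lt0].
rewrite lt_neqAle u0 leNgt; apply/negP => up.
move: h2; rewrite subr_gt0 invf_lt1// => h2; move: h1; rewrite subr_gt0; lra.
Qed.

Lemma regSN x : regS x -> regN x ->
  [/\ denS B x != 0, denS Bop x != 0, stereo B x != 0 &
   forall i, slit (- (cinv i * stereo B x))].
Proof.
move=> [D0 O0] [D1 O1]; have [z0 wE] := stereo_op D0 D1; split=> // i.
have y0 : cinv i * stereo B x != 0 by rewrite mulf_neq0// cinv_neq0.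
rewrite (slit_split y0); apply/andP; split.
  exact: O0.
rewrite invfM /cinv invrK -wE; exact: O1.
Qed.

Lemma regSN_intro x : denS B x != 0 -> denS Bop x != 0 ->
  (forall i, slit (- (cinv i * stereo B x))) -> regS x /\ regN x.
Proof.
move=> D0 D1 H; have [z0 wE] := stereo_op D0 D1.
have K i : slit (1 - cinv i * stereo B x) /\ slit (1 - cpos i * (stereo B x)^-1).
  have y0 : cinv i * stereo B x != 0 by rewrite mulf_neq0// cinv_neq0.
  have := H i; rewrite (slit_split y0).
  by rewrite invfM /cinv invrK => /andP[].
by split; split=> // i; [have [] := K i|rewrite wE; have [] := K i].
Qed.

Lemma slitNreal y : ~~ slit y -> complex.Im y = 0 /\ complex.Re y <= 0.
Proof. by rewrite negb_or negbK -leNgt => /andP[/eqP ? ?]. Qed.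

(** At each pole one of the coordinates is 0. Elsewhere, a point z missed by both charts is u z_i
    with u >= 1, while z_j = v z with v >= 1. If i = j this forces z = z_i; otherwise two punctures
    share a meridian, which the frame excludes. *)
Lemma regSN_cover x : ~ range c x -> regS x \/ regN x.
Proof.
move=> xc; have [D0|D0] := eqVneq (denS B x) 0.
  right; have [_ _ E2] := crd_flip B x.
  have c2 : crd B 2 x = -1 by move: D0; rewrite /denS; lra.
  split; first by rewrite /denS E2 c2 opprK gt_eqF// addr_gt0.
  have h := crd_sqr x sB; rewrite c2 sqrrN expr1n in h.
  have : crd B 0 x ^+ 2 = 0 /\ crd B 1 x ^+ 2 = 0.
    by have := sqr_ge0 (crd B 0 x); have := sqr_ge0 (crd B 1 x); split; lra.
  move=> [/eqP + /eqP]; rewrite !sqrf_eq0 => /eqP h0 /eqP h1.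
  have [E0 E1 _] := crd_flip B x.
  have -> : stereo Bop x = 0 by rewrite /stereo /numS E0 E1 h0 h1 oppr0 mul0r.
  exact: Omega0.
have [D1|D1] := eqVneq (denS Bop x) 0.
  left; have [_ _ E2] := crd_flip B x.
  have c2 : crd B 2 x = 1 by move: D1; rewrite /denS E2; lra.
  split; first by [].
  have h := crd_sqr x sB; rewrite c2 expr1n in h.
  have : crd B 0 x ^+ 2 = 0 /\ crd B 1 x ^+ 2 = 0.
    by have := sqr_ge0 (crd B 0 x); have := sqr_ge0 (crd B 1 x); split; lra.
  move=> [/eqP + /eqP]; rewrite !sqrf_eq0 => /eqP h0 /eqP h1.
  have -> : stereo B x = 0 by rewrite /stereo /numS h0 h1 mul0r.
  exact: Omega0.
have [z0 wE] := stereo_op D0 D1.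
have [H|/existsNP[i /negP Hi]] := pselect (forall i, slit (1 - cinv i * stereo B x)).
  by left; split.
right; split=> // j; rewrite wE; apply: contrapT => /negP Hj.
have [i0 i1] := slitNreal Hi; have [j0 j1] := slitNreal Hj.
set z := stereo B x in z0 wE Hi Hj i0 i1 j0 j1 *.
have Im1 : complex.Im (1 : R[i]) = 0 by [].
have Re1 : complex.Re (1 : R[i]) = 1 by [].
rewrite cImD cImN Im1 add0r in i0; rewrite cReD cReN Re1 in i1.
rewrite cImD cImN Im1 add0r in j0; rewrite cReD cReN Re1 in j1.
have realE w : - complex.Im w = 0 -> w = (complex.Re w)%:C.
  by move=> /eqP; rewrite oppr_eq0 => /eqP w0; apply: eqc_ReIm.
have {i0}iE := realE _ i0; have {j0}jE := realE _ j0.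
set u := complex.Re (cinv i * z) in iE i1; set v := complex.Re (cpos j * z^-1) in jE j1.
have uv : cinv i * cpos j = (u * v)%:C.
  by rewrite rmorphM /= -iE -jE mulrACA mulfV// mulr1.
have [ij|ij] := eqVneq j i.
  have {}uv : u * v = 1.
    by apply: complexI; rewrite -uv ij /cinv mulVf// cpos_neq0.
  have u1 : u = 1 by nra.
  apply: xc; exists i => //; apply: (stereo_inj sB) => //; first by case: gB => _ /(_ i)[].
  by rewrite -/z -/(cpos i) -[z]mul1r -(mulfV (cpos_neq0 i)) -mulrA -/(cinv i) iE u1 mulr1.
case: gB => _ _ /(_ _ _ ij); rewrite uv /slit -rmorphN /= eqxx /=.
by rewrite oppr_gt0; nra.
Qed.

Lemma open_regS : open regS.
Proof. exact: (@open_chart_set R n B sB). Qed.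

Lemma open_regN : open regN.
Proof. exact: (@open_chart_set R n Bop sBop). Qed.

(* rescales the second chart so that the transitions are isometric *)
Definition scale4 : R[i] := sqrtc (sqrtc (\prod_i (- cinv i) ^ m i)).

Lemma scale4E : scale4 ^+ 4 = \prod_i (- cinv i) ^ m i.
Proof. by rewrite (exprM _ 2 2) !sqr_sqrtc. Qed.

Lemma scale4_neq0 : scale4 != 0.
Proof.
suff : scale4 ^+ 4 != 0 by rewrite expf_eq0.
rewrite scale4E; apply/prodf_neq0 => i _.
by rewrite expfz_neq0// oppr_eq0 cinv_neq0.
Qed.

Definition primS : R[i] -> R[i] := Fprim cinv m.
Definition primN z := scale4 * Fprim cpos m z.

Definition chartS : chart R := Chart regS (primS \o stereo B).
Definition chartN : chart R := Chart regN (primN \o stereo Bop).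

Lemma primN_sdiff z : Omega cpos z -> sdiff primN z (scale4 * hfun cpos m z).
Proof. by move=> Oz; exact: sdiffZ (Fprim_sdiff _ Oz). Qed.

Lemma primN_near z : Omega cpos z ->
  \forall x \near (z : R[i]^o), sdiff primN x (scale4 * hfun cpos m x).
Proof. by move=> /Omega_near; apply: filterS => x; exact: primN_sdiff. Qed.

Lemma chartS_is_chart : is_chart (range c) chartS.
Proof.
apply: (holo_is_chart sB (F' := hfun cinv m) open_regS).
  by move=> x Ux [i _ ix]; apply: (@regSNc i); rewrite ix.
by move=> x [D0 O0]; split=> //; [exact: Fprim_near|exact: hfun_neq0].
Qed.

Lemma chartN_is_chart : is_chart (range c) chartN.
Proof.
apply: (holo_is_chart sBop (F' := fun z => scale4 * hfun cpos m z) open_regN).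
  by move=> x Ux [i _ ix]; apply: (@regNNc i); rewrite ix.
move=> x [D0 O0]; split=> //; first exact: primN_near.
by rewrite mulf_neq0 ?scale4_neq0// hfun_neq0.
Qed.

(* derivative of the second chart in the coordinate of the first one *)
Definition dprimN z := scale4 * hfun cpos m z^-1 * - z ^- 2.

Lemma primN_inv_sdiff z : z != 0 -> Omega cpos z^-1 ->
  sdiff (fun w => primN w^-1) z (dprimN z).
Proof.
by move=> z0 Oz; exact: sdiff_comp (sdiffV z0) (primN_sdiff Oz).
Qed.

Lemma dprimN_neq0 z : z != 0 -> Omega cpos z^-1 -> dprimN z != 0.
Proof.
move=> z0 Oz; rewrite /dprimN !mulf_neq0 ?scale4_neq0 ?hfun_neq0//.
by rewrite oppr_eq0 invr_eq0 expf_neq0.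
Qed.

Hypothesis m_sum : \sum_i m i = -8.

Lemma prod_exprz (z : R[i]) : z != 0 -> \prod_i z ^ m i = z ^- 8.
Proof.
move=> z0; have -> : z ^- 8 = z ^ (\sum_i m i) by rewrite m_sum.
by elim/big_rec2: _ => [|i u v _ ->]; rewrite ?expr0z// expfzDr.
Qed.

(** Factor by factor, 1 - z/z_i = (-1/z_i) z (1 - z_i/z). The first factors make up [scale4 ^+ 4],
    and the powers of z multiply to z^-8 = (-z^-2)^4. *)
Lemma dprimN4 z : z != 0 -> Omega cinv z -> Omega cpos z^-1 ->
  hfun cinv m z ^+ 4 = dprimN z ^+ 4.
Proof.
move=> z0 O0 O1; rewrite hfun4// /dprimN !exprMn scale4E hfun4//.
have -> : (- z ^- 2) ^+ 4 = \prod_i z ^ m i.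
  by rewrite prod_exprz// exprNn -signr_odd mul1r exprVn -exprM.
rewrite -!big_split /=; apply: eq_bigr => i _.
rewrite -!expfzMl; congr (_ ^ _); rewrite /cinv; field.
by rewrite z0 cpos_neq0.
Qed.

Definition turn x : 'Z_4 :=
  xget 0 [set k : 'Z_4 | hfun cinv m (stereo B x) = 'i ^+ k * dprimN (stereo B x)].

Lemma regSN_Omega x : regS x -> regN x -> [/\ stereo B x != 0,
  Omega cinv (stereo B x) & Omega cpos (stereo B x)^-1].
Proof.
move=> US UN; have [D0 D1 z0 _] := regSN US UN; split=> //; first by case: US.
by have [_ <-] := stereo_op D0 D1; case: UN.
Qed.

Lemma turnP x : regS x -> regN x ->
  hfun cinv m (stereo B x) = 'i ^+ turn x * dprimN (stereo B x).
Proof.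
move=> US UN; have [z0 O0 O1] := regSN_Omega US UN.
have [k kE] := expr4_eq (dprimN4 z0 O0 O1).
exact: (@xgetPex _ 0 [set k : 'Z_4 | hfun cinv m (stereo B x) =
  'i ^+ k * dprimN (stereo B x)] (ex_intro _ k kE)).
Qed.

Lemma near_Omega_inv z : z != 0 -> Omega cpos z^-1 ->
  \forall w \near (z : R[i]^o), w != 0 /\ Omega cpos w^-1.
Proof.
move=> z0 Oz; apply: filterI.
  apply/nbhs_cabsP; exists (cabs z); first by rewrite cabs_gt0.
  by move=> x; apply: contraTneq => ->; rewrite sub0r cabsN ltxx.
exact: (sdiff_cvg (sdiffV z0) (Omega_near Oz)).
Qed.

Lemma transitionSN x : regS x -> regN x -> transition chartS chartN x (turn x).
Proof.
move=> US UN; have [D0 D1 z0 _] := regSN US UN; have [_ O0 O1] := regSN_Omega US UN.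
have N1 := near_Omega_inv z0 O1; have N0 := Omega_near O0.
have [|||| k [kE [t tE]]] := @primitive_uniq R primS (hfun cinv m)
    (fun w => primN w^-1) dprimN (stereo B x).
- exact: Fprim_near.
- by apply: filterS N1 => w [w0 Ow]; exact: primN_inv_sdiff.
- by apply: filterS2 N0 N1 => w Ow [w0 Ow1]; exact: dprimN4.
- exact: dprimN_neq0.
(* The exponent delivered by [primitive_uniq] satisfies the same equation between derivatives as
   [turn x], and this equation determines it. *)
have kt : k = turn x.
  apply: (@exprZ4_inj R); rewrite (_ : _ - _ = 0) ?cabs0 ?ler01//.
  apply/eqP; rewrite subr_eq0; apply/eqP.
  by apply: (mulIf (dprimN_neq0 z0 O1)); rewrite -kE turnP.
split=> //; exists t; rewrite -kt.
have tx := stereo_cvg D0 tE; have nD0 := denS_near sB D0; have nD1 := denS_near sBop D1.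
near=> y; rewrite /=.
have -> : stereo Bop y = (stereo B y)^-1.
  have y0 : denS B y != 0 by near: y; exact: nD0.
  have y1 : denS Bop y != 0 by near: y; exact: nD1.
  by have [] := stereo_op y0 y1.
by near: y; exact: tx.
Unshelve. all: by end_near. Qed.

Lemma transition_refl (f : chart R) x : chart_dom f x -> transition f f x 0.
Proof. by move=> fx; split=> //; exists 0; apply: (@nearW _ (nbhs x)) => y; rewrite expr0 mul1r addr0. Qed.

Lemma transition_sym (f g : chart R) x k : transition f g x k -> transition g f x (- k).
Proof.
move=> [fx gx [t H]]; split=> //; exists (- 'i ^+ (- k)%R * t).
apply: filterS H => y ->; have E : ('i : R[i]) ^+ (- k)%R * 'i ^+ k = 1.
  by rewrite -exprZ4D addNr.
by rewrite mulrDr mulrA E mul1r mulNr addrK.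
Qed.

Lemma transitionNS x : regS x -> regN x -> transition chartN chartS x (- turn x).
Proof. by move=> US UN; exact/transition_sym/transitionSN. Qed.

(** The quotient of the two derivatives, after [root4_split] has cancelled the roots of 1 - z_i/z.
    It is continuous on the sectors, and only the i-th factor jumps on the ray of z_i. *)
Definition turn_fun z := - scale4^-1 * z ^+ 2 * \prod_i root4 (- (cinv i * z)) ^ m i.

Lemma turnE x : regS x -> regN x -> 'i ^+ turn x = turn_fun (stereo B x).
Proof.
move=> US UN; have [D0 D1 z0 Hs] := regSN US UN; have [_ O0 O1] := regSN_Omega US UN.
set z := stereo B x in z0 Hs O0 O1.
apply: (mulIf (dprimN_neq0 z0 O1)); rewrite -turnP// -/z /dprimN /turn_fun.
have hE : hfun cinv m z = (\prod_i root4 (- (cinv i * z)) ^ m i) * hfun cpos m z^-1.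
  rewrite -big_split /=; apply: eq_bigr => i _; rewrite -expfzMl.
  congr (_ ^ _); have H1 := O1 i; have iE : cpos i * z^-1 = (cinv i * z)^-1.
    by rewrite [RHS]invfM /cinv invrK.
  by rewrite iE in H1 *; exact: root4_split (Hs i) (O0 i) H1.
rewrite hE; have l0 := scale4_neq0.
transitivity ((\prod_i root4 (- (cinv i * z)) ^ m i) * hfun cpos m z^-1 *
  (scale4^-1 * scale4) * (z ^+ 2 * z ^- 2)); last by ring.
by rewrite mulVf// mulfV ?expf_neq0// !mulr1.
Qed.

End TwoCharts.

(** * Homology and rotational holonomy *)

Lemma subr_subK (V : zmodType) (u v w : V) : u - w - (v - w) = u - v.
Proof. by rewrite opprB addrA subrK. Qed.

Lemma subr_lens (V : zmodType) (s0 s1 n0 n1 g : V) :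
  s1 - s0 + g - (n1 - n0 + g) = n0 - s0 - (n1 - s1).
Proof.
rewrite [n1 - n0 + g]addrC opprD addrA addrK !opprB addrC.
rewrite -[LHS]addrA addrCA [RHS]addrC -!addrA [RHS]addrCA; congr (_ + _).
by rewrite addrCA addrC -addrA; congr (_ + _); rewrite addrC.
Qed.

Lemma subr_tele (V : zmodType) (a b d u v : V) :
  a - b + u + (b - v) = a - d + (u + (d - v)).
Proof. by rewrite addrAC subrKA [RHS]addrCA subrKA addrC. Qed.

Lemma subr_seg_sum (V : zmodType) (u v w t : V) :
  u - t + (v - u - w) = v - (t + w).
Proof. by rewrite addrC addrAC subrKA opprD addrA. Qed.

Section HomologyHolonomy.
Variables (R : realType) (n : nat) (c : 'I_n -> S2 R).
Variable B : 'M[R]_3.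
Hypothesis gB : generic_frame c B.
Variable rho : {additive H1 R (punctured c) -> 'Z_4}.
Let X := punctured c.
Implicit Types (q : X) (z w : chain R X 1).

(** Extends [rho] from cycles to all chains, with value 0 on non-cycles, so that identities can be
    checked in the chain group. Additivity is available on cycles only. *)
Definition rho_chain z : 'Z_4 :=
  rho (\pi_(H1 R X)%qT (insubd (0 : cycle1 R X) z)).

Let insub_val z : is_cycle z -> cycle_chain (insubd (0 : cycle1 R X) z) = z.
Proof. exact: (@insubdK _ (@is_cycle R X) (cycle1 R X) 0 z). Qed.

Lemma is_cycleD z w : is_cycle z -> is_cycle w -> is_cycle (z + w).
Proof. by rewrite /is_cycle raddfD /= => /eqP -> /eqP ->; rewrite addr0. Qed.

Lemma is_cycleN z : is_cycle z -> is_cycle (- z).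
Proof. by rewrite /is_cycle raddfN /= => /eqP ->; rewrite oppr0. Qed.

Lemma rho_chainD z w : is_cycle z -> is_cycle w ->
  rho_chain (z + w) = rho_chain z + rho_chain w.
Proof.
move=> cz cw; rewrite /rho_chain -!raddfD /=; congr (rho (\pi_(_)%qT _)).
by apply: val_inj; rewrite /= !insub_val// is_cycleD.
Qed.

Lemma rho_chainN z : is_cycle z -> rho_chain (- z) = - rho_chain z.
Proof.
move=> cz; rewrite /rho_chain -!raddfN /=; congr (rho (\pi_(_)%qT _)).
by apply: val_inj; rewrite /= !insub_val// is_cycleN.
Qed.

Lemma rho_chain_bdry z : is_cycle z -> bdry z -> rho_chain z = 0.
Proof.
move=> cz bz; rewrite /rho_chain -[RHS](raddf0 rho); congr (rho _).
rewrite -(raddf0 (\pi_(H1 R X)%qT)); apply/eqP; rewrite -Quotient.idealrBE subr0.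
by apply/asboolP; rewrite insub_val.
Qed.

Lemma rho_chain_loop (g : loop R X) :
  rho_chain << seg (loop_fun g) 0 1 >> = rho (loop_class g).
Proof.
rewrite /rho_chain /loop_class; congr (rho (\pi_(_)%qT _)); apply: val_inj.
have E : seg (loop_fun g) 0 1 = loop_simplex g.
  apply/continuousEP => x.
  have -> : seg (loop_fun g) 0 1 x = g (co x 0 * 0 + co x 1 * 1) by [].
  have -> : loop_simplex g x = g (co x ord_max) by [].
  by rewrite mulr0 mulr1 add0r; congr (g (co x _)); exact/val_inj.
rewrite /= insub_val E//; exact: loop_simplex_is_cycle.
Qed.

Definition rayS q := ray (sB gB) (regSNc gB) q.
Definition rayN q := ray (sBop gB) (regNNc gB) q.
Definition ray_side (e : bool) q := if e then rayN q else rayS q.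
Definition reg_side (e : bool) : set (S2 R) := if e then regN c B else regS c B.
Definition both q := regS c B (set_val q) /\ regN c B (set_val q).

(** Since both rays run from [q] inwards, this is the meridian from the centre of the first chart
    through [q] to the centre of the second. *)
Definition lens q : chain R X 1 := << rayN q >> - << rayS q >>.

Lemma boundary_lens q : both q -> boundary (lens q) =
  << pt (cone_pt (sBop gB) (regNNc gB) 0) >> - << pt (cone_pt (sB gB) (regSNc gB) 0) >>.
Proof.
by move=> [qS qN]; rewrite raddfB /= !boundary_ray// opprB addrA subrK.
Qed.

Lemma lens_sub_cycle q q' : both q -> both q' -> is_cycle (lens q - lens q').
Proof.
by move=> bq bq'; rewrite /is_cycle raddfB /= !boundary_lens// subrr.
Qed.

(** A reference point in the overlap: all lenses have the same boundary, so only their differences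
    are cycles. *)
Definition lens0 : X := xget (cone_pt (sB gB) (regSNc gB) 0) both.

Lemma both_lens0 q : both q -> both lens0.
Proof. by move=> bq; apply: (@xgetPex _ _ both); exists q. Qed.

Definition lens_rho q : 'Z_4 := rho_chain (lens q - lens lens0).

Lemma lens_rho_sub q q' : both q -> both q' ->
  lens_rho q - lens_rho q' = rho_chain (lens q - lens q').
Proof.
move=> bq bq'; have b0 := both_lens0 bq.
have cq := lens_sub_cycle bq b0; have cq' := lens_sub_cycle bq' b0.
rewrite /lens_rho -(rho_chainN cq') -(rho_chainD cq (is_cycleN cq')).
by congr rho_chain; exact: subr_subK.
Qed.

(** Coning the path off from each of the two centres gives two boundaries that both contain the
    path. It cancels in their difference, and the difference of the two lenses remains. *)
Lemma lens_rho_path (g : continuousType R X) (s0 s1 : R) : s0 <= s1 ->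
  (forall t, s0 <= t <= s1 -> both (g t)) -> lens_rho (g s0) = lens_rho (g s1).
Proof.
move=> s01 gb; apply/eqP; rewrite -subr_eq0; apply/eqP.
have b0 : both (g s0) by apply: gb; rewrite lexx s01.
have b1 : both (g s1) by apply: gb; rewrite lexx s01.
rewrite lens_rho_sub//; apply: rho_chain_bdry; first exact: lens_sub_cycle.
have HN := cone_bdry (sBop gB) (regNNc gB) s01 (fun t ts => (gb t ts).2).
have HS := cone_bdry (sB gB) (regSNc gB) s01 (fun t ts => (gb t ts).1).
by have := bdryB HS HN; congr bdry; exact: subr_lens.
Qed.

(** The value [true] stands for the second chart. The jump is an integer, so that it telescopes
    along a loop and can serve as a multiplicity of chains. *)
Definition side_jump (e e' : bool) : int := (e' : nat)%:Z - (e : nat)%:Z.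

Lemma side_jumpSN : side_jump false true = 1. Proof. by []. Qed.
Lemma side_jumpNS : side_jump true false = -1. Proof. by []. Qed.
Lemma side_jump_same e : side_jump e e = 0. Proof. exact: subrr. Qed.

Lemma ray_side_jump e e' q : << ray_side e' q >> - << ray_side e q >> =
  lens q *~ side_jump e e' :> chain R X 1.
Proof.
case: e; case: e'; rewrite ?side_jumpSN ?side_jumpNS ?side_jump_same /lens /=.
- by rewrite mulr0z subrr.
- by rewrite mulrN1z opprB.
- by rewrite mulr1z.
- by rewrite mulr0z subrr.
Qed.

Lemma sum_side_jump (N : nat) (e : nat -> bool) :
  \sum_(l < N) side_jump (e l) (e l.+1) = side_jump (e 0%N) (e N).
Proof.
elim: N => [|N IH]; first by rewrite big_ord0 /side_jump subrr.
by rewrite big_ord_recr /= IH /side_jump addrC addrA subrK.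
Qed.

Section LoopPartition.
Variables (g : loop R X) (N : nat) (s : nat -> R) (e : nat -> bool).
Hypotheses (s0 : s 0%N = 0) (sN : s N = 1) (eN : e N = e 0%N).
Hypothesis smono : forall l, (l < N)%N -> s l <= s l.+1.
Hypothesis se : forall l, (l < N)%N -> forall t, s l <= t <= s l.+1 ->
  reg_side (e l) (set_val (g t)).

Let G : continuousType R X := loop_fun g.

Let seg_sum k : (k <= N)%N ->
  bdry (<< seg G (s 0%N) (s k) >> - \sum_(l < k) << seg G (s l) (s l.+1) >>).
Proof.
elim: k => [|k IH] kN; first by rewrite big_ord0 subr0; exact: seg_refl.
have := bdryD (IH (ltnW kN)) (seg_split G (s 0%N) (s k) (s k.+1)); congr bdry.
by rewrite big_ord_recr /=; exact: subr_seg_sum.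
Qed.

Let seg_cone l : (l < N)%N -> bdry (<< seg G (s l) (s l.+1) >> -
  (<< ray_side (e l) (G (s l)) >> - << ray_side (e l) (G (s l.+1)) >>)).
Proof.
move=> lN; have := se lN; rewrite /ray_side /reg_side; case: (e l) => H.
  by have := cone_bdry (sBop gB) (regNNc gB) (smono lN) H; congr bdry;
    rewrite [LHS]addrC opprB.
by have := cone_bdry (sB gB) (regSNc gB) (smono lN) H; congr bdry;
  rewrite [LHS]addrC opprB.
Qed.

Lemma both_jump l : (l < N)%N -> e l != e l.+1 -> both (g (s l.+1)).
Proof.
move=> lN el; have H1 : reg_side (e l) (set_val (g (s l.+1))).
  by apply: (se lN); rewrite lexx (smono lN).
have H2 : reg_side (e l.+1) (set_val (g (s l.+1))).
  have [lN1|] := ltnP l.+1 N; first by apply: (se lN1); rewrite lexx (smono lN1).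
  (* After the last piece the loop closes up: the next side is [e N = e 0], whose domain contains g
     0 = g 1 by the first piece. *)
  rewrite leq_eqVlt ltnNge lN orbF => /eqP NE; rewrite -NE eN sN -(loop_closed g) -s0.
  have N0 : (0 < N)%N by exact: leq_ltn_trans lN.
  by apply: (se N0); rewrite lexx (smono N0).
by move: el H1 H2; rewrite /both; case: (e l); case: (e l.+1).
Qed.

(** Each piece is homologous to the difference of the rays at its ends. Collected by partition
    points, these rays cancel except where the side changes, and there they form a lens. *)
Lemma loop_rho : rho (loop_class g) =
  \sum_(l < N) lens_rho (g (s l.+1)) *~ side_jump (e l) (e l.+1).
Proof.
pose rd k : chain R X 1 := << ray_side (e k) (G (s k)) >>.
have tele k : \sum_(l < k) (<< ray_side (e l) (G (s l)) >> -
    << ray_side (e l) (G (s l.+1)) >>) = rd 0%N - rd k +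
    \sum_(l < k) lens (G (s l.+1)) *~ side_jump (e l) (e l.+1).
  elim: k => [|k IH]; first by rewrite !big_ord0 subrr addr0.
  by rewrite !big_ord_recr /= IH -ray_side_jump; exact: subr_tele.
(* Subtracting the reference lens turns each summand into a cycle. The sum is unchanged because the
   jumps of a closed loop add up to 0. *)
pose L : chain R X 1 :=
  \sum_(l < N) (lens (G (s l.+1)) - lens lens0) *~ side_jump (e l) (e l.+1).
have LE : L = \sum_(l < N) lens (G (s l.+1)) *~ side_jump (e l) (e l.+1).
  rewrite /L (eq_bigr (fun l : 'I_N => lens (G (s l.+1)) *~ side_jump (e l) (e l.+1)
    - lens lens0 *~ side_jump (e l) (e l.+1))); last by move=> l _; rewrite mulrzBl.
  rewrite sumrB -[X in _ - X]mulrz_sumr sum_side_jump eN /side_jump subrr mulr0z.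
  by rewrite subr0.
have cterm (l : 'I_N) :
    is_cycle ((lens (G (s l.+1)) - lens lens0) *~ side_jump (e l) (e l.+1)) /\
    rho_chain ((lens (G (s l.+1)) - lens lens0) *~ side_jump (e l) (e l.+1)) =
    lens_rho (g (s l.+1)) *~ side_jump (e l) (e l.+1).
  have [el|el] := eqVneq (e l) (e l.+1).
    rewrite el /side_jump subrr !mulr0z; split; first by rewrite /is_cycle raddf0.
    by apply: rho_chain_bdry; [rewrite /is_cycle raddf0|exact: bdry0].
  have bq := both_jump (ltn_ord l) el; have cq := lens_sub_cycle bq (both_lens0 bq).
  have : side_jump (e l) (e l.+1) = 1 \/ side_jump (e l) (e l.+1) = -1.
    by move: el; case: (e l); case: (e l.+1) => //= _; [right|left].
  case=> ->; first by rewrite !mulr1z.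
  by rewrite !mulrN1z; split; [exact: is_cycleN|rewrite rho_chainN].
have [cL rL] : is_cycle L /\ rho_chain L =
    \sum_(l < N) lens_rho (g (s l.+1)) *~ side_jump (e l) (e l.+1).
  rewrite /L; elim/big_ind2: _ => [|z u w v [cz <-] [cw <-]|l _]; last exact: cterm.
    split; first by rewrite /is_cycle raddf0.
    by apply: rho_chain_bdry; [rewrite /is_cycle raddf0|exact: bdry0].
  by split; [exact: is_cycleD|exact: rho_chainD].
rewrite -rL -rho_chain_loop; set z := << _ >>.
have cz : is_cycle z.
  have := loop_simplex_is_cycle g; congr is_true; congr (is_cycle << _ >>).
  apply/continuousEP => x.
  have -> : seg (loop_fun g) 0 1 x = g (co x 0 * 0 + co x 1 * 1) by [].
  have -> : loop_simplex g x = g (co x ord_max) by [].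
  by rewrite mulr0 mulr1 add0r; congr (g (co x _)); exact/val_inj.
apply/eqP; rewrite -subr_eq0 -rho_chainN// -rho_chainD ?is_cycleN//.
apply/eqP; apply: rho_chain_bdry; first by rewrite is_cycleD ?is_cycleN.
have b1 := seg_sum (leqnn N).
have b2 : bdry (\sum_(l < N) (<< seg G (s l) (s l.+1) >> -
  (<< ray_side (e l) (G (s l)) >> - << ray_side (e l) (G (s l.+1)) >>))).
  by apply: bdry_sum => l; exact: (seg_cone (ltn_ord l)).
have := bdryD b1 b2; rewrite s0 sN; congr bdry.
rewrite sumrB tele -LE subrKA /rd eN s0 sN -/G.
have -> : G 0 = G 1 by exact: loop_closed.
by rewrite subrr add0r.
Qed.

End LoopPartition.
End HomologyHolonomy.

Section SectorRoots.
Variable R : realType.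
Implicit Types (y : R[i]).

(** This is e^(-i pi/4). Above the real axis arg (-y) = arg y - pi, so the root of -y is [nu8] times
    that of y; below the axis the factor is e^(i pi/4) = i nu8. Crossing the axis thus multiplies
    the principal root of -y by i relative to the root of y. *)
Definition nu8 : R[i] := (Num.sqrt 2)^-1 -i* (Num.sqrt 2)^-1.

Lemma root4N_upper y : 0 < complex.Im y -> root4 (- y) = nu8 * root4 y.
Proof.
move=> y0; have sy : slit y by rewrite /slit gt_eqF.
have [/sectorP[u0 uv] r4] := root4P sy.
have s2 : (Num.sqrt 2 : R) ^+ 2 = 2 by rewrite sqr_sqrtr.
have s0 : 0 < (Num.sqrt 2 : R) by rewrite sqrtr_gt0.
have n2 : nu8 ^+ 2 = - 'i.
  rewrite expr2; apply: eqc_ReIm; rewrite !(cReM, cImM) /nu8; set s := (Num.sqrt 2)^-1.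
    by rewrite /=; ring.
  have -> : complex.Im (- 'i : R[i]) = - (2 / Num.sqrt 2 ^+ 2) by rewrite s2 divff.
  by rewrite /s /=; field; rewrite gt_eqF.
have n4 : nu8 ^+ 4 = -1 by rewrite (exprM _ 2 2) n2 sqrrN sqr_i.
have -> : - y = (nu8 * root4 y) ^+ 4 by rewrite exprMn n4 r4 mulN1r.
apply: root4_eq; apply/sectorP; move: r4 u0 uv.
case: (root4 y) => u v r4 u0 uv; move: y0; rewrite -r4 Im_exp4 /=.
have P0 : 0 < 4 * u * (u ^+ 2 - v ^+ 2) by rewrite !mulr_gt0 ?subr_gt0.
move=> h; have v0 : 0 < v by rewrite -(pmulr_rgt0 _ P0).
set s := (Num.sqrt 2)^-1; have sp : 0 < s by rewrite invr_gt0.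
have -> : s * u - - s * v = s * (u + v) by ring.
have -> : s * v + - s * u = s * (v - u) by ring.
split; first by rewrite mulr_gt0// addr_gt0.
rewrite !exprMn ltr_pM2l ?exprn_gt0// -subr_gt0.
have -> : (u + v) ^+ 2 - (v - u) ^+ 2 = 4 * u * v by ring.
by rewrite !mulr_gt0.
Qed.

Lemma root4N_lower y : complex.Im y < 0 -> root4 (- y) = 'i * nu8 * root4 y.
Proof.
move=> y0; have yN : 0 < complex.Im (- y) by rewrite cImN oppr_gt0.
have := root4N_upper yN; rewrite opprK => ->; rewrite mulrA.
have i1 : 'i * nu8 * nu8 = 1.
  have s2 : (Num.sqrt 2 : R) ^+ 2 = 2 by rewrite sqr_sqrtr.
  have s0 : 0 < (Num.sqrt 2 : R) by rewrite sqrtr_gt0.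
  apply: eqc_ReIm; rewrite !(cReM, cImM) /nu8.
    have -> : complex.Re (1 : R[i]) = 2 / Num.sqrt 2 ^+ 2 by rewrite s2 divff.
    by rewrite /=; field; rewrite gt_eqF.
  by rewrite /=; ring.
by rewrite i1 mul1r.
Qed.

End SectorRoots.

Section LocallyConstant.
Variable R : realType.

(** The real-valued indicator of [u = u a] has derivative 0, so the mean value theorem applies. *)
Lemma locally_constant_segment (T : eqType) (u : R -> T) (a b : R) : a <= b ->
  (forall t, a <= t <= b -> \forall s \near t, u s = u t) -> u a = u b.
Proof.
move=> ab H; pose v s : R := (u s == u a)%:R.
have [t tab||d _] := @MVT_segment R v (fun=> 0) a b ab.
- apply: is_derive_estimate => e e0; move: tab; rewrite in_itv /= => /andP[ta tb].
  have := H t; rewrite (ltW ta) (ltW tb) => /(_ isT) /nbhs_ballP[r /= r0 Hr].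
  apply/nbhs_ballP; exists r => //= h; rewrite /ball /= sub0r normrN => hr.
  have th : ball t r (t + h) by rewrite /ball /= opprD addrA subrr sub0r normrN.
  by rewrite /v (Hr _ th) subrr mul0r subr0 normr0 mulr_ge0// ltW.
- apply: within_segment_cont => t /H; move=> Ht; apply/cvgrPdist_lt => e e0.
  by apply: filterS Ht => s su; rewrite /v su subrr normr0.
- rewrite mul0r => /eqP; rewrite subr_eq0 /v eqxx.
  case: (eqVneq (u b) (u a)) => [->//|_] /eqP h.
  by have := oner_neq0 R; rewrite -[1]h eqxx.
Qed.

End LocallyConstant.

(** * The overlap of the charts, and the defect between prescribed and realized rotation *)

Section Wedges.
Variables (R : realType) (n : nat) (c : 'I_n -> S2 R) (m : 'I_n -> int).
Variable B : 'M[R]_3.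
Hypothesis gB : generic_frame c B.
Hypothesis m_sum : \sum_i m i = -8.
Variable rho : {additive H1 R (punctured c) -> 'Z_4}.
Let X := punctured c.
Implicit Types (q : X) (z w : R[i]).

Local Notation ainv := (cinv c B).
Local Notation apos := (cpos c B).

(** The overlap of the charts in the first coordinate: the union of the open sectors between the
    rays through the punctures. *)
Definition wedge z := z != 0 /\ forall i, slit (- (ainv i * z)).

Lemma wedge_Omega z : wedge z -> Omega ainv z.
Proof.
move=> [z0 H] i; have y0 : ainv i * z != 0 by rewrite mulf_neq0// (cinv_neq0 gB).
by have := H i; rewrite (slit_split y0) => /andP[].
Qed.

Lemma hol_linear_form (k : R[i]) z : hol (fun x => - (k * x)) z.
Proof.
exists (- k * 1); apply: sdiff_eq (sdiffZ (- k) (sdiff_id z)) => x.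
by rewrite mulNr.
Qed.

Lemma wedge_near z : wedge z -> \forall w \near (z : R[i]^o), wedge w.
Proof.
move=> [z0 H]; apply: filterI.
  apply/nbhs_cabsP; exists (cabs z); first by rewrite cabs_gt0.
  by move=> x; apply: contraTneq => ->; rewrite sub0r cabsN ltxx.
apply: (@filter_forall _ _ (fun i x => slit (- (ainv i * x))) (nbhs (z : R[i]^o)) _) => i.
exact: (hol_cvg (hol_linear_form (ainv i) z) (slit_open (H i))).
Qed.

Definition spt z : X := cone_pt (sB gB) (regSNc gB) z.

Lemma val_spt z : wedge z -> set_val (spt z) = unstereo (sB gB) z.
Proof. by move=> /wedge_Omega; exact: val_cone_pt. Qed.

Lemma stereo_spt z : wedge z -> stereo B (set_val (spt z)) = z.
Proof. by move=> /val_spt ->; rewrite unstereoK. Qed.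

Lemma both_spt z : wedge z -> both B (spt z).
Proof.
move=> wz; have [z0 H] := wz; rewrite /both (val_spt wz).
apply: (regSN_intro gB); last by rewrite unstereoK.
  exact: denS_unstereo_neq0.
have [_ _ E2] := crd_flip B (unstereo (sB gB) z).
rewrite /denS E2; have [_ _ ->] := crd_unstereo (sB gB) z.
have d0 := onecabs_gt0 z; have -> : 1 - (1 - cabs z ^+ 2) / (1 + cabs z ^+ 2) =
  2 * cabs z ^+ 2 / (1 + cabs z ^+ 2) by field; rewrite gt_eqF.
by rewrite mulf_neq0 ?invr_eq0 ?gt_eqF// mulr_gt0// exprn_gt0// cabs_gt0.
Qed.

Lemma spt_both q : both B q ->
  wedge (stereo B (set_val q)) /\ spt (stereo B (set_val q)) = q.
Proof.
move=> [qS qN]; have [_ _ z0 H] := regSN gB qS qN; split=> //.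
rewrite -(chart_coordE (a := ainv) (B := B) (q := q)) //.
exact: cone_pt_coord.
Qed.

(** The rotation demanded by [rho] for a change of charts at [q], minus the rotation that the
    primitives realize. *)
Definition defect q : 'Z_4 := lens_rho gB rho q - turn c m B (set_val q).

Lemma hol_turn_fun z : wedge z -> hol (turn_fun c m B) z.
Proof.
move=> [z0 H]; apply: holM.
  by apply: holM; [exact: hol_cst|exact/holX/hol_id].
apply: hol_prod => i _.
apply: (hol_exprz (f := root4 \o (fun x => - (ainv i * x)))).
  exact: root4_neq0.
exact: hol_root4 (hol_linear_form _ _).
Qed.

Lemma turn_spt z : wedge z -> 'i ^+ turn c m B (set_val (spt z)) = turn_fun c m B z.
Proof.
by move=> wz; have [qS qN] := both_spt wz; rewrite (turnE gB m_sum qS qN) stereo_spt.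
Qed.

Lemma turn_near z : wedge z -> \forall w \near (z : R[i]^o),
  turn c m B (set_val (spt w)) = turn c m B (set_val (spt z)).
Proof.
move=> wz; have /cvgc_nearP/(_ _ ltr01) := hol_cvg (hol_turn_fun wz).
apply: filterS2 (wedge_near wz) => w ww.
by rewrite -(turn_spt ww) -(turn_spt wz) => h; apply: exprZ4_inj (ltW h).
Qed.

(** Paths have to be continuous on the whole real line, so a segment is continued by constants. *)
Definition clamp (t : R) : R := Num.max 0 (Num.min 1 t).

Lemma clamp01 t : 0 <= clamp t <= 1.
Proof. by rewrite /clamp le_max lexx ge_max ler01 ge_min lexx. Qed.

Lemma clamp_id t : 0 <= t <= 1 -> clamp t = t.
Proof. by move=> /andP[t0 t1]; rewrite /clamp (min_idPr t1) (max_idPr t0). Qed.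

Lemma clamp_continuous : continuous clamp.
Proof.
move=> t; apply: (@continuous_max R R (fun=> 0) (fun s => Num.min 1 s) t).
  exact: cst_continuous.
apply: (@continuous_min R R (fun=> 1) id t); first exact: cst_continuous.
by move=> A.
Qed.

Section Path.
Variables z w : R[i].
Hypothesis zw : forall t : R, 0 <= t <= 1 -> wedge (z + t%:C * (w - z)).

Let f (t : R) : R[i] := z + (clamp t)%:C * (w - z).

Let f_cvg (t : R) : (f : R -> R[i]^o) @ t --> (f t : R[i]^o).
Proof.
have k1 : (fun=> z : R[i]^o) @ t --> (z : R[i]^o) by exact: cst_continuous.
have k2 : (fun=> w - z : R[i]^o) @ t --> (w - z : R[i]^o) by exact: cst_continuous.
exact: (cvgcD k1 (cvgcM (cvgc_real (@clamp_continuous t)) k2)).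
Qed.

Let wf t : wedge (f t). Proof. by apply: zw; exact: clamp01. Qed.

Let spath_continuous : continuous (spt \o f).
Proof. by apply: cone_pt_continuous => // t; exact: wedge_Omega. Qed.

(** The summand [lens_rho] is constant by coning, and [turn] because i^turn is the continuous
    function [turn_fun]. *)
Lemma defect_path : defect (spt z) = defect (spt w).
Proof.
have f0 : f 0 = z by rewrite /f clamp_id ?lexx ?ler01// mul0r addr0.
have f1 : f 1 = w by rewrite /f clamp_id ?lexx ?ler01// mul1r addrC subrK.
have L := @lens_rho_path _ _ _ _ gB rho (mkcts spath_continuous) 0 1 ler01
  (fun t _ => both_spt (wf t)).
have {}L : lens_rho gB rho (spt (f 0)) = lens_rho gB rho (spt (f 1)) by exact: L.
have T : turn c m B (set_val (spt (f 0))) = turn c m B (set_val (spt (f 1))).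
  apply: (locally_constant_segment (u := fun t => turn c m B (set_val (spt (f t)))) ler01) => t _.
  exact: (f_cvg (turn_near (wf t))).
by move: L T; rewrite f0 f1 /defect => -> ->.
Qed.

End Path.

End Wedges.

(** * Explicit small circles around the punctures *)

Section PunctureCircle.
Variables (R : realType).

(* rows: the unit tangent vectors to the meridian and to the parallel through
   (s e, s f, k), and this point *)
Definition meridian_mx (e f s k : R) : 'M[R]_3 :=
  \matrix_(i, j) (nth [::] [:: [:: k * e; k * f; - s]; [:: - f; e; 0];
    [:: s * e; s * f; k]] i)`_j.

Lemma so3_meridian (e f s k : R) : e ^+ 2 + f ^+ 2 = 1 -> s ^+ 2 + k ^+ 2 = 1 ->
  so3 (meridian_mx e f s k).
Proof.
move=> ef sk; split.
  apply/matrixP => i j; rewrite !mxE sum3 !mxE.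
  case: (ord3P i) => ->; case: (ord3P j) => -> /=; rewrite ?mulr1n ?mulr0n.
  - by transitivity (k ^+ 2 * (e ^+ 2 + f ^+ 2) + s ^+ 2); [ring|rewrite ef mulr1 addrC].
  - by ring.
  - by transitivity (k * s * (e ^+ 2 + f ^+ 2) - s * k); [ring|rewrite ef; ring].
  - by ring.
  - by transitivity (e ^+ 2 + f ^+ 2); [ring|].
  - by ring.
  - by transitivity (k * s * (e ^+ 2 + f ^+ 2) - s * k); [ring|rewrite ef; ring].
  - by ring.
  - by transitivity (s ^+ 2 * (e ^+ 2 + f ^+ 2) + k ^+ 2); [ring|rewrite ef mulr1].
rewrite det_mx3 !mxE /=.
transitivity ((e ^+ 2 + f ^+ 2) * (s ^+ 2 + k ^+ 2)); first by ring.
by rewrite ef sk mulr1.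
Qed.

Lemma tangent_meridian (e f s k : R) : s ^+ 2 + k ^+ 2 = 1 ->
  tangent (meridian_mx e f s k) = (e +i* f) * (1 + k)%:C.
Proof.
move=> sk; rewrite /tangent !mxE /=; apply: eqc_ReIm; rewrite /=.
  by transitivity (e * (k + (s ^+ 2 + k ^+ 2))); [ring|rewrite sk; ring].
by transitivity (f * (k + (s ^+ 2 + k ^+ 2))); [ring|rewrite sk; ring].
Qed.

Lemma circle_row_unit (r t : R) : dot (circle_row r t) (circle_row r t) = 1.
Proof.
rewrite /dot sum3 !mxE /=; have h := cos2Dsin2 r; have h' := cos2Dsin2 (2 * pi * t).
transitivity (sin r ^+ 2 * (cos (2 * pi * t) ^+ 2 + sin (2 * pi * t) ^+ 2) + cos r ^+ 2).
  by ring.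
by rewrite h' mulr1 addrC.
Qed.

Lemma cos_quarter (t : R) :
  [/\ 0 <= t <= 1 / 4 -> 0 <= cos (2 * pi * t),
      1 / 4 <= t <= 3 / 4 -> cos (2 * pi * t) <= 0 &
      3 / 4 <= t <= 1 -> 0 <= cos (2 * pi * t)].
Proof.
have p0 := pi_gt0 R; split=> /andP[h1 h2].
- by apply: cos_ge0_pihalf; apply/andP; split; nra.
- rewrite -oppr_ge0 -cosDpi.
  have -> : 2 * pi * t + pi = (2 * pi * t - pi) + pi *+ 2 by rewrite mulr2n; ring.
  by rewrite cosD2pi; apply: cos_ge0_pihalf; apply/andP; split; nra.
- have -> : 2 * pi * t = (2 * pi * t - 2 * pi) + pi *+ 2 by rewrite mulr2n; ring.
  by rewrite cosD2pi; apply: cos_ge0_pihalf; apply/andP; split; nra.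
Qed.

End PunctureCircle.

Section PunctureLoop.
Variables (R : realType) (n : nat) (c : 'I_n -> S2 R).
Hypothesis c_inj : injective c.
Variable B : 'M[R]_3.
Hypothesis gB : generic_frame c B.
Variable i : 'I_n.
Let X := punctured c.
Let p := c i.
Let D := denS B p.
Let N := numS B p.
Let s := cabs N.

Let Dp : 0 < D. Proof. by apply: (denS_gt0 (sB gB)); case: gB => _ /(_ i)[]. Qed.

Let N0 : N != 0.
Proof. by apply: contraNneq (cpos_neq0 gB i) => N0; rewrite /cpos /stereo -/N N0 mul0r. Qed.

Let s0 : 0 < s. Proof. by rewrite cabs_gt0. Qed.

Let e := crd B 0 p / s.
Let f := crd B 1 p / s.
Let k := crd B 2 p.

Let ef : e ^+ 2 + f ^+ 2 = 1.
Proof.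
have h : s ^+ 2 = crd B 0 p ^+ 2 + crd B 1 p ^+ 2 by exact: cabs_sqr.
transitivity ((crd B 0 p ^+ 2 + crd B 1 p ^+ 2) / s ^+ 2).
  by rewrite /e /f; field; rewrite gt_eqF.
by rewrite -h divff// expf_neq0// gt_eqF.
Qed.

Let sk : s ^+ 2 + k ^+ 2 = 1.
Proof.
have h : s ^+ 2 = crd B 0 p ^+ 2 + crd B 1 p ^+ 2 by exact: cabs_sqr.
by rewrite h /k; exact: crd_sqr (sB gB).
Qed.

Let F := meridian_mx e f s k *m B.

Let sF : so3 F.
Proof.
have [BB dB] := sB gB; have [GG dG] := so3_meridian ef sk; split.
  by rewrite trmx_mul mulmxA -(mulmxA _ B) BB mulmx1.
by rewrite det_mulmx dG dB mulr1.
Qed.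

Let Fp : row ord_max F = set_val p.
Proof.
rewrite -[set_val p]mulmx1 -(so3_orthoT (sB gB)) mulmxA row_mul; congr (_ *m _).
apply/rowP => j; have -> : (set_val p *m B^T) 0 j = crd B j p by [].
rewrite !mxE.
by case: (ord3P j) => -> /=; rewrite ?(mulrC s) ?divfK ?gt_eqF.
Qed.

Let FBT : F *m B^T = meridian_mx e f s k.
Proof. by rewrite -mulmxA (sB gB).1 mulmx1. Qed.

(** The frame follows the meridian of the puncture, so that for small r the points t = 0 and t = 1/2
    lie on the ray of z_i, beyond and before z_i respectively. *)
Definition circ (r t : R) : S2 R := sphere_pt sF (circle_row_unit r t).

Lemma circ_positive r : positive_circle p r (circ r).
Proof. by exists F; case: sF => FF dF; split. Qed.

Lemma dot_circ r t : dot (set_val p) (set_val (circ r t)) = cos r.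
Proof.
have <- : circle_row r t 0 2 = cos r by rewrite mxE.
rewrite -(crd_sphere_pt sF (circle_row_unit r t) 2) -/(circ r t).
rewrite /crd mxE; apply: eq_bigr => j _; rewrite mulrC [F^T _ _]mxE; congr (_ * _).
by rewrite -Fp mxE; congr (F _ j); exact/val_inj.
Qed.

Lemma dot_lt1 j : j != i -> dot (set_val (c j)) (set_val p) < 1.
Proof.
move=> ji; rewrite -subr_gt0.
have E : 2 * (1 - dot (set_val (c j)) (set_val p)) = (crd B 0 (c j) - crd B 0 p) ^+ 2 +
    (crd B 1 (c j) - crd B 1 p) ^+ 2 + (crd B 2 (c j) - crd B 2 p) ^+ 2.
  rewrite (dot_crd _ _ (sB gB)) sum3.
  have := crd_sqr (c j) (sB gB); have := crd_sqr p (sB gB) => h1 h2.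
  by transitivity ((crd B 0 (c j) ^+ 2 + crd B 1 (c j) ^+ 2 + crd B 2 (c j) ^+ 2) +
    (crd B 0 p ^+ 2 + crd B 1 p ^+ 2 + crd B 2 p ^+ 2) - 2 *
    (crd B 0 (c j) * crd B 0 p + crd B 1 (c j) * crd B 1 p + crd B 2 (c j) * crd B 2 p));
    [rewrite h1 h2; ring|ring].
rewrite -(pmulr_rgt0 _ (ltr0Sn R 1)) E lt0r; apply/andP; split; last first.
  by rewrite !addr_ge0 ?sqr_ge0.
apply: contraNneq ji => /eqP; rewrite !paddr_eq0 ?addr_ge0 ?sqr_ge0// !sqrf_eq0 !subr_eq0.
move=> /andP[/andP[/eqP e0 /eqP e1] /eqP e2]; apply/eqP/c_inj/(crd_inj (sB gB)) => l.
by case: (ord3P l) => ->.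
Qed.

Lemma near_dot_lt_cos : \forall r \near 0^'+, forall j, j != i ->
  dot (set_val (c j)) (set_val p) < cos r.
Proof.
apply: (@filter_forall _ _ (fun j r => j != i -> dot (set_val (c j)) (set_val p) < cos r) (0 : R)^'+ _) => j.
have [->|ji] := eqVneq j i; first by apply: nearW => r /=.
have d1 : 0 < 1 - dot (set_val (c j)) (set_val p) by rewrite subr_gt0 dot_lt1.
have : cos r @[r --> (0 : R)] --> cos (0 : R) by exact: continuous_cos.
rewrite cos0 => /cvgrPdist_lt/(_ _ d1) H; rewrite near_withinE.
apply: filterS H => r; rewrite ltr_norml => /andP[_ h] _ _.
by lra.
Qed.

(** Division by z_i cancels the direction [e +i* f] of the meridian; the real part then records the
    radial displacement and the imaginary part the sideways one. *)
Lemma circ_coord r t : denS B (circ r t) != 0 ->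
  1 - cinv c B i * stereo B (circ r t) =
  ((1 - cos r - sin r * (D / s) * cos (2 * pi * t)) / denS B (circ r t)) +i*
  (- (sin r * (D / s) * sin (2 * pi * t)) / denS B (circ r t)).
Proof.
move=> Dt; have D0 : D != 0 by rewrite gt_eqF.
have cD := real_neq0 D0; have cDt := real_neq0 Dt; have cs := real_neq0 (lt0r_neq0 s0).
have NE : N = s%:C * (e +i* f).
  rewrite realM_ReIm /= /e /f; apply: eqc_ReIm => /=; by rewrite mulrC divfK ?gt_eqF.
have u0 : e +i* f != 0.
  by apply: contraNneq N0 => u0; rewrite NE u0 mulr0.
have ST : stereo B (circ r t) - stereo B p = ((sin r)%:C * cis (2 * pi * t) *
    ((e +i* f) * D%:C) + (cos r - 1)%:C * N) / ((denS B (circ r t))%:C * D%:C).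
  have vc : set_val (circ r t) = circle_row r t *m F by [].
  by rewrite (stereo_sub D0 Dt) (circle_exact (sB gB) sF Fp vc) FBT tangent_meridian.
have zi : cinv c B i = D%:C / N by rewrite /cinv /cpos /stereo -/N -/D -/p invf_div.
have -> : 1 - cinv c B i * stereo B (circ r t) =
    - (cinv c B i * (stereo B (circ r t) - stereo B p)).
  have : cinv c B i * stereo B p = 1 by rewrite /cinv mulVf// (cpos_neq0 gB).
  by rewrite mulrBr => ->; ring.
rewrite ST zi NE.
transitivity ((1 - cos r - sin r * (D / s) * cos (2 * pi * t)) -i*
  (sin r * (D / s) * sin (2 * pi * t)) / (denS B (circ r t))%:C); last first.
  by rewrite divc_real /= mulNr.
have -> : (1 - cos r - sin r * (D / s) * cos (2 * pi * t)) -i*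
  (sin r * (D / s) * sin (2 * pi * t)) =
  (1 - cos r)%:C - (sin r)%:C * (D%:C / s%:C) * cis (2 * pi * t).
  rewrite -fmorphV -!rmorphM /cis realM_ReIm; apply: eqc_ReIm => /=; ring.
rewrite !rmorphB /=; field.
by rewrite cD cDt cs u0.
Qed.

End PunctureLoop.

Section PunctureLoop.
Variables (R : realType) (n : nat) (c : 'I_n -> S2 R).
Hypothesis c_inj : injective c.
Variable B : 'M[R]_3.
Hypothesis gB : generic_frame c B.
Variable i : 'I_n.
Let X := punctured c.
Let D := denS B (c i).
Let s := cabs (numS B (c i)).

Let D0 : 0 < D. Proof. by apply: (denS_gt0 (sB gB)); case: gB => _ /(_ i)[]. Qed.

Let s0 : 0 < s.
Proof.
rewrite cabs_gt0; apply: contraNneq (cpos_neq0 gB i) => N0.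
by rewrite /cpos /stereo N0 mul0r.
Qed.

Lemma circ_punctured r : 0 < sin r -> (forall j, j != i -> dot (set_val (c j)) (set_val (c i)) < cos r) ->
  forall t, circ gB i r t \in ~` range c.
Proof.
move=> sr H t; apply/mem_set => -[j _ jE].
have E := dot_circ gB i r t; rewrite -jE in E.
have [ji|ji] := eqVneq j i.
  move: E; rewrite ji sphere_sqr => c1.
  have := cos2Dsin2 r; rewrite -c1 expr1n => h; have := exprn_gt0 2 sr; lra.
have := H _ ji; rewrite -E /dot; under eq_bigr do rewrite mulrC.
by rewrite ltxx.
Qed.

Lemma slit_oneBinv (y : R[i]) : complex.Im (1 - y) != 0 \/ complex.Re (1 - y) < 0 ->
  slit (1 - y^-1).
Proof.
case: y => u v; rewrite /slit.
have -> : complex.Im (1 - (u +i* v)) = - v by rewrite /= sub0r.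
have -> : complex.Re (1 - (u +i* v)) = 1 - u by [].
have -> : complex.Im (1 - (u +i* v)^-1) = v / (u ^+ 2 + v ^+ 2).
  by rewrite /= sub0r opprK.
have -> : complex.Re (1 - (u +i* v)^-1) = 1 - u / (u ^+ 2 + v ^+ 2) by [].
rewrite oppr_eq0; have [->|v0 _] := eqVneq v 0.
  case=> // h; apply/orP; right; rewrite expr0n /= addr0.
  have u1 : 1 < u by lra.
  have -> : u / u ^+ 2 = u^-1 by field; rewrite gt_eqF//; lra.
  by rewrite subr_gt0 invf_lt1; lra.
apply/orP; left; rewrite mulf_neq0// invr_eq0.
by rewrite paddr_eq0 ?sqr_ge0// !expf_eq0 /= (negbTE v0) andbF.
Qed.

(** The loop to which the hypothesis on [rho] is applied. Its half with cos <= 0, turned towards the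
    coordinate 0, avoids the i-th cut of the first chart, and the other half avoids that of the
    second. The two switching points lie on opposite sides of the ray. *)
Lemma puncture_loop (d : R) : 0 < d -> exists g : loop R X, [/\ small_positive_loop i g,
  forall t, denS B (set_val (g t)) != 0 /\ cabs (stereo B (set_val (g t)) - cpos c B i) < d,
  forall t, 1 / 4 <= t <= 3 / 4 -> slit (1 - cinv c B i * stereo B (set_val (g t))),
  forall t, 0 <= t <= 1 / 4 \/ 3 / 4 <= t <= 1 ->
    slit (1 - (cinv c B i * stereo B (set_val (g t)))^-1) &
  0 < complex.Im (cinv c B i * stereo B (set_val (g (1 / 4)))) /\
  complex.Im (cinv c B i * stereo B (set_val (g (3 / 4)))) < 0].
Proof.
(* The bound D / 32 is the one of [circle_estimate], d D / 2 keeps the image within distance d of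
   z_i, and D / s gives 1 - cos r < sin r (D / s), so that the point t = 0 really lies beyond
   z_i. *)
move=> d0; pose dl := Num.min (D / 32) (Num.min (d * D / 2) (D / s)).
have dl0 : 0 < dl by rewrite !lt_min !divr_gt0// mulr_gt0.
have p2 : 0 < pi / 2 :> R by rewrite divr_gt0// pi_gt0.
have ND := near_dot_lt_cos c_inj gB i; have NS := near_sin dl0.
near (0 : R)^'+ => r.
have r0 : 0 < r by [].
have rp : r < pi / 2 by [].
have H : forall j, j != i -> dot (set_val (c j)) (set_val (c i)) < cos r.
  by near: r; exact: ND.
have [sr cr] : [/\ 0 < sin r, 0 <= cos r & sin r < dl] by near: r; exact: NS.
rewrite !lt_min => /and3P[sD sd ss].
have PH := circ_punctured sr H.
pose f t : X := exist _ (circ gB i r t) (PH t).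
have cp := circ_positive gB i r.
have fc : continuous f.
  apply: continuous_comp_initial => t; exact: (circle_cvg (sB gB) cp).
have f01 : f 0 = f 1.
  apply: val_inj; apply: val_inj; congr (_ *m _); rewrite /circle_row.
  by rewrite mulr1 (mulr0 (2 * pi)) mulr_natl cos2pi sin2pi cos0 sin0.
pose g := @Loop R X (mkcts fc) f01.
have gE t : set_val (g t) = circ gB i r t by [].
have s32 : 32 * sin r <= denS B (c i) by move: sD; rewrite ltr_pdivlMr// => h; rewrite -/D; lra.
have Dn0 : denS B (c i) != 0 by rewrite gt_eqF.
have [l [lE HE]] := circle_estimate (sB gB) Dn0 sr cr s32 cp.
have Dt t : 0 < denS B (circ gB i r t) by apply: denS_gt0; [exact: (sB gB)|case: (HE t)].
have A0 : 0 < sin r * (D / s) by rewrite mulr_gt0// divr_gt0.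
have C0 : 0 < 1 - cos r.
  have := cos2Dsin2 r; have := exprn_gt0 2 sr; have := cr => h0 h1 h2.
  by rewrite subr_gt0 ltNge; apply/negP => h; nra.
have CA : 1 - cos r < sin r * (D / s).
  apply: (@le_lt_trans _ _ (sin r * sin r)); last by rewrite ltr_pM2l.
  by have := cos2Dsin2 r; have := cos_le1 r; nra.
have coordE t := circ_coord (lt0r_neq0 (Dt t)).
exists g; split.
- by exists r; split=> //; apply/andP.
- move=> t; rewrite gE; have [Dt0 h] := HE t; split=> //; rewrite -[cpos _ _ _]/(stereo B (c i)).
  rewrite -(subrK (cis (2 * pi * t) * l) (_ - _)).
  apply: le_lt_trans (cabsD _ _) _; rewrite cabsM cabs_cis mul1r.
  apply: (@le_lt_trans _ _ (2 * cabs l)); first by have := cabs_ge0 l; lra.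
  by rewrite lE -/D mulrA ltr_pdivrMr//; lra.
- move=> t t4; rewrite gE coordE /slit; apply/orP; right => /=.
  rewrite divr_gt0//; have [_ /(_ t4) h _] := cos_quarter t.
  by rewrite subr_gt0; apply: le_lt_trans C0; rewrite pmulr_rle0.
- move=> t t4; rewrite gE; apply: slit_oneBinv; rewrite coordE /=.
  have [h1 _ h3] := cos_quarter t.
  have ct : 0 <= cos (2 * pi * t) by case: t4.
  have [st|st] := eqVneq (sin (2 * pi * t)) 0; last first.
    left; apply: mulf_neq0; last by rewrite invr_eq0 gt_eqF.
    by rewrite oppr_eq0; apply: mulf_neq0 => //; rewrite gt_eqF.
  right; rewrite pmulr_llt0 ?invr_gt0//.
  suff -> : cos (2 * pi * t) = 1 by rewrite mulr1 subr_lt0.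
  have := cos2Dsin2 (2 * pi * t); rewrite st expr0n /= addr0 => /eqP.
  by rewrite sqrf_eq1 => /orP[/eqP //|/eqP h]; move: ct; rewrite h; lra.
- have yE t : complex.Im (cinv c B i * stereo B (set_val (g t))) =
      sin r * (D / s) * sin (2 * pi * t) / denS B (circ gB i r t).
    rewrite gE -[cinv _ _ _ * _](subKr 1) coordE cImD cImN.
    have -> : complex.Im (1 : R[i]) = 0 by [].
    by rewrite /= add0r mulNr opprK.
  rewrite !yE; split.
    have -> : 2 * pi * (1 / 4) = pi / 2 :> R by field.
    by rewrite sin_pihalf mulr1 divr_gt0.
  have -> : 2 * pi * (3 / 4) = pi / 2 + pi :> R by field.
  by rewrite sinDpi sin_pihalf mulrN1 mulNr oppr_lt0 divr_gt0.
Unshelve. all: by end_near. Qed.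

End PunctureLoop.

Lemma segment_same_sign (R : realType) (u v t : R) : 0 <= t <= 1 -> 0 < u * v ->
  (1 - t) * u + t * v != 0.
Proof.
move=> /andP[t0 t1] uv; apply: contraTneq uv => h; rewrite -leNgt.
have e0 : (1 - t) * (u * u) + t * (u * v) = 0 by rewrite -[RHS](mulr0 u) -h; ring.
have := sqr_ge0 u; rewrite expr2 => uu.
rewrite leNgt; apply/negP => uv.
have u0 : 0 < u * u by rewrite lt0r uu andbT mulf_neq0//; apply: contraTneq uv => ->; rewrite mul0r ltxx.
have h1 : 0 <= (1 - t) * (u * u) by rewrite mulr_ge0// subr_ge0.
have [t00|tn0] := eqVneq t 0; first by move: e0; rewrite t00; lra.
have h2 : 0 < t * (u * v) by rewrite mulr_gt0// lt0r tn0.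
by lra.
Qed.

(** * Constancy of the defect across the rays *)

Section DefectConstant.
Variables (R : realType) (n : nat) (c : 'I_n -> S2 R) (m : 'I_n -> int).
Hypothesis c_inj : injective c.
Variable B : 'M[R]_3.
Hypothesis gB : generic_frame c B.
Hypothesis m_sum : \sum_i m i = -8.
Variable rho : {additive H1 R (punctured c) -> 'Z_4}.
Hypothesis rhoP : forall (i : 'I_n) (g : loop R (punctured c)),
  small_positive_loop i g -> rho (loop_class g) = (m i)%:~R.
Let X := punctured c.
Implicit Types (q : X) (z w : R[i]).

Local Notation ainv := (cinv c B).
Local Notation apos := (cpos c B).
Local Notation wedge := (wedge c B).
Local Notation spt := (spt gB).
Local Notation defect := (defect m gB rho).

Lemma exprz_i (k : int) : ('i : R[i]) ^ k = 'i ^+ (k%:~R : 'Z_4).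
Proof.
have N (l : nat) : ('i : R[i]) ^+ l = 'i ^+ (l%:R : 'Z_4).
  by rewrite -[LHS]exprM4i; congr (_ ^+ _); rewrite val_Zp_nat.
case: k => l; first exact: N.
rewrite NegzE mulrNz -[(l.+1)%:~R]/(l.+1%:R).
have E : ('i : R[i]) ^+ (- (l.+1%:R : 'Z_4))%R * 'i ^+ (l.+1%:R : 'Z_4) = 1.
  by rewrite -exprZ4D addNr.
rewrite -exprnN N; apply/esym; rewrite -[LHS]mulr1.
by rewrite -(mulfV (_ : 'i ^+ (l.+1%:R : 'Z_4) != 0)) ?expf_neq0 ?i_neq0// mulrA E mul1r.
Qed.

Section AtPuncture.
Variable i : 'I_n.

Let slit_other j : j != i -> slit (- (ainv j * apos i)).
Proof. by move=> ji; case: gB => _ _; apply; rewrite eq_sym. Qed.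

(* [turn_fun], continued across the ray through the i-th puncture *)
Let K w := - (scale4 c m B)^-1 * w ^+ 2 *
  (\prod_(j | j != i) root4 (- (ainv j * w)) ^ m j) * (nu8 R * root4 (ainv i * w)) ^ m i.

Let K_cvg : (K : R[i] -> R[i]^o) @ (apos i : R[i]^o) --> (K (apos i) : R[i]^o).
Proof.
have ap : ainv i * apos i = 1 by rewrite /cinv mulVf// (cpos_neq0 gB).
have s1 : slit (ainv i * apos i) by rewrite ap /slit /= ltr01 orbT.
apply: hol_cvg; apply: holM; first (apply: holM; first (apply: holM)).
- exact: hol_cst.
- exact/holX/hol_id.
- apply: hol_prod => j ji; apply: (hol_exprz (f := root4 \o (fun x => - (ainv j * x)))).
    exact/root4_neq0/slit_other.
  by apply: hol_root4; [exact: slit_other|exact: hol_linear_form].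
- apply: (hol_exprz (f := fun x => nu8 R * (root4 \o (fun x => ainv i * x)) x)).
    rewrite mulf_neq0 ?root4_neq0//.
    by rewrite /nu8 eq_complex /= gt_eqF// invr_gt0 sqrtr_gt0.
  apply: holM; first exact: hol_cst.
  apply: hol_root4; first exact: s1.
  by apply: holM; [exact: hol_cst|exact: hol_id].
Qed.

Let turn_upper w : 0 < complex.Im (ainv i * w) -> turn_fun c m B w = K w.
Proof.
move=> h; rewrite /turn_fun (bigD1 i)//= (root4N_upper h) /K.
by set P := \prod_(_ | _) _; set Q := _ ^ m i; ring.
Qed.

Let turn_lower w : complex.Im (ainv i * w) < 0 -> turn_fun c m B w = 'i ^ m i * K w.
Proof.
move=> h; rewrite /turn_fun (bigD1 i)//= (root4N_lower h) -(mulrA 'i) (expfzMl 'i) /K.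
set P := \prod_(_ | _) _; set U := 'i ^ m i.
by set Q := (nu8 R * _) ^ m i; ring.
Qed.

(** Close to z_i only the i-th ray is left. It separates two half discs on each of which the defect
    is constant. They are compared at the switching points w1 and w3 of the small circle, where both
    summands of the defect differ by m_i. *)
Lemma defect_at_puncture : exists (e : 'Z_4) (r : R), 0 < r /\
  forall w, cabs (w - apos i) < r -> wedge w -> defect (spt w) = e.
Proof.
have ap : ainv i * apos i = 1 by rewrite /cinv mulVf// (cpos_neq0 gB).
have h2 : 0 < 1 / 2 :> R by rewrite divr_gt0.
(* Two values within 1/2 of [K (apos i)] are within 1 of each other, as [exprZ4_inj] demands. *)
have NK : \forall w \near (apos i : R[i]^o), cabs (K w - K (apos i)) < 1 / 2.
  by have /cvgc_nearP/(_ _ h2) := K_cvg.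
have NA : \forall w \near (apos i : R[i]^o), cabs (ainv i * w - 1) < 1.
  have hl : hol (fun w => ainv i * w) (apos i) by apply: holM; [exact: hol_cst|exact: hol_id].
  by have /cvgc_nearP/(_ _ ltr01) := hol_cvg hl; rewrite ap.
have NS : \forall w \near (apos i : R[i]^o), forall j, j != i -> slit (- (ainv j * w)).
  apply: (@filter_forall _ _ (fun j w => j != i -> slit (- (ainv j * w)))
    (nbhs (apos i : R[i]^o)) _) => j.
  have [->|ji] := eqVneq j i.
    by apply/nbhs_cabsP; exists 1 => // w _ /=.
  have sj := slit_other ji.
  have H0 : \forall w \near (apos i : R[i]^o), slit (- (ainv j * w)).
    exact: (hol_cvg (hol_linear_form (ainv j) (apos i)) (slit_open sj)).
  have [r r0 H] := (nbhs_cabsP _ _).1 H0.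
  by apply/nbhs_cabsP; exists r => // w wr _; exact: H.
have [r r0 Hr] := (nbhs_cabsP _ _).1 (filterI NK (filterI NA NS)).
have Re0 w : cabs (w - apos i) < r -> 0 < complex.Re (ainv i * w).
  move=> /Hr[_ [/(le_lt_trans (cabs_Re _)) + _]]; rewrite cReD cReN.
  have -> : complex.Re (1 : R[i]) = 1 by [].
  by rewrite ltr_norml => /andP[h _]; lra.
have wedgeE w : cabs (w - apos i) < r -> wedge w <-> complex.Im (ainv i * w) != 0.
  move=> wr; have [_ [_ ws]] := Hr _ wr; have w0 := Re0 _ wr; split.
    by case=> _ /(_ i)/orP[]; rewrite ?cImN ?oppr_eq0// cReN oppr_gt0 ltNge ltW.
  move=> iw; split; first by apply: contraTneq w0 => ->; rewrite mulr0 ltxx.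
  move=> j; have [->|ji] := eqVneq j i; last exact: ws.
  by rewrite /slit cImN oppr_eq0 iw.
have [g [gi gd gS gN [g1 g3]]] := puncture_loop c_inj gB i r0.
have gnear t : cabs (stereo B (set_val (g t)) - apos i) < r by case: (gd t).
have gz t : stereo B (set_val (g t)) != 0.
  by apply: contraTneq (Re0 _ (gnear t)) => ->; rewrite mulr0 ltxx.
have gy j t : ainv j * stereo B (set_val (g t)) != 0.
  by rewrite mulf_neq0// (cinv_neq0 gB).
have gDop t : denS (Bop B) (set_val (g t)) != 0.
  have [D0 _] := gd t; have [_ _ E2] := crd_flip B (set_val (g t)).
  rewrite /denS E2; apply: contraNneq (gz t) => h.
  have : cabs (numS B (set_val (g t))) ^+ 2 = 0 by rewrite (cabs_numS _ (sB gB)) h mulr0.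
  move=> /eqP; rewrite sqrf_eq0 cabs_eq0 => /eqP h'.
  by rewrite /stereo h' mul0r.
have gSj t j : j != i -> slit (1 - ainv j * stereo B (set_val (g t))) /\
    slit (1 - (ainv j * stereo B (set_val (g t)))^-1).
  move=> ji; have [_ [_ /(_ _ ji)]] := Hr _ (gnear t).
  by rewrite (slit_split (gy j t)) => /andP[].
have inS t : 1 / 4 <= t <= 3 / 4 -> regS c B (set_val (g t)).
  move=> t4; split; first by case: (gd t).
  by move=> j; have [->|ji] := eqVneq j i; [exact: gS|have [] := gSj t j ji].
have inN t : 0 <= t <= 1 / 4 \/ 3 / 4 <= t <= 1 -> regN c B (set_val (g t)).
  move=> t4; split=> // j; have [_ ->] := stereo_op gB (gd t).1 (gDop t).
  have -> : cpos c B j / stereo B (set_val (g t)) = (ainv j * stereo B (set_val (g t)))^-1.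
    by rewrite [RHS]invfM /cinv invrK.
  by have [->|ji] := eqVneq j i; [exact: gN|have [] := gSj t j ji].
(* The circle is in the second chart on [0, 1/4] and [3/4, 1], and in the first one in between. The
   default 1 of [nth] supplies the end point s 3 = 1. *)
have R1 : lens_rho gB rho (g (3 / 4)) - lens_rho gB rho (g (1 / 4)) = (m i)%:~R.
  rewrite -(rhoP gi).
  rewrite (@loop_rho _ _ _ _ gB rho g 3 (fun l => nth 1 [:: 0; 1 / 4; 3 / 4] l)
    (fun l => l != 1%N))//.
  - rewrite !big_ord_recl big_ord0 /= side_jumpNS side_jumpSN side_jump_same.
    by rewrite mulr0z !addr0 mulrN1z mulr1z addrC.
  - by case=> [|[|[|//]]] _ /=; lra.
  - case=> [|[|[|//]]] _ t /= ht; [apply: inN; left|exact: inS|apply: inN; right]; exact: ht.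
set w1 := stereo B (set_val (g (1 / 4))) in g1; set w3 := stereo B (set_val (g (3 / 4))) in g3.
have W1 : wedge w1 by apply/(wedgeE _ (gnear _)); move: g1; rewrite lt0r => /andP[].
have W3 : wedge w3 by apply/(wedgeE _ (gnear _)); move: g3; rewrite lt_def eq_sym => /andP[].
have sptE t : wedge (stereo B (set_val (g t))) -> spt (stereo B (set_val (g t))) = g t.
  move=> W; apply: val_inj; apply: etrans (val_spt gB W) _.
  by rewrite stereoK//; case: (gd t).
have T1 : turn c m B (set_val (g (3 / 4))) = turn c m B (set_val (g (1 / 4))) + (m i)%:~R.
  apply: (@exprZ4_inj R); rewrite exprZ4D -exprz_i.
  have tE t : wedge (stereo B (set_val (g t))) ->
      'i ^+ turn c m B (set_val (g t)) = turn_fun c m B (stereo B (set_val (g t))).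
    by move=> W; have := turn_spt gB m_sum W; rewrite (sptE _ W).
  rewrite (tE _ W3) (tE _ W1) -/w1 -/w3 (turn_upper g1) (turn_lower g3).
  rewrite [X in cabs (_ - X)]mulrC -mulrBr cabsM.
  have -> : cabs ('i ^ m i) = 1 :> R by rewrite exprz_i cabsX cabs_i expr1n.
  rewrite mul1r; apply: le_trans (cabs_tri (K (apos i)) _ _) _.
  have [k3 _] := Hr _ (gnear (3 / 4)); have [k1 _] := Hr _ (gnear (1 / 4)).
  rewrite -/w3 in k3; rewrite -/w1 cabsC in k1.
  by rewrite [leRHS]splitr; exact: lerD (ltW k3) (ltW k1).
have D13 : defect (spt w3) = defect (spt w1).
  rewrite /w3 /w1 (sptE _ W3) (sptE _ W1) /defect T1.
  by apply/eqP; rewrite -subr_eq0 -{}R1; apply/eqP; ring.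
have seg w w' : cabs (w - apos i) < r -> cabs (w' - apos i) < r ->
    0 < complex.Im (ainv i * w) * complex.Im (ainv i * w') ->
    defect (spt w) = defect (spt w').
  move=> wr wr' ww; apply: (defect_path gB m_sum) => t /andP[t0 t1].
  apply/wedgeE.
    have -> : w + t%:C * (w' - w) - apos i =
      (1 - t)%:C * (w - apos i) + t%:C * (w' - apos i) by rewrite rmorphB; ring.
    apply: le_lt_trans (cabsD _ _) _; rewrite !cabsM !cabs_real !ger0_norm ?subr_ge0//.
    have [->|tn0] := eqVneq t 0; first by rewrite subr0 mul1r mul0r addr0.
    have tp : 0 < t by rewrite lt0r tn0.
    by have := cabs_ge0 (w - apos i); nra.
  have -> : complex.Im (ainv i * (w + t%:C * (w' - w))) =
      (1 - t) * complex.Im (ainv i * w) + t * complex.Im (ainv i * w').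
    have -> : ainv i * (w + t%:C * (w' - w)) = (1 - t)%:C * (ainv i * w) + t%:C * (ainv i * w').
      by rewrite rmorphB; ring.
    by rewrite cImD !realM_ReIm.
  by apply: segment_same_sign; rewrite ?t0.
exists (defect (spt w1)), r; split=> // w wr ww.
have [h|h|h] := ltgtP (complex.Im (ainv i * w)) 0; last first.
  by have := (wedgeE _ wr).1 ww; rewrite h eqxx.
  by apply: (seg _ _ wr (gnear (1 / 4))); rewrite mulr_gt0.
by rewrite -D13; apply: (seg _ _ wr (gnear (3 / 4))); rewrite nmulr_rgt0.
Qed.

End AtPuncture.

End DefectConstant.

Section DefectGlobal.
Variables (R : realType) (n : nat) (c : 'I_n -> S2 R) (m : 'I_n -> int).
Hypothesis c_inj : injective c.
Variable B : 'M[R]_3.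
Hypothesis gB : generic_frame c B.
Hypothesis m_sum : \sum_i m i = -8.
Variable rho : {additive H1 R (punctured c) -> 'Z_4}.
Hypothesis rhoP : forall (i : 'I_n) (g : loop R (punctured c)),
  small_positive_loop i g -> rho (loop_class g) = (m i)%:~R.
Implicit Types (z w : R[i]).

Local Notation ainv := (cinv c B).
Local Notation apos := (cpos c B).
Local Notation wedge := (wedge c B).
Local Notation spt := (spt gB).
Local Notation defect := (defect m gB rho).

Lemma slit_scale (s : R) z : 0 < s -> slit (s%:C * z) = slit z.
Proof.
move=> s0; rewrite /slit realM_ReIm.
rewrite [complex.Im (_ +i* _)]/(s * complex.Im z) [complex.Re (_ +i* _)]/(s * complex.Re z).
by rewrite mulf_eq0 gt_eqF// pmulr_rgt0.
Qed.

Lemma wedge_scale (s : R) z : 0 < s -> wedge z -> wedge (s%:C * z).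
Proof.
move=> s0 [z0 H]; split; first by rewrite mulf_neq0// real_neq0// gt_eqF.
move=> i; have -> : - (ainv i * (s%:C * z)) = s%:C * - (ainv i * z) by ring.
by rewrite slit_scale.
Qed.

Lemma defect_scale (s : R) z : 0 < s -> wedge z -> defect (spt (s%:C * z)) = defect (spt z).
Proof.
move=> s0 wz; apply/esym; apply: (defect_path gB m_sum) => t /andP[t0 t1].
have -> : z + t%:C * (s%:C * z - z) = (1 - t + t * s)%:C * z.
  by rewrite rmorphD rmorphB rmorphM; ring.
apply: wedge_scale => //; have [->|tn0] := eqVneq t 0; first by rewrite mul0r subr0 addr0 ltr01.
have : 0 < t * s by rewrite mulr_gt0// lt0r tn0.
by lra.
Qed.

(** A point outside the sectors lies on the ray of some puncture, and a positive scaling, which does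
    not affect the defect, moves it to the puncture itself. A point inside a sector has a disc
    around it in that sector. *)
Lemma defect_local z : z != 0 -> exists (e : 'Z_4) (r : R), 0 < r /\
  forall w, cabs (w - z) < r -> wedge w -> defect (spt w) = e.
Proof.
move=> z0; have [[i Hi] | H] := pselect (exists i, ~~ slit (- (ainv i * z))).
  move: Hi => /slitNreal; rewrite cImN cReN => -[/eqP]; rewrite oppr_eq0 => /eqP I0.
  rewrite oppr_le0 => R0; set s := complex.Re (ainv i * z) in R0.
  have sE : ainv i * z = s%:C by rewrite /s; case: (ainv i * z) I0 => u v /= ->.
  have zE : z = s%:C * apos i.
    by rewrite -sE mulrAC /cinv mulVf ?mul1r// (cpos_neq0 gB).
  have s0 : 0 < s.
    by rewrite lt0r R0 andbT; apply: contraNneq z0 => h; rewrite zE h mul0r.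
  have [e [r [r0 H]]] := @defect_at_puncture _ _ _ _ c_inj _ gB m_sum rho rhoP i.
  exists e, (s * r); split=> [|w wr ww]; first exact: mulr_gt0.
  have sV : 0 < s^-1 by rewrite invr_gt0.
  rewrite -(defect_scale sV ww); apply: H; last exact: wedge_scale.
  have -> : s^-1%:C * w - apos i = s^-1%:C * (w - z).
    by rewrite zE mulrBr mulrA -rmorphM mulVf ?gt_eqF// mul1r.
  by rewrite cabsM cabs_real gtr0_norm// mulrC ltr_pdivrMr// mulrC.
have wz : wedge z.
  by split=> // i; apply: contrapT => /negP h; apply: H; exists i.
have [r r0 Hr] := (nbhs_cabsP _ _).1 (wedge_near wz).
exists (defect (spt z)), r; split=> // w wr ww; apply/esym.
apply: (defect_path gB m_sum) => t /andP[t0 t1]; apply: Hr.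
have -> : z + t%:C * (w - z) - z = t%:C * (w - z) by ring.
rewrite cabsM cabs_real ger0_norm//; apply: le_lt_trans wr.
by rewrite ler_piMl ?cabs_ge0.
Qed.

(** The finitely many rays are avoided one after the other: a small step perpendicular to one ray
    leaves it, and the conditions already achieved are open. *)
Lemma wedge_dense z (r : R) : z != 0 -> 0 < r -> exists2 w, cabs (w - z) < r & wedge w.
Proof.
move=> z0 r0.
have r1 : 0 < Num.min r (cabs z) by rewrite lt_min r0 cabs_gt0.
suff H (l : seq 'I_n) : exists w, cabs (w - z) < Num.min r (cabs z) /\
    forall i, i \in l -> slit (- (ainv i * w)).
  have [w [wr ws]] := H (enum 'I_n); move: wr; rewrite lt_min => /andP[wr wz].
  exists w => //; split=> [|i]; last by rewrite ws// mem_enum.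
  by apply: contraTneq wz => ->; rewrite sub0r cabsN ltxx.
elim: l => [|i l [w [wr wl]]]; first by exists z; rewrite subrr cabs0.
have [s|ns] := boolP (slit (- (ainv i * w))).
  by exists w; split=> // j; rewrite inE => /orP[/eqP ->//|]; exact: wl.
have N : \forall x \near (w : R[i]^o), forall j, j \in l -> slit (- (ainv j * x)).
  apply: (@filter_forall _ _ (fun j x => j \in l -> slit (- (ainv j * x)))
    (nbhs (w : R[i]^o)) _) => j.
  have [jl|jl] := boolP (j \in l); last by apply/nbhs_cabsP; exists 1.
  have [d d0 Hd] := (nbhs_cabsP _ _).1
    (hol_cvg (hol_linear_form (ainv j) w) (slit_open (wl j jl))).
  by apply/nbhs_cabsP; exists d => // x xd _; exact: Hd.
have [d d0 Hd] := (nbhs_cabsP _ _).1 N.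
set h := Num.min d (Num.min r (cabs z) - cabs (w - z)).
have h0 : 0 < h by rewrite lt_min d0 subr_gt0.
have a0 : 0 < cabs (apos i) by rewrite cabs_gt0 (cpos_neq0 gB).
set e := h / 2 / cabs (apos i).
have e0 : 0 < e by rewrite !divr_gt0.
(* The factor i makes the step perpendicular to the ray of z_i. *)
set v := e%:C * ('i * apos i).
have vh : cabs v < h.
  have -> : cabs v = e * cabs (apos i) by rewrite /v !cabsM cabs_real gtr0_norm// cabs_i mul1r.
  have -> : e * cabs (apos i) = h / 2 by rewrite /e divfK// gt_eqF.
  by rewrite ltr_pdivrMr// ltr_pMr// ltr1n.
move: vh; rewrite /h lt_min => /andP[vd vr].
exists (w + v); split.
  have -> : w + v - z = (w - z) + v by ring.
  by apply: le_lt_trans (cabsD _ _) _; lra.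
move=> j; rewrite inE => /orP[/eqP ->|jl]; last by apply: Hd jl; rewrite addrC addKr.
move: ns => /slitNreal[]; rewrite cImN => /eqP; rewrite oppr_eq0 => /eqP I0 _.
have -> : ainv i * (w + v) = ainv i * w + e%:C * 'i.
  by rewrite /v /cinv; field; rewrite (cpos_neq0 gB).
have Ie : complex.Im (e%:C * 'i) = e by rewrite /= mulr1 mul0r addr0.
by rewrite /slit cImN oppr_eq0 cImD I0 add0r Ie (gt_eqF e0).
Qed.

(** Scaling reduces everything to the unit circle. There [defect_local] assigns a value to every
    angle, also to those of the rays; neighbouring values agree at a common point of a sector, so
    they are constant along the arc. *)
Lemma defect_spt_const z w : wedge z -> wedge w -> defect (spt z) = defect (spt w).
Proof.
suff H (a b : R) : a <= b -> wedge (cis a) -> wedge (cis b) ->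
    defect (spt (cis a)) = defect (spt (cis b)).
  move=> wz ww; have [a zE] := polar_ex z; have [b wE] := polar_ex w.
  have unit_arc u t : u = (cabs u)%:C * cis t -> wedge u ->
      wedge (cis t) /\ defect (spt u) = defect (spt (cis t)).
    move=> uE wu; have u0 : 0 < cabs u by rewrite cabs_gt0; case: wu.
    have tE : cis t = (cabs u)^-1%:C * u.
      by rewrite [in X in _ * X]uE mulrA -rmorphM mulVf ?gt_eqF// mul1r.
    by rewrite tE defect_scale ?invr_gt0//; split=> //; apply: wedge_scale; rewrite ?invr_gt0.
  have [wa ->] := unit_arc _ _ zE wz; have [wb ->] := unit_arc _ _ wE ww.
  by case: (leP a b) => [|/ltW] ab; [exact: H|apply/esym; exact: H].
move=> ab wa wb.
have /choice[E HE] : forall t : R, exists e : 'Z_4, exists2 r : R, 0 < r &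
    forall u, cabs (u - cis t) < r -> wedge u -> defect (spt u) = e.
  by move=> t; have [e [r [r0 H]]] := defect_local (cis_neq0 t); exists e, r.
have EE t : wedge (cis t) -> E t = defect (spt (cis t)).
  by move=> wt; have [r r0 ->//] := HE t; rewrite subrr cabs0.
rewrite -(EE _ wa) -(EE _ wb); apply: (locally_constant_segment ab) => t _.
have [r r0 Hr] := HE t; have r2 : 0 < r / 2 by rewrite divr_gt0.
have ct : ((fun u : R => cis u) : R -> R[i]^o) @ t --> (cis t : R[i]^o).
  by apply: cvg_cis; exact: cvg_id.
have := (cvgc_nearP t (@cis R) (cis t)).1 ct _ r2; apply: filterS => s st.
have [r' r0' Hs] := HE s.
have [|w' w1 w2] := @wedge_dense (cis s) (Num.min r' (r / 2)) (cis_neq0 s).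
  by rewrite lt_min r0'.
move: w1; rewrite lt_min => /andP[w1 w3].
rewrite -(Hs _ w1 w2); apply: Hr w2.
by apply: le_lt_trans (cabs_tri (cis s) _ _) _; lra.
Qed.

Lemma defect_const (p q : punctured c) : both B p -> both B q -> defect p = defect q.
Proof.
by move=> /(spt_both gB)[wp <-] /(spt_both gB)[wq <-]; exact: defect_spt_const.
Qed.

End DefectGlobal.

(** * Holonomy of arbitrary loops *)

Section LoopHolonomy.
Variables (R : realType) (n : nat) (c : 'I_n -> S2 R) (m : 'I_n -> int).
Hypothesis c_inj : injective c.
Variable B : 'M[R]_3.
Hypothesis gB : generic_frame c B.
Hypothesis m_sum : \sum_i m i = -8.
Variable rho : {additive H1 R (punctured c) -> 'Z_4}.
Hypothesis rhoP : forall (i : 'I_n) (g : loop R (punctured c)),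
  small_positive_loop i g -> rho (loop_class g) = (m i)%:~R.

Local Notation reg_side := (reg_side c B).

Lemma cover_side (q : punctured c) : exists e, reg_side e (set_val q).
Proof.
have [S|N] := regSN_cover gB (set_valP q); first by exists false.
by exists true.
Qed.

Lemma open_reg_side e : open (reg_side e).
Proof. by case: e; [exact: open_regN|exact: open_regS]. Qed.

Lemma loop_partition (g : loop R (punctured c)) : exists (N : nat) (e : nat -> bool),
  [/\ (0 < N)%N, e N = e 0%N & forall l, (l < N)%N ->
   forall t : R, l%:R / N%:R <= t <= l.+1%:R / N%:R -> reg_side (e l) (set_val (g t))].
Proof.
pose P (t r : R) := exists e, forall s, `|s - t| < r -> reg_side e (set_val (g s)).
have [|t t01|r r0 Hr] := @unit_interval_uniform R P.
- by move=> t r s sr [e He]; exists e => u us; apply: He; exact: lt_le_trans sr.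
- have [e He] := cover_side (g t).
  have gt : (set_val \o g) @ t --> set_val (g t).
    apply: (cvg_comp (loop_fun g) set_val); first exact: (@cts_fun _ _ (loop_fun g) t).
    exact: initial_continuous.
  have /gt/nbhs_ballP[r /= r0 Hr] : nbhs (set_val (g t)) (reg_side e).
    by apply: open_nbhs_nbhs; split=> //; exact: open_reg_side.
  exists (r / 2); first by rewrite divr_gt0.
  move=> s st _; exists e => u us; apply: Hr; rewrite /ball /= distrC.
  by rewrite -(subrKA s) [ltRHS]splitr (le_lt_trans (ler_normD _ _))// ltrD.
- pose N := (Num.truncn r^-1).+1.
  have N0 : 0 < N%:R :> R by rewrite ltr0n.
  have Nr : N%:R^-1 < r.
    by rewrite invf_plt ?posrE// /N truncnS_gt.
  have l01 l : (l < N)%N -> 0 <= (l%:R / N%:R : R) <= 1.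
    move=> lN; rewrite divr_ge0 ?ler0n//= ler_pdivrMr// mul1r ler_nat; exact: ltnW.
  have /choice[e He] : forall l, exists e : bool, (l < N)%N ->
      forall s : R, `|s - l%:R / N%:R| < r -> reg_side e (set_val (g s)).
    move=> l; have [lN|_] := ltnP l N; last by exists true.
    by have [e He] := Hr _ (l01 l lN); exists e => _.
  (* Index N is not a piece of the partition; it is given the side of piece 0 so that the sequence
     closes up. *)
  exists N, (fun l => if l == N then e 0%N else e l); split=> //; first by rewrite eqxx.
  move=> l lN t /andP[tl tr]; rewrite ltn_eqF//; apply: (He l lN).
  rewrite ger0_norm ?subr_ge0//; apply: le_lt_trans Nr.
  rewrite lerBlDr -[leRHS](_ : l.+1%:R / N%:R = _)//.
  by rewrite -[in LHS]natr1 mulrDl mul1r addrC.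
Qed.

Lemma loop_holonomy (g : loop R (punctured c)) :
  rotational_holonomy [set chartS c m B; chartN c m B] (fun t => set_val (g t))
    (rho (loop_class g)).
Proof.
have [N [e [N0 eN He]]] := loop_partition g.
have NR0 : 0 < N%:R :> R by rewrite ltr0n.
pose s l : R := l%:R / N%:R.
pose f (b : bool) := if b then chartN c m B else chartS c m B.
pose b (q : punctured c) := turn c m B (set_val q).
have s0 : s 0%N = 0 by rewrite /s mul0r.
have sN : s N = 1 by rewrite /s divff// gt_eqF.
have smono l : (l < N)%N -> s l <= s l.+1.
  by move=> _; rewrite /s ler_pM2r ?invr_gt0// ler_nat.
have both_s := both_jump s0 sN eN smono He.
have dom l t : (l < N)%N -> s l <= t <= s l.+1 -> chart_dom (f (e l)) (set_val (g t)).
  by move=> lN ts; have := He l lN t ts; rewrite /f /reg_side; case: (e l).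
exists N, s, (fun l => f (e l)), (fun l => b (g (s l.+1)) *~ side_jump (e l) (e l.+1)).
split=> //.
- split; last by rewrite eN.
  by move=> l _; rewrite /f; case: (e l); [right|left].
- by move=> l lN; split; [exact: smono|move=> t; exact: dom].
- move=> l lN; have [el|el] := eqVneq (e l) (e l.+1).
    rewrite -el side_jump_same mulr0z; apply: transition_refl.
    by apply: dom => //; rewrite lexx andbT smono.
  have [bS bN] := both_s l lN el; move: el; rewrite /f.
  case: (e l); case: (e l.+1) => //= _.
    by rewrite side_jumpNS mulrN1z; exact: (transitionNS gB).
  by rewrite side_jumpSN mulr1z; exact: (transitionSN gB).
rewrite (loop_rho gB rho s0 sN eN smono He); apply/eqP; rewrite -subr_eq0; apply/eqP.
(* The constant value of the defect is read off at some switch of charts. If there is none, both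
   sums vanish. *)
have [[l0 [l0N l0e]] | H] := pselect (exists l, (l < N)%N /\ e l != e l.+1); last first.
  rewrite -sumrB big1// => l _; have -> : e l = e l.+1.
    by apply: contrapT => h; apply: H; exists l; split; [|exact/eqP].
  by rewrite side_jump_same !mulr0z subrr.
pose d := defect m gB rho (g (s l0.+1)).
rewrite -sumrB (eq_bigr (fun l : 'I_N => d *~ side_jump (e l) (e l.+1))).
  by rewrite -mulrz_sumr sum_side_jump eN side_jump_same mulr0z.
move=> l _; have [->|el] := eqVneq (e l) (e l.+1).
  by rewrite side_jump_same !mulr0z subrr.
rewrite -mulrzBl; congr (_ *~ _); rewrite /d.
by apply: (defect_const c_inj gB m_sum rhoP); exact: both_s.
Qed.

End LoopHolonomy.

(** * Cone angles *)

Section InverseFunction.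
Variable R : realType.
Implicit Types (p d x y z : R[i]).

Lemma geometric_steps_is_cvg (u : R^nat) (C : R) :
  (forall k, `|u k.+1 - u k| <= C * 2^-1 ^+ k) -> cvgn u.
Proof.
move=> H; have /normed_cvg cs : cvgn [normed (series (telescope u))].
  apply: (@series_le_cvg _ _ (geometric C 2^-1)).
  - by move=> k; exact: normr_ge0.
  - by move=> k; apply: le_trans (H k); exact: normr_ge0.
  - by move=> k; exact: H.
  - by apply: is_cvg_geometric_series; rewrite ger0_norm ?invr_ge0// invf_lt1// ltr1n.
have -> : u = (fun k => u 0%N + series (telescope u) k).
  by apply/funext => k; exact: eq_sum_telescope.
exact: (is_cvgD (is_cvg_cst (u 0%N)) cs).
Qed.

Lemma geometric_steps_cvg (u : nat -> R[i]) (C : R) :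
  (forall k, cabs (u k.+1 - u k) <= C * 2^-1 ^+ k) ->
  exists l : R[i], (u : nat -> R[i]^o) @ \oo --> (l : R[i]^o).
Proof.
move=> H.
have cr : cvgn (fun k => complex.Re (u k)).
  apply: (@geometric_steps_is_cvg _ C) => k; apply: le_trans (H k).
  by rewrite -cReN -cReD; exact: cabs_Re.
have ci : cvgn (fun k => complex.Im (u k)).
  apply: (@geometric_steps_is_cvg _ C) => k; apply: le_trans (H k).
  by rewrite -cImN -cImD; exact: cabs_Im.
exists (limn (fun k => complex.Re (u k)) +i* limn (fun k => complex.Im (u k))).
by apply: cvgc_ReIm; [exact: cr|exact: ci].
Qed.

Section Solve.
Variables (f : R[i] -> R[i]) (p d y : R[i]) (rho : R).
Hypothesis d0 : d != 0.
Hypothesis fp : forall x x', cabs (x - p) < rho -> cabs (x' - p) < rho ->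
  cabs (f x - f x' - d * (x - x')) <= cabs d / 2 * cabs (x - x').
Hypothesis yp : cabs (y - f p) < cabs d * rho / 2.

Let D0 : 0 < cabs d. Proof. by rewrite cabs_gt0. Qed.
(** Newton's iteration with the derivative frozen at [p]; by strict differentiability it contracts
    by 1/2. *)
Let newton x := x - (f x - y) / d.
Let x k := iter k newton p.
Let delta := cabs (y - f p) / cabs d.

Let delta_lt : 2 * delta < rho.
Proof.
rewrite /delta mulrA ltr_pdivrMr//; have := yp; set a := cabs (y - f p); set b := cabs d.
by move=> h; rewrite mulrC [ltRHS]mulrC; move: h; rewrite ltr_pdivlMr.
Qed.

Let newton_lip u v : cabs (u - p) < rho -> cabs (v - p) < rho ->
  cabs (newton u - newton v) <= 2^-1 * cabs (u - v).
Proof.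
move=> up vp; have -> : newton u - newton v = - ((f u - f v - d * (u - v)) / d).
  by rewrite /newton; field.
rewrite cabsN cabsM cabsV ler_pdivrMr//; apply: le_trans (fp up vp) _.
by rewrite le_eqVlt; apply/orP; left; apply/eqP; ring.
Qed.

Let shrink k : 2 * delta * (1 - 2^-1 ^+ k) <= 2 * delta.
Proof.
have dl0 : 0 <= delta by rewrite divr_ge0 ?cabs_ge0.
have h0 : 0 <= 2^-1 ^+ k :> R by rewrite exprn_ge0// invr_ge0.
by have : 0 <= delta * 2^-1 ^+ k by [exact: mulr_ge0]; lra.
Qed.

Let x_ball k : cabs (x k - p) <= 2 * delta * (1 - 2^-1 ^+ k) /\
  cabs (x k.+1 - x k) <= delta * 2^-1 ^+ k.
Proof.
elim: k => [|k [IH1 IH2]].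
  rewrite /x /= subrr cabs0 expr0 subrr mulr0 mulr1; split=> //.
  have -> : newton p - p = (y - f p) / d by rewrite /newton; ring.
  by rewrite cabsM cabsV.
have h0 : 0 < 2^-1 ^+ k :> R by rewrite exprn_gt0// invr_gt0.
have dl0 : 0 <= delta by rewrite divr_ge0 ?cabs_ge0.
have B1 : cabs (x k.+1 - p) <= 2 * delta * (1 - 2^-1 ^+ k.+1).
  apply: le_trans (cabs_tri (x k) _ _) _; rewrite exprS.
  by apply: le_trans (lerD IH2 IH1) _; lra.
split=> //; have lt_rho j : cabs (x j - p) <= 2 * delta * (1 - 2^-1 ^+ j) ->
    cabs (x j - p) < rho.
  by move=> h; apply: le_lt_trans h (le_lt_trans (shrink j) delta_lt).
rewrite -[x k.+2]/(newton (x k.+1)) -[X in _ - X]/(newton (x k)).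
apply: le_trans (newton_lip (lt_rho _ B1) (lt_rho _ IH1)) _.
by rewrite exprS; lra.
Qed.

(** The iterates have steps of at most delta / 2^k and stay within 2 delta < rho of p. Their limit
    is a solution because f (x k) - y is -d times the k-th step. *)
Lemma newton_solve : exists z, [/\ cabs (z - p) < rho, f z = y &
  cabs (z - p) <= 2 / cabs d * cabs (y - f p)].
Proof.
have [z zl] := geometric_steps_cvg (fun k => (x_ball k).2).
have dl0 : 0 <= delta by rewrite divr_ge0 ?cabs_ge0.
have xp k : cabs (x k - p) <= 2 * delta.
  exact: le_trans (x_ball k).1 (shrink k).
have zp : cabs (z - p) <= 2 * delta.
  apply/ler_addgt0Pr => e e0; have [k _ /(_ k (leqnn k))] := (cvgc_cabsP _ _).1 zl _ e0.
  rewrite /= cabsC => kz; apply: le_trans (cabs_tri (x k) _ _) _.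
  by rewrite addrC lerD ?xp// ltW.
have zr : cabs (z - p) < rho by exact: le_lt_trans zp delta_lt.
exists z; split=> //; last first.
  by apply: le_trans zp _; rewrite /delta le_eqVlt; apply/orP; left; apply/eqP; ring.
apply/eqP; rewrite -subr_eq0 -cabs_eq0 eq_le cabs_ge0 andbT.
apply/ler_addgt0Pr => e e0; rewrite add0r.
(* With this tolerance [B1] and [B2] contribute e / 2 each. *)
have a_gt0 := D0; set a := cabs d in a_gt0 *; have a4 : 0 < e / (4 * a) by rewrite divr_gt0// mulr_gt0.
have [k _ Hk] := (cvgc_cabsP _ _).1 zl _ a4.
have := Hk k (leqnn k); have := Hk k.+1 (leqnSn k) => /= h1 h0.
have xr j : cabs (x j - p) < rho by exact: le_lt_trans (xp j) delta_lt.
have E : f (x k) - y = - (d * (x k.+1 - x k)).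
  by rewrite [x k.+1]/(newton (x k)) /newton; field.
have B1 : cabs (f (x k) - y) <= a * (2 * (e / (4 * a))).
  rewrite E cabsN cabsM -/a ler_pM2l//; apply: le_trans (cabs_tri z _ _) _.
  by rewrite [cabs (z - _)]cabsC; lra.
have B2 : cabs (f z - f (x k)) <= a * (2 * (e / (4 * a))).
  rewrite -(subrK (d * (z - x k)) (f z - f (x k))).
  apply: le_trans (cabsD _ _) _; rewrite [cabs (d * _)]cabsM -/a.
  apply: le_trans (lerD (fp zr (xr k)) (lexx _)) _; rewrite -/a [cabs (z - _)]cabsC.
  rewrite -mulrA -mulrDr ler_pM2l//; lra.
apply: le_trans (cabs_tri (f (x k)) _ _) _; apply: le_trans (lerD B2 B1) _.
by rewrite le_eqVlt; apply/orP; left; apply/eqP; field; rewrite gt_eqF.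
Qed.

End Solve.

(** The distance bound in [newton_solve] makes the solution [g] continuous at [f p], after which
    [sdiff_inv] applies with the roles of [f] and [g] exchanged. *)
Lemma sdiff_inverse (f : R[i] -> R[i]) p d : d != 0 -> sdiff f p d ->
  exists g : R[i] -> R[i], [/\ g (f p) = p,
    \forall y \near (f p : R[i]^o), f (g y) = y,
    \forall x \near (p : R[i]^o), g (f x) = x & sdiff g (f p) d^-1].
Proof.
move=> d0 fd; have D0 : 0 < cabs d by rewrite cabs_gt0.
have D2 : 0 < cabs d / 2 by rewrite divr_gt0.
have [rho rho0 Hr] := fd _ D2; pose r := cabs d * rho / 2.
have r0 : 0 < r by rewrite divr_gt0// mulr_gt0.
have /choice[g Hg] : forall y, exists z, cabs (y - f p) < r ->
    [/\ cabs (z - p) < rho, f z = y & cabs (z - p) <= 2 / cabs d * cabs (y - f p)].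
  move=> y; have [yr|_] := ltP (cabs (y - f p)) r; last by exists p.
  by have [z zH] := newton_solve d0 Hr yr; exists z.
have inj x x' : cabs (x - p) < rho -> cabs (x' - p) < rho -> f x = f x' -> x = x'.
  move=> xr xr' E; have := Hr _ _ xr xr'; rewrite E subrr sub0r cabsN cabsM => h.
  apply/eqP; rewrite -subr_eq0 -cabs_eq0; apply: contraT => h'.
  have : 0 < cabs (x - x') by rewrite lt0r h' cabs_ge0.
  by move: h; set b := cabs (x - x') => h b0; have : 0 < cabs d * b by [exact: mulr_gt0]; lra.
have r_p : cabs (f p - f p) < r by rewrite subrr cabs0.
have gfp : g (f p) = p.
  by have [_ _] := Hg _ r_p; rewrite subrr cabs0 mulr0 => h; apply/eqP;
    rewrite -subr_eq0 -cabs_eq0 eq_le cabs_ge0 h.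
have fg : \forall y \near (f p : R[i]^o), f (g y) = y.
  by apply/nbhs_cabsP; exists r => // y /Hg[].
have near_r : \forall x \near (p : R[i]^o), cabs (f x - f p) < r.
  by have /cvgc_nearP/(_ _ r0) := sdiff_cvg fd.
have gf : \forall x \near (p : R[i]^o), g (f x) = x.
  have [s s0 Hs] := (nbhs_cabsP _ _).1 near_r.
  apply/nbhs_cabsP; exists (Num.min s rho) => [|x]; first by rewrite lt_min s0.
  rewrite lt_min => /andP[/Hs xs xr]; have [gr fgr _] := Hg _ xs.
  exact: inj.
exists g; split=> //; apply: (sdiff_inv (g := f)) => //; last by rewrite gfp.
rewrite gfp; apply/cvgc_nearP => e e0; apply/nbhs_cabsP.
exists (Num.min r (e * cabs d / 2)); first by rewrite lt_min r0 divr_gt0// mulr_gt0.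
move=> y; rewrite lt_min => /andP[/Hg[_ _ h] h']; apply: le_lt_trans h _.
by rewrite mulrAC ltr_pdivrMr// mulrC -ltr_pdivlMr.
Qed.

End InverseFunction.

(** * Normal form of the primitives near a puncture *)

Section ConeModel.
Variables (R : realType) (q : nat) (k : R[i] -> R[i]) (rho : R).
Hypothesis rho01 : 0 < rho <= 1.
Hypothesis k_hol : forall z, cabs z < rho -> hol k z.
Hypothesis k0 : k 0 != 0.
Implicit Types (u v z : R[i]).

Let rho0 : 0 < rho. Proof. by case/andP: rho01. Qed.

Definition cone_factor z := 4 * radint q k z.
(** The integral of 4 w^q k(w^4) from 0 to u, along w = t u. Its second factor depends on u^4 only,
    so it does not notice the substitution of i u for u. *)
Definition cone_prim u := u ^+ q.+1 * cone_factor (u ^+ 4).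

Lemma cabs_expr4_lt u : cabs u < rho -> cabs (u ^+ 4) < rho.
Proof.
move=> ur; have u1 : cabs u <= 1 by case/andP: rho01 => _; exact/le_trans/ltW.
rewrite cabsX; apply: le_lt_trans ur; rewrite exprS ler_piMr ?cabs_ge0//.
by rewrite exprn_ile1 ?cabs_ge0.
Qed.

Lemma k_near_ray z : cabs z < rho -> forall t : R, 0 <= t <= 1 ->
  \forall x \near ((t%:C * z) : R[i]^o), hol k x.
Proof.
move=> zr t /andP[t0 t1]; apply/nbhs_cabsP; exists (rho - cabs z); first by rewrite subr_gt0.
move=> x xt; apply: k_hol.
have tz : cabs (t%:C * z) <= cabs z by rewrite cabsM cabs_real ger0_norm// ler_piMl ?cabs_ge0.
by have := cabs_sub x (t%:C * z); lra.
Qed.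

Lemma cone_prim_sdiff u : cabs u < rho -> sdiff cone_prim u (4 * u ^+ q * k (u ^+ 4)).
Proof.
move=> /cabs_expr4_lt/k_near_ray ku.
have s1 := sdiff_comp (sdiffX 4 (sdiff_id u)) (sdiffZ 4 (radint_sdiff ku q)).
have [d [S <-]] : exists d, sdiff cone_prim u d /\ d = 4 * u ^+ q * k (u ^+ 4); last exact: S.
eexists; split; first exact: (sdiffM (sdiffX q.+1 (sdiff_id u)) s1).
by rewrite -(radint_eq ku q) /= ![u ^+ q.+1]exprS; ring.
Qed.

Let K0 := cone_factor 0.

Lemma cone_factor0_neq0 : K0 != 0.
Proof.
have zr : cabs (0 : R[i]) < rho by rewrite cabs0.
have := radint_eq (k_near_ray zr) q; rewrite mulr0 mul0r addr0 => E.
rewrite /K0 /cone_factor mulf_neq0 ?pnatr_eq0//.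
by apply: contraNneq k0 => h; rewrite -E h mulr0.
Qed.

(* In the coordinate [V u] the primitive is a pure power; [W] inverts [V]. *)
Lemma cone_model : exists (V W : R[i] -> R[i]) (e h : R), [/\ 0 < e, 0 < h,
  forall (l : 'Z_4) u, V ('i ^+ l * u) = 'i ^+ l * V u,
  forall v, cabs v < e -> [/\ cabs (W v) <= 2 * cabs v /\ cabs (W v) < rho, V (W v) = v,
    cone_prim (W v) = K0 * v ^+ q.+1,
    forall l : 'Z_4, W ('i ^+ l * v) = 'i ^+ l * W v &
    (W : R[i] -> R[i]^o) @ (v : R[i]^o) --> (W v : R[i]^o)] &
  forall u, cabs u < h -> [/\ cabs (V u) < e, cabs (V u) <= 2 * cabs u & W (V u) = u]].
Proof.
have K00 := cone_factor0_neq0.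
have p0 : (q.+1%:R * 1 ^+ q.+1.-1 * 1 : R[i]) != 0 by rewrite expr1n !mulr1 pnatr_eq0.
(* Here [g] is the (q+1)-th root near 1. With it V u ^ (q+1) equals cone_prim u / K0 near 0, and V
   commutes with multiplication by i because [H] depends on u^4 only. *)
have [g [g1 gX _ gd]] := sdiff_inverse p0 (sdiffX q.+1 (sdiff_id (1 : R[i]))).
rewrite expr1n in g1 gX gd.
pose H u := g (cone_factor (u ^+ 4) / K0); pose V u := u * H u.
have zr : cabs (0 ^+ 4 : R[i]) < rho by rewrite expr0n cabs0.
have sK := sdiff_comp (sdiffX 4 (sdiff_id (0 : R[i]))) (sdiffZ 4 (radint_sdiff (k_near_ray zr) q)).
have sQ := sdiffZ K0^-1 sK.
have Q0 : K0^-1 * ((fun x => 4 * radint q k x) \o (fun x : R[i] => id x ^+ 4)) 0 = 1.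
  by rewrite /= expr0n /= mulVf.
have sH := sdiff_comp sQ (g := g) (b := _).
rewrite /= Q0 in sH; have {}sH := sH _ gd.
have {}sH : exists d, sdiff H 0 d.
  eexists; apply: sdiff_eq sH => u; rewrite /H /= /cone_factor; congr g.
  by rewrite mulrC.
have [d dH] := sH.
have H0 : H 0 = 1 by rewrite /H expr0n /= divff.
have sV : sdiff V 0 1.
  have [d' [S <-]] : exists d', sdiff V 0 d' /\ d' = 1; last exact: S.
  eexists; split; first exact: (sdiffM (sdiff_id (0 : R[i])) dH).
  by rewrite H0 /=; ring.
have V0 : V 0 = 0 by rewrite /V mul0r.
have [W [W0 VW WV sW]] := sdiff_inverse (oner_neq0 _) sV.
rewrite V0 in W0 VW sW; rewrite invr1 in sW.
have Vrot (l : 'Z_4) u : V ('i ^+ l * u) = 'i ^+ l * V u.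
  rewrite /V /H exprMn -exprM mulnC exprM.
  have -> : ('i : R[i]) ^+ 4 = 1 by rewrite (exprM _ 2 2) sqr_i sqrrN expr1n.
  by rewrite expr1n mul1r mulrA.
have Vpow : \forall u \near (0 : R[i]^o), cone_prim u = K0 * V u ^+ q.+1.
  have cQ := sdiff_cvg sQ; rewrite Q0 in cQ.
  have [r r0 Hr] := (nbhs_cabsP _ _).1 (cQ _ gX).
  apply/nbhs_cabsP; exists r => // u ur.
  have gE : g (cone_factor (u ^+ 4) / K0) ^+ q.+1 = cone_factor (u ^+ 4) / K0.
    by rewrite [cone_factor _ / _]mulrC; exact: Hr ur.
  by rewrite /V exprMn /H gE mulrCA [K0 * _]mulrC divfK.
have [r1 r10 Hr1] := (nbhs_cabsP _ _).1 (filterI Vpow WV).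
have [r2 r20 Hr2] := (nbhs_cabsP _ _).1 VW.
have [r3 r30 Hr3] := sdiff_lip sW; have [r4 r40 Hr4] := sdiff_lip sV.
rewrite !cabs1 in Hr3 Hr4.
pose e := Num.min (Num.min r2 r3) (Num.min (r1 / 2) (rho / 2)).
have e0 : 0 < e by rewrite !lt_min r20 r30 !divr_gt0.
pose h := Num.min (Num.min r1 r4) (e / 2).
have h0 : 0 < h by rewrite !lt_min r10 r40 divr_gt0.
have Wle v : cabs v < e -> cabs (W v) <= 2 * cabs v.
  rewrite !lt_min => /andP[/andP[v2 v3] _].
  have := Hr3 v 0; rewrite W0 !subr0 cabs0 => /(_ v3 r30).
  by rewrite (_ : 1 + 1 = 2).
exists V, W, e, h; split=> //.
  move=> v ve; have Wv := Wle v ve.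
  have := ve; rewrite !lt_min => /andP[/andP[v2 v3] /andP[v1 vr]].
  have W1 : cabs (W v) < r1 by lra.
  have VWv : V (W v) = v by apply: Hr2; rewrite subr0.
  split=> //.
  - by split=> //; lra.
  - by have [|-> _] := Hr1 (W v); rewrite ?subr0// VWv.
  - move=> l; have [|_] := Hr1 ('i ^+ l * W v).
      by rewrite subr0 cabsM cabsX cabs_i expr1n mul1r.
    by rewrite Vrot VWv.
  - apply/cvgc_nearP => d0 d00; apply/nbhs_cabsP.
    exists (Num.min (r3 - cabs v) (d0 / 2)) => [|w].
      by rewrite lt_min subr_gt0 v3 divr_gt0.
    rewrite lt_min => /andP[w3 wd]; apply: le_lt_trans (Hr3 _ _ _ _) _; rewrite ?subr0//.
      by have := cabs_sub w v; lra.
    by lra.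
move=> u uh; have /andP[/andP[u1 u4] ue] :
    (cabs u < r1) && (cabs u < r4) && (cabs u < e / 2) by rewrite -!lt_min.
have Vu : cabs (V u) <= 2 * cabs u.
  have := Hr4 u 0; rewrite V0 !subr0 cabs0 => /(_ u4 r40).
  by rewrite (_ : 1 + 1 = 2).
split=> //; last by have [|_ ->] := Hr1 u; rewrite ?subr0.
by apply: le_lt_trans Vu _; rewrite mulrC -ltr_pdivlMr.
Qed.

End ConeModel.

Section PolarRoot.
Variable R : realType.
Implicit Types (s t : R).

Lemma cisX t n : cis t ^+ n = cis (n%:R * t) :> R[i].
Proof.
elim: n => [|n IH]; first by rewrite mul0r cis0.
by rewrite exprS IH -cisD -natr1 mulrDl mul1r addrC.
Qed.

Lemma cis_period (k : int) : cis (2 * pi * k%:~R) = 1 :> R[i].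
Proof.
have N (l : nat) : cis (2 * pi * l%:R) = 1 :> R[i].
  by rewrite mulrC -cisX cis2pi expr1n.
case: k => l; first exact: N.
have := cisD (2 * pi * l.+1%:R : R) (2 * pi * (Negz l)%:~R).
by rewrite NegzE mulrNz -pmulrn mulrN subrr cis0 N mul1r => <-.
Qed.

Lemma cis_eq1 (x : R) : cis x = 1 -> exists k : int, x = 2 * pi * k%:~R.
Proof.
move=> x1; have p0 := pi_gt0 R; have pp : 0 < 2 * pi :> R by rewrite mulr_gt0.
pose k := Num.floor (x / (2 * pi)); exists k.
have /andP[k1 k2] := floor_itv (x / (2 * pi)); rewrite -/k in k1 k2.
pose y := x - 2 * pi * k%:~R.
have y0 : 0 <= y by rewrite subr_ge0 mulrC -ler_pdivlMr.
have y1 : y < 2 * pi.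
  by rewrite ltrBlDr -[X in X + _]mulr1 -mulrDr mulrC -ltr_pdivrMr// addrC -intrD1.
have cy : cis y = 1.
  have := cisD y (2 * pi * k%:~R); rewrite subrK x1 cis_period mulr1; exact: esym.
have cos1 : cos y = 1 by have := congr1 (@complex.Re R) cy.
suff : y = 0 by move=> /eqP; rewrite subr_eq0 => /eqP.
have [yp|yp] := leP y pi.
  by apply: cos_inj; rewrite ?cos1 ?cos0// in_itv /= ?lexx ?y0// ltW.
have cosE : cos (2 * pi - y) = 1 by rewrite addrC mulr_natl cosD2pi cosN.
have : 2 * pi - y = 0.
  apply: cos_inj; rewrite ?in_itv /= ?lexx ?(ltW p0)//; last by rewrite cos0.
  by apply/andP; split; lra.
by lra.
Qed.

Lemma cis_pihalf (k : nat) : cis (k%:R * (pi / 2)) = 'i ^+ k :> R[i].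
Proof. by rewrite -cisX /cis cos_pihalf sin_pihalf. Qed.

Variables (kap : R) (q : nat).
Hypothesis kap0 : 0 < kap.
Implicit Types x y : R * R.
Let p : R := q.+1%:R.
Let p0 : 0 < p. Proof. by rewrite ltr0n. Qed.

(** A (q+1)-th root of (x.1 / kap) e^(i x.2) as a function of polar coordinates; the angle ranges
    over the whole real line, so there is no cut. *)
Definition polar_root (x : R * R) : R[i] :=
  (expR (ln (x.1 / kap) / q.+1%:R))%:C * cis (x.2 / q.+1%:R).

Lemma cabs_polar_root x : cabs (polar_root x) = expR (ln (x.1 / kap) / p).
Proof. by rewrite cabsM cabs_cis mulr1 cabs_real ger0_norm ?expR_ge0. Qed.

Lemma polar_root_neq0 x : polar_root x != 0.
Proof. by rewrite -cabs_gt0 cabs_polar_root expR_gt0. Qed.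

Lemma expR_lnX s : 0 < s -> expR (ln (s / kap) / p) ^+ q.+1 = s / kap.
Proof.
by move=> s0; rewrite -expRM_natl mulrC divfK ?gt_eqF// lnK// posrE divr_gt0.
Qed.

Lemma polar_rootX x : 0 < x.1 ->
  polar_root x ^+ q.+1 = (x.1 / kap)%:C * cis x.2.
Proof.
by move=> x0; rewrite exprMn cisX -rmorphXn /= expR_lnX// [q.+1%:R * _]mulrC divfK//.
Qed.

Lemma polar_root_lt (e s t : R) : 0 < e -> 0 < s < kap * e ^+ q.+1 ->
  cabs (polar_root (s, t)) < e.
Proof.
move=> e0 /andP[s0 se]; rewrite cabs_polar_root -(@ltr_pXn2r _ q.+1)// ?nnegrE ?expR_ge0 ?(ltW e0)//.
by rewrite expR_lnX// ltr_pdivrMr// mulrC.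
Qed.

Lemma polar_root_surj (e : R) (v : R[i]) : v != 0 -> cabs v < e ->
  exists2 x, 0 < x.1 < kap * e ^+ q.+1 & polar_root x = v.
Proof.
move=> v0 ve; have [t tE] := polar_ex v; have c0 : 0 < cabs v by rewrite cabs_gt0.
have s0 : 0 < kap * cabs v ^+ q.+1 by rewrite mulr_gt0// exprn_gt0.
exists (kap * cabs v ^+ q.+1, p * t).
  by rewrite s0/= ltr_pM2l// ltr_pXn2r// nnegrE ?cabs_ge0// ltW// (lt_trans c0).
rewrite /polar_root /= [p * t]mulrC mulfK ?gt_eqF// [RHS]tE; congr (_%:C * _).
apply: (@pexpIrn _ q.+1); rewrite ?nnegrE ?expR_ge0 ?cabs_ge0//.
by rewrite expR_lnX// mulrAC mulfV ?mul1r// gt_eqF.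
Qed.

Lemma polar_root_cvg (x : R * R) : 0 < x.1 ->
  (polar_root : R * R -> R[i]^o) @ x --> (polar_root x : R[i]^o).
Proof.
move=> x0; have f1 : (fun y : R * R => y.1) @ x --> x.1 by exact: cvg_fst.
have f2 : (fun y : R * R => y.2) @ x --> x.2 by exact: cvg_snd.
have k1 : (fun y : R * R => y.1 / kap) @ x --> x.1 / kap by exact: cvgMl f1.
have l1 : (fun y : R * R => ln (y.1 / kap)) @ x --> ln (x.1 / kap).
  by apply: (cvg_comp _ (@ln R) k1); apply: continuous_ln; rewrite divr_gt0.
have l2 : (fun y : R * R => ln (y.1 / kap) / p) @ x --> ln (x.1 / kap) / p by exact: cvgMl l1.
have e1 : (fun y : R * R => expR (ln (y.1 / kap) / p)) @ x --> expR (ln (x.1 / kap) / p).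
  by apply: (cvg_comp _ (@expR R) l2); exact: continuous_expR.
have c1 : (fun y : R * R => y.2 / p) @ x --> x.2 / p by exact: cvgMl f2.
exact: (cvgcM (cvgc_real e1) (cvg_cis c1)).
Qed.

(** Adding (q+1) pi/2 to the angle multiplies the root by i. Identifying roots up to powers of i
    therefore gives exactly the cone of total angle (q+1) pi/2. *)
Lemma polar_root_eq x y : 0 < x.1 -> 0 < y.1 ->
  (exists l : 'Z_4, polar_root x = 'i ^+ l * polar_root y) <->
  x.1 = y.1 /\ exists k : int, x.2 = y.2 + k%:~R * (p * (pi / 2)).
Proof.
move=> x0 y0; split=> [[l xy]|[xy1 [k xy2]]].
  have c : cabs (polar_root x) = cabs (polar_root y).
    by rewrite xy cabsM cabsX cabs_i expr1n mul1r.
  have e1 : expR (ln (x.1 / kap) / p) = expR (ln (y.1 / kap) / p).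
    by rewrite -!cabs_polar_root.
  have xy1 : x.1 = y.1.
    have := congr1 (fun u => u ^+ q.+1) e1; rewrite !expR_lnX// => /(mulIf _); apply.
    by rewrite invr_eq0 gt_eqF.
  split=> //; have E0 : (expR (ln (y.1 / kap) / p))%:C != 0 :> R[i].
    by apply: real_neq0; rewrite gt_eqF ?expR_gt0.
  have : cis (x.2 / p) = cis (y.2 / p + l%:R * (pi / 2)) :> R[i].
    apply: (mulfI E0); rewrite cisD cis_pihalf mulrA [RHS]mulrC.
    by move: xy; rewrite /polar_root xy1; exact.
  move=> h; have /cis_eq1[k kE] : cis (x.2 / p - (y.2 / p + l%:R * (pi / 2))) = 1.
    apply: (mulIf (cis_neq0 (y.2 / p + l%:R * (pi / 2)))).
    by rewrite -cisD subrK mul1r.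
  exists (l%:Z + 4 * k); rewrite rmorphD rmorphM /=.
  have -> : x.2 = p * (x.2 / p) by rewrite mulrC divfK// gt_eqF.
  have -> : x.2 / p = y.2 / p + l%:R * (pi / 2) + 2 * pi * k%:~R by rewrite -kE; ring.
  by field; rewrite gt_eqF.
have [l lE] : exists l : 'Z_4, cis (k%:~R * (pi / 2)) = 'i ^+ l :> R[i].
  exists (k%:~R); rewrite -exprz_i; case: k {xy2} => j; first exact: cis_pihalf.
  have h := cis_pihalf j.+1; rewrite NegzE mulrNz mulNr -exprnN.
  apply: (mulIf (_ : 'i ^+ j.+1 != 0)); first by rewrite expf_neq0// i_neq0.
  rewrite mulVf ?expf_neq0 ?i_neq0// -h -cisD addrC subrr; exact: cis0.
exists l; rewrite /polar_root xy1 xy2 -lE.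
have -> : (y.2 + k%:~R * (p * (pi / 2))) / p = y.2 / p + k%:~R * (pi / 2).
  by field; rewrite gt_eqF.
by rewrite cisD mulrA mulrC.
Qed.

End PolarRoot.

Lemma norm_chart_factor (R : realType) (l : 'Z_4) (k : R[i]) : k != 0 ->
  `|'i ^+ l * k / (cabs k)%:C| = 1.
Proof.
rewrite -cabs_gt0 => k0; rewrite normc_cabs cabsM cabsV cabs_real gtr0_norm//.
by rewrite cabsM cabsX cabs_i expr1n mul1r divff// gt_eqF.
Qed.

Lemma mul_chart_value (F : fieldType) (a b d e f g h : F) :
  a * (b * (d * (e * f * g))) + h = a * (b * d) * f * (e * g) + h.
Proof. by ring. Qed.

Section ConeAngle.
Variables (R : realType) (n : nat) (c : 'I_n -> S2 R) (m : 'I_n -> int).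
Variable B : 'M[R]_3.
Hypothesis gB : generic_frame c B.
Hypothesis m_sum : \sum_i m i = -8.
Implicit Types (x : S2 R) (z w u v : R[i]).

Local Notation ainv := (cinv c B).
Local Notation apos := (cpos c B).
Local Notation unst := (unstereo (sB gB)).

Lemma denSop_unstereo z : z != 0 -> denS (Bop B) (unst z) != 0.
Proof.
move=> z0; have [_ _ E2] := crd_flip B (unst z); rewrite /denS E2.
have [_ _ ->] := crd_unstereo (sB gB) z; have d0 := onecabs_gt0 z.
have -> : 1 - (1 - cabs z ^+ 2) / (1 + cabs z ^+ 2) =
  2 * cabs z ^+ 2 / (1 + cabs z ^+ 2) by field; rewrite gt_eqF.
by rewrite mulf_neq0 ?invr_eq0 ?gt_eqF// mulr_gt0// exprn_gt0// cabs_gt0.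
Qed.

(** The computation of [dprimN4], but compared with the rational function itself, which makes sense
    on the cuts of the first chart as well. *)
Lemma dprimN_pow4 z : z != 0 -> Omega apos z^-1 ->
  dprimN c m B z ^+ 4 = \prod_i (1 - ainv i * z) ^ m i.
Proof.
move=> z0 O1; rewrite /dprimN !exprMn scale4E hfun4//.
have -> : (- z ^- 2) ^+ 4 = \prod_i z ^ m i.
  by rewrite (prod_exprz m_sum)// exprNn -signr_odd mul1r exprVn -exprM.
rewrite -!big_split /=; apply: eq_bigr => i _.
rewrite -!expfzMl; congr (_ ^ _); rewrite /cinv; field.
by rewrite z0 (cpos_neq0 gB).
Qed.

Lemma near_neq0 z : z != 0 -> \forall w \near (z : R[i]^o), w != 0.
Proof.
move=> z0; apply/nbhs_cabsP; exists (cabs z); first by rewrite cabs_gt0.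
by move=> w; apply: contraTneq => ->; rewrite sub0r cabsN ltxx.
Qed.

(** Makes the two charts interchangeable at a cone point: all that is kept of a chart is the fourth
    power of its derivative. *)
Lemma chart_unstereo z : z != 0 -> ~ range c (unst z) ->
  exists f (F F' : R[i] -> R[i]), [/\ [set chartS c m B; chartN c m B] f,
    chart_dom f (unst z),
    \forall w \near (z : R[i]^o), f (unst w) = F w,
    \forall w \near (z : R[i]^o), sdiff F w (F' w) &
    \forall w \near (z : R[i]^o), F' w ^+ 4 = \prod_i (1 - ainv i * w) ^ m i].
Proof.
move=> z0 zc; have [S|N] := regSN_cover gB zc.
  have Oz : Omega ainv z by case: (S); rewrite unstereoK.
  exists (chartS c m B), (primS c m B), (hfun ainv m); split=> //.
  - by left.
  - apply/nbhs_cabsP; exists 1 => [|w _]; first exact: ltr01.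
    rewrite -[LHS]/(primS c m B (stereo B (unst w))); congr (primS c m B _).
    exact: unstereoK.
  - exact: Fprim_near.
  - have [r r0 Hr] := (nbhs_cabsP _ _).1 (Omega_near Oz).
    by apply/nbhs_cabsP; exists r => // w /Hr; exact: hfun4.
have sE w : w != 0 -> stereo (Bop B) (unst w) = w^-1.
  move=> w0; have [_ ->] := stereo_op gB (denS_unstereo_neq0 (sB gB) w) (denSop_unstereo w0).
  by rewrite unstereoK.
have Oz : Omega apos z^-1 by case: (N); rewrite sE.
exists (chartN c m B), (fun w => primN c m B w^-1), (dprimN c m B); split=> //.
- by right.
- have [r r0 Hr] := (nbhs_cabsP _ _).1 (near_neq0 z0).
  apply/nbhs_cabsP; exists r => [//|w /Hr w0].
  rewrite -[LHS]/(primN c m B (stereo (Bop B) (unst w))); congr (primN c m B _).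
  exact: sE.
- have [r r0 Hr] := (nbhs_cabsP _ _).1 (near_Omega_inv z0 Oz).
  by apply/nbhs_cabsP; exists r => // w /Hr[w0 Ow]; exact: primN_inv_sdiff.
- have [r r0 Hr] := (nbhs_cabsP _ _).1 (near_Omega_inv z0 Oz).
  by apply/nbhs_cabsP; exists r => // w /Hr[w0 Ow]; exact: dprimN_pow4.
Qed.

Section Puncture.
Variable i : 'I_n.
Variable q : nat.
Hypothesis mi : m i = q%:Z - 3.

Let b j : R[i] := ainv j * apos i.
(* the other factors, in the coordinate [s = 1 - z / apos i] *)
Let kf s := \prod_(j | j != i) root4 (1 - b j * (1 - s)) ^ m j.
(* a fourth root of the coordinate [s] uniformizes all charts at the puncture *)
Let pos u := (1 - u ^+ 4) * apos i.

Let ai : ainv i * apos i = 1. Proof. by rewrite /cinv mulVf// (cpos_neq0 gB). Qed.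

Let factor_pos j u : 1 - ainv j * pos u = 1 - b j * (1 - u ^+ 4).
Proof. by rewrite /pos /b; ring. Qed.

Let slit0 j : j != i -> slit (1 - b j * (1 - 0)).
Proof.
move=> ji; rewrite subr0 mulr1.
have b0 : b j != 0 by rewrite mulf_neq0 ?(cinv_neq0 gB) ?(cpos_neq0 gB).
have : slit (- b j) by case: gB => _ _; apply; rewrite eq_sym.
by rewrite (slit_split b0) => /andP[].
Qed.

Let hol_factor j s : hol (fun s => 1 - b j * (1 - s)) s.
Proof.
apply: holD; first exact: hol_cst.
have := hol_linear_form (b j) (1 - s) => h.
have h1 : hol (fun s => 1 - s) s.
  exists (0 + (- 1) * 1); apply: sdiff_eq (sdiffD (sdiff_cst 1 s) (sdiffZ (- 1) (sdiff_id s))) => t.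
  by rewrite mulN1r.
exact: (hol_comp h1 h).
Qed.

(** The bound rho <= 1 ensures |u^4| < rho whenever |u| < rho. *)
Lemma puncture_radius : exists2 rho : R, 0 < rho <= 1 &
  forall s, cabs s < rho -> forall j, j != i -> slit (1 - b j * (1 - s)).
Proof.
have N : \forall s \near (0 : R[i]^o), forall j, j != i -> slit (1 - b j * (1 - s)).
  apply: (@filter_forall _ _ (fun j s => j != i -> slit (1 - b j * (1 - s)))
    (nbhs (0 : R[i]^o)) _) => j.
  have [->|ji] := eqVneq j i; first by apply/nbhs_cabsP; exists 1 => // w _ /=.
  have [r r0 H] := (nbhs_cabsP _ _).1 (hol_cvg (hol_factor j 0) (slit_open (slit0 ji))).
  by apply/nbhs_cabsP; exists r => // w wr _; exact: H.
have [r r0 H] := (nbhs_cabsP _ _).1 N.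
exists (Num.min r 1); first by rewrite lt_min r0 ltr01 ge_min lexx orbT.
by move=> s; rewrite lt_min => /andP[sr _]; apply: H; rewrite subr0.
Qed.

Section Radius.
Variable rho : R.
Hypothesis rho01 : 0 < rho <= 1.
Hypothesis rhoP : forall s, cabs s < rho -> forall j, j != i -> slit (1 - b j * (1 - s)).

Let kf_hol s : cabs s < rho -> hol kf s.
Proof.
move=> sr; apply: hol_prod => j ji.
apply: (hol_exprz (f := root4 \o (fun s => 1 - b j * (1 - s)))).
  exact/root4_neq0/rhoP.
by apply: hol_root4; [exact: rhoP|exact: hol_factor].
Qed.

Let kf_neq0 s : cabs s < rho -> kf s != 0.
Proof.
move=> sr; apply/prodf_neq0 => j ji; rewrite expfz_neq0//.
exact/root4_neq0/rhoP.
Qed.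

Let kf4 s : cabs s < rho -> kf s ^+ 4 = \prod_(j | j != i) (1 - b j * (1 - s)) ^ m j.
Proof.
move=> sr; rewrite -prodrXl; apply: eq_bigr => j ji.
by rewrite exprz_exp4 root4K//; exact: rhoP.
Qed.

Let kf00 : kf 0 != 0. Proof. by apply: kf_neq0; rewrite cabs0; case/andP: rho01. Qed.

Let pos_neq0 u : cabs u < rho -> pos u != 0.
Proof.
move=> /(cabs_expr4_lt rho01) ur; rewrite mulf_neq0 ?(cpos_neq0 gB)// subr_eq0.
apply: contraTneq ur => <-; rewrite cabs1 -leNgt; by case/andP: rho01.
Qed.

Let pos_punctured u : cabs u < rho -> u != 0 -> ~ range c (unst (pos u)).
Proof.
move=> ur u0 [j _ jE].
have E : apos j = pos u by rewrite -[RHS](unstereoK (sB gB)) -jE.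
have [ji|ji] := eqVneq j i.
  have := congr1 (fun w => ainv i * w) E; rewrite ji ai /pos mulrCA ai mulr1 => h.
  have : u ^+ 4 = 0 by rewrite -[LHS]opprK -(addKr 1 (- u ^+ 4)) -h addNr oppr0.
  by move=> /eqP; rewrite expf_eq0 (negbTE u0).
have := rhoP (cabs_expr4_lt rho01 ur) ji.
by rewrite -factor_pos -E /cinv mulVf ?(cpos_neq0 gB)// subrr not_slit0.
Qed.

Let pos_sdiff u : sdiff pos u (- (4 * u ^+ 3) * apos i).
Proof.
have [d [S <-]] : exists d, sdiff pos u d /\ d = - (4 * u ^+ 3) * apos i; last exact: S.
eexists; split.
  apply: (@sdiff_eq _ (fun w => (1 + (-1) * w ^+ 4) * apos i)).
    by move=> w; rewrite /pos mulN1r.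
  exact: (sdiffM (sdiffD (sdiff_cst 1 u) (sdiffZ (-1) (sdiffX 4 (sdiff_id u)))) (sdiff_cst (apos i) u)).
by rewrite /=; ring.
Qed.

(** In the coordinate u, the fourth power of the derivative of a chart is (4 apos_i)^4 u^(4 m_i +
    12) kf(u^4)^4. Since q = m_i + 3, this is the fourth power of the derivative of apos_i times
    [cone_prim], and [primitive_uniq] applies. *)
Lemma chart_at_root u0 : cabs u0 < rho -> u0 != 0 -> exists f (l : 'Z_4) (t : R[i]),
  [/\ [set chartS c m B; chartN c m B] f, chart_dom f (unst (pos u0)) &
    \forall u \near (u0 : R[i]^o),
      f (unst (pos u)) = 'i ^+ l * (apos i * cone_prim q kf u) + t].
Proof.
move=> ur u00; have pc := sdiff_cvg (pos_sdiff u0).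
have [f [F [F' [Af fd fF sF F4]]]] := chart_unstereo (pos_neq0 ur) (pos_punctured ur u00).
have near_rho : \forall u \near (u0 : R[i]^o), cabs u < rho.
  apply/nbhs_cabsP; exists (rho - cabs u0); first by rewrite subr_gt0.
  by move=> u; have := cabs_sub u u0; lra.
have N4 : \forall u \near (u0 : R[i]^o),
    F' (pos u) ^+ 4 = \prod_i (1 - ainv i * pos u) ^ m i by exact: (pc _ F4).
have NF : \forall u \near (u0 : R[i]^o), f (unst (pos u)) = F (pos u) by exact: (pc _ fF).
have NS : \forall u \near (u0 : R[i]^o), sdiff F (pos u) (F' (pos u)) by exact: (pc _ sF).
pose G' u := apos i * (4 * u ^+ q * kf (u ^+ 4)).
have [||||l [_ [t tE]]] := @primitive_uniq R (F \o pos)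
  (fun u => F' (pos u) * (- (4 * u ^+ 3) * apos i)) (fun u => apos i * cone_prim q kf u) G' u0.
- have [r r0 Hr] := (nbhs_cabsP _ _).1 NS.
  apply/nbhs_cabsP; exists r => [//|u /Hr Fu].
  exact: (sdiff_comp (pos_sdiff u) Fu).
- have [r r0 Hr] := (nbhs_cabsP _ _).1 near_rho.
  apply/nbhs_cabsP; exists r => [//|u /Hr us].
  exact: (sdiffZ (apos i) (cone_prim_sdiff q rho01 kf_hol us)).
- have [r r0 Hr] := (nbhs_cabsP _ _).1 (filterI N4 (filterI near_rho (near_neq0 u00))).
  apply/nbhs_cabsP; exists r => [//|u /Hr[Fu [us u_neq0]]].
  have u4 : u ^+ 4 != 0 by rewrite expf_neq0.
  have {}Fu : F' (pos u) ^+ 4 = (u ^+ 4) ^ m i * kf (u ^+ 4) ^+ 4.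
    rewrite kf4 ?(cabs_expr4_lt rho01)//; apply: etrans Fu _.
    rewrite (bigD1 i)//= factor_pos; congr (_ ^ _ * _).
      by rewrite /b ai; ring.
    by apply: eq_bigr => j _; rewrite factor_pos.
  have hX : (u ^+ 4) ^ m i * (u ^+ 4) ^+ 3 = (u ^+ 4) ^+ q.
    by rewrite -[_ ^+ 3]/((u ^+ 4) ^ 3%:Z) -expfzDr// mi subrK.
  rewrite exprMn Fu /G' !exprMn -[(u ^+ q) ^+ 4]exprM mulnC exprM -hX.
  by set X := (u ^+ 4) ^ m i; set Y := kf _; ring.
- have k0 := kf_neq0 (cabs_expr4_lt rho01 ur).
  have e0 : u0 ^+ q != 0 by rewrite expf_neq0.
  by rewrite /G' mulf_neq0 ?(cpos_neq0 gB)// mulf_neq0// mulf_neq0// pnatr_eq0.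
exists f, l, t; split=> //.
have [r r0 Hr] := (nbhs_cabsP _ _).1 (filterI tE NF).
by apply/nbhs_cabsP; exists r => [//|u /Hr[<- ->]].
Qed.

Lemma puncture_cone_angle_radius :
  has_cone_angle [set chartS c m B; chartN c m B] (c i) (q.+1%:R * (pi / 2)).
Proof.
have K00 := cone_factor0_neq0 q rho01 kf_hol kf00; set K0 := cone_factor q kf 0 in K00.
have [V [W [e [h [e0 h0 Vrot Wv Vu]]]]] := cone_model q rho01 kf_hol kf00.
rewrite -/K0 in Wv.
(* A chart is i^l apos_i K0 v^(q+1) + t in the coordinate v = V u. Dividing the radius by [kap]
   inside the root leaves a factor of absolute value 1, so that [P] is an isometry. *)
pose kap := cabs (apos i * K0).
have kap0 : 0 < kap by rewrite cabs_gt0 mulf_neq0 ?(cpos_neq0 gB).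
have kapc : kap%:C != 0 :> R[i] by apply: real_neq0; rewrite gt_eqF.
pose pr := polar_root kap q; pose P (x : R * R) : S2 R := unst (pos (W (pr x))).
have W0 v : cabs v < e -> v != 0 -> W v != 0.
  move=> /Wv[_ _ Wp _ _] v0; apply: contraTneq isT => h1; move: Wp.
  rewrite h1 /cone_prim expr0n /= mul0r => /esym/eqP.
  by rewrite mulf_eq0 (negbTE K00) expf_eq0 (negbTE v0).
have pr_e (x : R * R) : 0 < x.1 < kap * e ^+ q.+1 -> cabs (pr x) < e.
  by case: x => s t /= st; exact: polar_root_lt.
have PW_cvg (x : R * R) : 0 < x.1 < kap * e ^+ q.+1 ->
    ((fun y => W (pr y)) : R * R -> R[i]^o) @ x --> (W (pr x) : R[i]^o).
  move=> xD; have [_ _ _ _ cW] := Wv _ (pr_e x xD).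
  have cp : (pr : R * R -> R[i]^o) @ x --> (pr x : R[i]^o).
    by apply: polar_root_cvg => //; case/andP: xD.
  exact: (cvg_comp (pr : R * R -> R[i]^o) (W : R[i]^o -> R[i]^o) cp cW).
have E0 : 0 < kap * e ^+ q.+1 by rewrite mulr_gt0// exprn_gt0.
split; first by rewrite mulr_gt0 ?divr_gt0 ?pi_gt0.
exists (kap * e ^+ q.+1), P => D; split=> //.
- move=> x xD; have cp := sdiff_cvg (pos_sdiff (W (pr x))).
  have H := cvg_comp (fun y => W (pr y) : R[i]^o) (pos : R[i]^o -> R[i]^o) (PW_cvg x xD) cp.
  exact: (unstereo_cvg H).
- move=> x y xD yD; have /andP[x0 _] := xD; have /andP[y0 _] := yD.
  apply: iff_trans (polar_root_eq q kap0 x0 y0).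
  have [_ VWx _ _ _] := Wv _ (pr_e x xD); have [_ VWy _ Wroty _] := Wv _ (pr_e y yD).
  (* Equal points have equal u^4, so the values of W differ by a power of i. As V and W commute with
     i, this is equivalent to the same relation between the polar roots. *)
  split=> [Pxy|[l lE]].
    have p4 : W (pr x) ^+ 4 = W (pr y) ^+ 4.
      have := congr1 (stereo B) Pxy; rewrite !unstereoK => /(mulIf (cpos_neq0 gB i)) E.
      by apply: oppr_inj; apply: (addrI 1).
    have [l lE] := expr4_eq p4; exists l; rewrite -/(pr x) -/(pr y) -[LHS]VWx lE Vrot.
    by rewrite VWy.
  rewrite /P /pr lE -/(pr y) Wroty /pos exprMn -exprM mulnC exprM.
  have -> : ('i : R[i]) ^+ 4 = 1 by rewrite (exprM _ 2 2) sqr_i sqrrN expr1n.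
  by rewrite expr1n mul1r.
- split.
    have D0 : denS B (c i) != 0 by case: gB => _ /(_ i)[].
    have h4 : 0 < h ^+ 4 by rewrite exprn_gt0.
    have hl : hol (fun w => 1 - ainv i * w) (apos i) by exact: hol_slit_factor.
    have N1 : \forall w \near (apos i : R[i]^o), cabs (1 - ainv i * w) < h ^+ 4.
      have H0 := (cvgc_nearP _ _ _).1 (hol_cvg hl) _ h4.
      have [r r0 Hr] := (nbhs_cabsP _ _).1 H0; apply/nbhs_cabsP; exists r => [//|w /Hr].
      by rewrite ai subrr subr0.
    have N2 : \forall x \near c i, cabs (1 - ainv i * stereo B x) < h ^+ 4.
      exact: (stereo_cvg D0 N1).
    have N3 := denS_near (sB gB) D0.
    apply: filterS2 N2 N3 => x xh Dx.
    (* Any fourth root will do. It is 0 only at the puncture, and otherwise V u is a polar root. *)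
    pose u := sqrtc (sqrtc (1 - ainv i * stereo B x)).
    have u4 : u ^+ 4 = 1 - ainv i * stereo B x by rewrite (exprM _ 2 2) !sqr_sqrtc.
    have xE : pos u = stereo B x.
      rewrite /pos u4; transitivity ((ainv i * apos i) * stereo B x); first by ring.
      by rewrite ai mul1r.
    have [u0|u0] := eqVneq u 0.
      left; apply: (stereo_inj (sB gB)) => //.
      by rewrite -xE u0 /pos expr0n subr0 mul1r.
    have uh : cabs u < h.
      by rewrite -(@ltr_pXn2r _ 4)// ?nnegrE ?cabs_ge0 ?(ltW h0)// -cabsX u4.
    have [Ve _ WVu] := Vu _ uh.
    have V0 : V u != 0.
      apply: contra_neq u0 => V0; have z0 : cabs (0 : R[i]) < e by rewrite cabs0.
      have [[W00 _] _ _ _ _] := Wv _ z0; rewrite -WVu V0; apply/eqP.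
      by rewrite -cabs_eq0 eq_le cabs_ge0 andbT; move: W00; rewrite cabs0 mulr0.
    have [y yD yE] := polar_root_surj q kap0 V0 Ve.
    right; exists y => //.
    by rewrite /P /pr yE WVu xE stereoK.
  move=> V0 nV0.
  have pos0 : pos 0 = apos i by rewrite /pos expr0n subr0 mul1r.
  have D0 : denS B (c i) != 0 by case: gB => _ /(_ i)[].
  have cu : (fun u => unst (pos u)) @ (0 : R[i]^o) --> c i.
    have <- : unst (pos 0) = c i by rewrite pos0; exact: stereoK.
    exact: (unstereo_cvg (sdiff_cvg (pos_sdiff 0))).
  have [d d0 Hd] := (nbhs_cabsP _ _).1 (cu _ nV0).
  (* The map W at most doubles absolute values. *)
  pose e1 := Num.min e (d / 2); have e10 : 0 < e1 by rewrite lt_min e0 divr_gt0.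
  have E1 : 0 < kap * e1 ^+ q.+1 by rewrite mulr_gt0// exprn_gt0.
  near=> r => a.
  have ra : cabs (pr (r, a)) < e1.
    by apply: polar_root_lt => //; apply/andP; split; near: r;
      [exact: nbhs_right_gt|exact: nbhs_right_lt].
  move: ra; rewrite lt_min => /andP[re rd]; have [[Wr _] _ _ _ _] := Wv _ re.
  apply: Hd; rewrite subr0; apply: le_lt_trans Wr _.
  by rewrite mulrC -ltr_pdivlMr.
- move=> x xD; have xe := pr_e x xD; have [[_ Wrho] _ _ _ _] := Wv _ xe.
  have Wx0 := W0 _ xe (polar_root_neq0 _ _ x).
  have [f [l [t [Af fd fE]]]] := chart_at_root Wrho Wx0.
  exists f; split=> //; exists ('i ^+ l * (apos i * K0) / kap%:C), t; split.
    by apply: norm_chart_factor; rewrite mulf_neq0// (cpos_neq0 gB).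
  have nD : \forall y \near x, 0 < y.1 < kap * e ^+ q.+1.
    have /andP[x0 x1] := xD; have c1 : (fun y : R * R => y.1) @ x --> x.1 by exact: cvg_fst.
    have G1 : \forall y \near x, 0 < y.1 by exact: (cvgr_gt x.1 c1 0 x0).
    have G2 : \forall y \near x, y.1 < kap * e ^+ q.+1 by exact: (cvgr_lt x.1 c1 _ x1).
    by apply: filterS2 G1 G2 => y -> ->.
  have NE : \forall y \near x, f (P y) = 'i ^+ l * (apos i * cone_prim q kf (W (pr y))) + t.
    exact: (PW_cvg x xD _ fE).
  apply: filterS2 nD NE => y yD ->; have [_ _ Wp _ _] := Wv _ (pr_e y yD).
  have /andP[y0 _] := yD.
  rewrite Wp (polar_rootX q kap0 y0) rmorphM fmorphV.
  exact: mul_chart_value.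
Unshelve. all: by end_near. Qed.

End Radius.

End Puncture.

Lemma puncture_cone_angle (m_gt : forall i, -4 < m i) i :
  has_cone_angle [set chartS c m B; chartN c m B] (c i) ((m i + 4)%:~R * (pi / 2)).
Proof.
have [q qE] : exists q : nat, m i + 3 = q%:Z.
  have : 0 <= m i + 3 by have := m_gt i; rewrite -lezD1; lra.
  by case: (m i + 3) => // q _; exists q.
have mi : m i = q%:Z - 3 by rewrite -qE addrK.
have [rho rho01 rhoP] := puncture_radius i.
have -> : m i + 4 = q.+1%:Z by rewrite mi (intS q); ring.
exact: (puncture_cone_angle_radius mi rho01 rhoP).
Qed.

End ConeAngle.

(** * Generic frames *)

Section FrameChoice.
Variable R : realType.
Implicit Types (s t : R) (v : 'rV[R]_3) (x y : S2 R).

Let frame_norm s t : R := 1 + s ^+ 2 + t ^+ 2.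

Let frame_norm_neq0 s t : frame_norm s t != 0.
Proof. by rewrite gt_eqF// /frame_norm; have := sqr_ge0 s; have := sqr_ge0 t; lra. Qed.

Let frame_coef s t (k l : nat) : R := (nth [::]
  [:: [:: 1 + s ^+ 2 - t ^+ 2; 2 * s * t; - 2 * t];
      [:: 2 * s * t; 1 - s ^+ 2 + t ^+ 2; 2 * s];
      [:: 2 * t; - 2 * s; 1 - s ^+ 2 - t ^+ 2]] k)`_l.

(* The rotation of the unit quaternion proportional to 1 + s i + t j. *)
Definition quat_frame s t : 'M[R]_3 :=
  \matrix_(k, l) (frame_coef s t k l / frame_norm s t).

Lemma so3_quat_frame s t : so3 (quat_frame s t).
Proof.
have N0 := frame_norm_neq0 s t; split.
  by apply/matrixP => k l; rewrite !mxE sum3 !mxE /frame_coef;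
    case: (ord3P k) => ->; case: (ord3P l) => -> /=;
    rewrite /frame_norm in N0 *; field.
by rewrite det_mx3 !mxE /frame_coef /=; rewrite /frame_norm in N0 *; field.
Qed.

Lemma crd_quat_frame s t k x : crd (quat_frame s t) k x = (set_val x 0 0 * frame_coef s t k 0 +
  set_val x 0 1 * frame_coef s t k 1 + set_val x 0 2 * frame_coef s t k 2) / frame_norm s t.
Proof. by rewrite /crd mxE sum3 !mxE; field; exact: frame_norm_neq0. Qed.

Definition cross3 (u v : 'rV[R]_3) : 'rV[R]_3 := \row_(k < 3)
  [:: u 0 1 * v 0 2 - u 0 2 * v 0 1; u 0 2 * v 0 0 - u 0 0 * v 0 2;
      u 0 0 * v 0 1 - u 0 1 * v 0 0]`_k.

(** The pairing of [v] with the third row of [quat_frame s t], cleared of the denominator. *)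
Let axis s t v := v 0 0 * frame_coef s t 2 0 + v 0 1 * frame_coef s t 2 1 +
  v 0 2 * frame_coef s t 2 2.

(** A rotation preserves cross products, and the left side is the third coordinate of the cross
    product in the rotated frame. If the projections of two points are parallel, the axis is thus
    orthogonal to their cross product. *)
Lemma numS_cross s t x y :
  crd (quat_frame s t) 0 x * crd (quat_frame s t) 1 y -
  crd (quat_frame s t) 1 x * crd (quat_frame s t) 0 y =
  axis s t (cross3 (set_val x) (set_val y)) / frame_norm s t.
Proof.
have N0 := frame_norm_neq0 s t.
rewrite !crd_quat_frame /axis /cross3 !mxE /frame_coef /=.
by rewrite /frame_norm in N0 *; field.
Qed.

Lemma cross3_eq0 x y : cross3 (set_val x) (set_val y) = 0 ->
  x = y \/ set_val x = - set_val y.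
Proof.
move=> /rowP H; have := H 0; have := H 1; have := H 2; rewrite !mxE /=.
have := sphere_sqr x; have := sphere_sqr y; rewrite /dot !sum3.
set x0 := set_val x 0 0; set x1 := set_val x 0 1; set x2 := set_val x 0 2.
set y0 := set_val y 0 0; set y1 := set_val y 0 1; set y2 := set_val y 0 2.
move=> yy xx h2 h1 h0; pose e := x0 * y0 + x1 * y1 + x2 * y2.
have e0 : x0 = e * y0.
  transitivity (x0 * (y0 * y0 + y1 * y1 + y2 * y2) - y1 * (x0 * y1 - x1 * y0) +
    y2 * (x2 * y0 - x0 * y2)); first by rewrite yy h2 h1; ring.
  by rewrite /e; ring.
have e1 : x1 = e * y1.
  transitivity (x1 * (y0 * y0 + y1 * y1 + y2 * y2) + y0 * (x0 * y1 - x1 * y0) -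
    y2 * (x1 * y2 - x2 * y1)); first by rewrite yy h2 h0; ring.
  by rewrite /e; ring.
have e2 : x2 = e * y2.
  transitivity (x2 * (y0 * y0 + y1 * y1 + y2 * y2) - y0 * (x2 * y0 - x0 * y2) +
    y1 * (x1 * y2 - x2 * y1)); first by rewrite yy h1 h0; ring.
  by rewrite /e; ring.
have ee : e ^+ 2 = 1.
  transitivity (e ^+ 2 * (y0 * y0 + y1 * y1 + y2 * y2)); first by rewrite yy mulr1.
  by rewrite -[RHS]xx {1 2}e0 {1 2}e1 {1 2}e2; ring.
have row3 (u v : 'rV[R]_3) : u 0 0 = v 0 0 -> u 0 1 = v 0 1 -> u 0 2 = v 0 2 -> u = v.
  by move=> *; apply/rowP => k; case: (ord3P k) => ->.
move: ee => /eqP; rewrite sqrf_eq1 => /orP[/eqP e_1|/eqP e_1]; [left|right].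
  by apply: val_inj; apply: row3; rewrite -/x0 -/x1 -/x2 ?e0 ?e1 ?e2 e_1 mul1r.
by apply: row3; rewrite !mxE -/x0 -/x1 -/x2 ?e0 ?e1 ?e2 e_1 mulN1r.
Qed.

(** An axis that is not orthogonal to [w] cannot be parallel to [v]; in this way the condition that
    the axis avoids the punctures gets the same form as the other one. *)
Lemma orthogonal_ex v : exists2 w : 'rV[R]_3, w != 0 &
  w 0 0 * v 0 0 + w 0 1 * v 0 1 + w 0 2 * v 0 2 = 0.
Proof.
have [v0|v0] := eqVneq (v 0 0) 0.
  exists (\row_(k < 3) [:: 1; 0; 0]`_k); last by rewrite !mxE /= v0; ring.
  by apply/negP => /eqP/rowP/(_ 0); rewrite !mxE /= => /eqP; rewrite oner_eq0.
exists (\row_(k < 3) [:: - v 0 1; v 0 0; 0]`_k); last by rewrite !mxE /=; ring.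
by apply/negP => /eqP/rowP/(_ 1); rewrite !mxE /= => /eqP; rewrite (negbTE v0).
Qed.

(** On the curve (t, t^2) the pairing is a polynomial in one variable whose coefficients determine
    [v]. On a straight line through the origin of the parameter plane some [v] would be lost. *)
Let axis_poly v : {poly R} :=
  Poly [:: v 0 2; - (2 * v 0 1); 2 * v 0 0 - v 0 2; 0; - v 0 2].

Let axis_polyE v t : (axis_poly v).[t] = axis t (t ^+ 2) v.
Proof. by rewrite horner_Poly /axis /frame_coef /=; ring. Qed.

Let axis_poly_neq0 v : v != 0 -> axis_poly v != 0.
Proof.
apply: contra_neq => /polyP p0; have := p0 0%N; have := p0 1%N; have := p0 2%N.
rewrite !coef_Poly !coef0 /= => h2 h1 h0; apply/rowP => k; rewrite mxE.
case: (ord3P k) => ->; lra.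
Qed.

Lemma poly_nonroot (p : {poly R}) : p != 0 -> exists t, p.[t] != 0.
Proof.
move=> p0; apply: contrapT => H.
pose rs : seq R := [seq l%:R | l <- iota 0 (size p)].
have urs : uniq rs by rewrite map_inj_uniq ?iota_uniq// => i j /eqP; rewrite eqr_nat => /eqP.
have rrs : all (root p) rs.
  by apply/allP => t _; apply: contraT => h; exfalso; apply: H; exists t.
by have := max_poly_roots p0 rrs urs; rewrite size_map size_iota ltnn.
Qed.

(** Finitely many nonzero polynomials have a common non-root. Vanishing [v i], such as the cross
    product of a puncture with itself, are replaced by the factor 1. *)
Lemma axis_avoid (I J : finType) (v : I -> 'rV[R]_3) (w : J -> 'rV[R]_3) :
  (forall j, w j != 0) -> exists s t,
    (forall i, v i != 0 -> axis s t (v i) != 0) /\ forall j, axis s t (w j) != 0.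
Proof.
move=> w0; pose p := (\prod_i (if v i == 0 then 1 else axis_poly (v i))) *
  \prod_j axis_poly (w j).
have [|t] := @poly_nonroot p.
  rewrite mulf_neq0//; apply/prodf_neq0 => i _; last exact: axis_poly_neq0.
  have [_|vi] := eqVneq (v i) 0; first by rewrite oner_eq0.
  exact: axis_poly_neq0.
rewrite hornerM !horner_prod mulf_eq0 negb_or => /andP[/prodf_neq0 H1 /prodf_neq0 H2].
exists t, (t ^+ 2); split=> i; last by rewrite -axis_polyE; exact: H2.
by move=> vi; have := H1 i isT; rewrite (negbTE vi) axis_polyE.
Qed.

Variables (n : nat) (c : 'I_n -> S2 R).
Hypothesis c_inj : injective c.

(** For punctures on a common meridian the projection of one is a nonnegative multiple [lam] of that
    of the other, so the axis is orthogonal to their cross product. The choice of the axis leaves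
    only the case of a zero cross product, hence of antipodal points; but their projections are
    opposite, and lam + 1 > 0 would force both to vanish. *)
Lemma generic_frame_ex : exists B, generic_frame c B.
Proof.
have /choice[w Hw] : forall i, exists w : 'rV[R]_3, w != 0 /\
    w 0 0 * set_val (c i) 0 0 + w 0 1 * set_val (c i) 0 1 + w 0 2 * set_val (c i) 0 2 = 0.
  by move=> i; have [w w0 wc] := orthogonal_ex (set_val (c i)); exists w.
have [s [t [Hv Hw0]]] := axis_avoid
  (fun ij : 'I_n * 'I_n => cross3 (set_val (c ij.1)) (set_val (c ij.2)))
  (fun i => (Hw i).1).
pose B := quat_frame s t; have hB : so3 B := so3_quat_frame s t.
have N0 := frame_norm_neq0 s t.
(* A puncture on the axis is a multiple of the third row, and the vector [w i] orthogonal to it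
   would be orthogonal to the axis. *)
have crd2 i : crd B 0 (c i) = 0 -> crd B 1 (c i) = 0 -> False.
  move=> c0 c1; have S := crd_sqr (c i) hB.
  have c2 : crd B 2 (c i) != 0.
    by apply: contra_eq_neq S => ->; rewrite c0 c1 !expr0n /= !addr0 eq_sym oner_eq0.
  have xE l : set_val (c i) 0 l = crd B 2 (c i) * B 2 l.
    have -> : set_val (c i) = set_val (c i) *m B^T *m B.
      by rewrite -mulmxA (so3_orthoT hB) mulmx1.
    by rewrite mxE sum3 -/(crd B 0 (c i)) -/(crd B 1 (c i)) -/(crd B 2 (c i)) c0 c1 !mul0r !add0r.
  have := (Hw i).2; rewrite !xE => h.
  have := Hw0 i; apply/negP/negPn/eqP.
  apply: (mulfI c2); apply: (mulIf (_ : (frame_norm s t)^-1 != 0)); first by rewrite invr_eq0.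
  rewrite mulr0 mul0r -[RHS]h /axis !mxE; field; exact: N0.
have D i : denS B (c i) != 0 /\ 1 - crd B 2 (c i) != 0.
  have S := crd_sqr (c i) hB; apply/andP; rewrite -negb_or -mulf_eq0.
  apply/eqP => h; have Z : crd B 0 (c i) ^+ 2 + crd B 1 (c i) ^+ 2 = 0.
    by move: h; rewrite /denS => h; nra.
  have := sqr_ge0 (crd B 0 (c i)); have := sqr_ge0 (crd B 1 (c i)) => p1 p0.
  by apply: (crd2 i); apply/eqP; rewrite -sqrf_eq0 eq_le ?p0 ?p1 andbT; lra.
have gB : so3 B /\ forall i, denS B (c i) != 0 /\ denS (Bop B) (c i) != 0.
  split=> // i; have [D0 D1] := D i; split=> //.
  by have [_ _ E2] := crd_flip B (c i); rewrite /denS E2.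
exists B; split=> [||i j ij]; [exact: gB.1|exact: gB.2|].
apply: contraT => /slitNreal[]; rewrite cImN cReN => /eqP; rewrite oppr_eq0 => /eqP I0.
rewrite oppr_le0 => R0; set r := complex.Re _ in R0.
have rE : cinv c B j * cpos c B i = r%:C.
  by rewrite /r; case: (cinv c B j * cpos c B i) I0 => u v /= ->.
have Di := (D i).1; have Dj := (D j).1.
have Nj0 : numS B (c j) != 0.
  apply/eqP => h; apply: (crd2 j); first by have := congr1 (@complex.Re R) h.
  by have := congr1 (@complex.Im R) h.
have lamE : numS B (c i) = (r * denS B (c i) / denS B (c j))%:C * numS B (c j).
  have Dic := real_neq0 Di; have Djc := real_neq0 Dj.
  have : cpos c B i = r%:C * cpos c B j.
    have pj : cpos c B j != 0 by rewrite /cpos /stereo mulf_neq0// invr_eq0.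
    by rewrite -rE /cinv mulrAC mulVf// mul1r.
  rewrite /cpos /stereo => h.
  rewrite -[LHS](divfK Dic) h !rmorphM fmorphV /=; field; exact: Djc.
set lam := r * _ / _ in lamE.
have lam0 : 0 <= lam.
  by rewrite divr_ge0 ?mulr_ge0// ltW// (denS_gt0 hB).
have e0 : crd B 0 (c i) = lam * crd B 0 (c j).
  by have := congr1 (@complex.Re R) lamE; rewrite realM_ReIm.
have e1 : crd B 1 (c i) = lam * crd B 1 (c j).
  by have := congr1 (@complex.Im R) lamE; rewrite realM_ReIm.
have := numS_cross s t (c i) (c j); rewrite -/B e0 e1.
have -> : lam * crd B 0 (c j) * crd B 1 (c j) - lam * crd B 1 (c j) * crd B 0 (c j) = 0.
  by ring.
move=> /esym/eqP; rewrite mulf_eq0 invr_eq0 (negbTE N0) orbF => ax.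
have [v0|v0] := eqVneq (cross3 (set_val (c i)) (set_val (c j))) 0; last first.
  by have := Hv (i, j) v0; rewrite /= ax.
have [cc|cc] := cross3_eq0 v0; first by rewrite (c_inj cc) eqxx in ij.
have crdN k : crd B k (c i) = - crd B k (c j) by rewrite /crd cc mulNmx mxE.
exfalso; apply: (crd2 j).
  have : (lam + 1) * crd B 0 (c j) = 0 by rewrite mulrDl -e0 crdN mul1r addNr.
  by move=> /eqP; rewrite mulf_eq0 gt_eqF ?ltr_wpDl//= => /eqP.
have : (lam + 1) * crd B 1 (c j) = 0 by rewrite mulrDl -e1 crdN mul1r addNr.
by move=> /eqP; rewrite mulf_eq0 gt_eqF ?ltr_wpDl//= => /eqP.
Qed.

End FrameChoice.

Local Close Scope complex_scope.

Theorem proposition3p7 (R : realType) (n : nat) (c : 'I_n -> S2 R)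
  (c_inj : injective c)
  (m : 'I_n -> int) (m_gt : forall i, -4 < m i) (m_sum : \sum_i m i = -8)
  (rho : {additive H1 R (punctured c) -> 'Z_4})
  (rhoP : forall (i : 'I_n) (g : loop R (punctured c)),
    small_positive_loop i g -> rho (loop_class g) = (m i)%:~R) :
  exists A : atlas R, seamless (range c) A /\ has_signature A m rho.
Proof.
have [B gB] := generic_frame_ex c_inj.
exists [set chartS c m B; chartN c m B]; split; last first.
  split=> [i|g]; first exact: puncture_cone_angle.
  exact: loop_holonomy.
split.
- by move=> f [->|->]; [exact: chartS_is_chart|exact: chartN_is_chart].
- move=> p /(regSN_cover gB)[pS|pN].
    by exists (chartS c m B) => //; left.
  by exists (chartN c m B) => //; right.
- move=> f g p [->|->] [->|->] fp gp.
  + by exists 0; exact: transition_refl.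
  + by exists (turn c m B p); exact: transitionSN.
  + by exists (- turn c m B p); exact: transitionNS.
  + by exists 0; exact: transition_refl.
- move=> _ [i _ <-]; have := puncture_cone_angle gB m_sum m_gt i.
  have : 0 <= m i + 4 by rewrite -[4]opprK subr_ge0 ltW.
  by case: (m i + 4) => // k _; exists k.
Qed.
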